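(* (Moments formula.) For any $n\in\mathbb N$ and any $f^{(n)}\in B_0(T^n\to\mathbb C)$, $$\tau(\langle f^{(n)},\omega^{\otimes n}\rangle)=\sum_{\mathcal V\in\mathcal P^{(n)}_{\ge2}}\int_{T^n}f^{(n)}(t_1,\dots,t_n)\,Q(\mathcal V;t_1,\dots,t_n)\prod_{B\in\mathcal V}\lambda^{|B|-2}\,\delta(dt_B).$$ Here $\mathcal P^{(n)}_{\ge2}$ is the collection of all partitions $\mathcal V$ of $\{1,\dots,n\}$ all of whose blocks have at least two elements; for $B=\{i_1,\dots,i_k\}$ ($k\ge2$), $\delta(dt_B):=\delta(dt_{i_1}\times\dots\times dt_{i_k})$ where $\delta(ds_1\times\dots\times ds_k)$ is the measure on $(T^k,\mathcal B(T^k))$ given by $$\int_{T^k}g^{(k)}(s_1,\dots,s_k)\,\delta(ds_1\times\dots\times ds_k):=\int_Tg^{(k)}(s,s,\dots,s)\,\sigma(ds);$$ and $$Q(\mathcal V;t_1,\dots,t_n):=\prod_{\substack{B_1,B_2\in\mathcal V\\ \min B_1<\min B_2<\max B_1<\max B_2}}Q(t_{\min B_2},t_{\max B_1}).$$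
   Context: $T$ is a locally compact Polish space with Borel $\sigma$-algebra $\mathcal B(T)$, and $\sigma$ is a Radon non-atomic measure on $T$. $A\in\mathcal B(T^2)$ is a symmetric set containing the diagonal, with $\sigma^{\otimes2}(A)=0$; $Q:T^2\setminus A\to\{z\in\mathbb C:|z|=1\}$ is measurable with $Q(s,t)=\overline{Q(t,s)}$ (values of $Q$ on $A$ do not matter). $\lambda\in\mathbb R$ is fixed; $\lambda^0:=1$ (also for $\lambda=0$). $B_0(T)$: real-valued bounded Borel functions on $T$ with compact support; $B_0(T^n\to\mathbb C)$: complex-valued bounded Borel functions on $T^n$ with compact support. $\mathcal H_{\mathbb C}:=L^2(T\to\mathbb C,\sigma)$, $\mathcal H_{\mathbb C}^{\otimes n}=L^2(T^n\to\mathbb C,\sigma^{\otimes n})$. On $\mathcal H_{\mathbb C}^{\otimes n}$ let $(\Psi_jf)(t_1,\dots,t_n)=Q(t_j,t_{j+1})f(t_1,\dots,t_{j+1},t_j,\dots,t_n)$; these extend to a unitary representation $\pi\mapsto\Psi_\pi$ of $S_n$ with $\Psi_{(j,j+1)}=\Psi_j$. $P_n:=\frac1{n!}\sum_{\pi\in S_n}\Psi_\pi$ (an orthogonal projection), $\mathcal H_{\mathbb C}^{\circledast n}:=P_n\mathcal H_{\mathbb C}^{\otimes n}$, $\mathcal H_{\mathbb C}^{\circledast0}:=\mathbb C$. $\mathcal F^Q(\mathcal H):=\bigoplus_{n\ge0}\mathcal H_{\mathbb C}^{\circledast n}n!$ (so $\|F\|^2=\sum_nn!\|f^{(n)}\|^2$),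 $\Omega:=(1,0,0,\dots)$, and $\mathcal F^Q_{\mathrm{fin}}(\mathcal H)$ is the subspace of finite sequences (convergence: uniformly finitely many non-zero components and componentwise convergence). For $f\in B_0(T)$ and $f^{(m)}\in\mathcal H_{\mathbb C}^{\circledast m}$: $a^+(f)f^{(m)}:=P_{m+1}(f\otimes f^{(m)})$; $a^-(f)$ is the restriction of $a^+(f)^*$ to $\mathcal F^Q_{\mathrm{fin}}(\mathcal H)$; $(a^0(f)f^{(m)})(t_1,\dots,t_m):=(f(t_1)+\dots+f(t_m))f^{(m)}(t_1,\dots,t_m)$. Put $\langle f,\omega\rangle:=a^+(f)+\lambda a^0(f)+a^-(f)$. For $f_i\in B_0(T)$, $\langle f_1\otimes\dots\otimes f_n,\omega^{\otimes n}\rangle:=\langle f_1,\omega\rangle\dotsm\langle f_n,\omega\rangle$. This is extended (by linearity and continuity) to operators $\langle f^{(n)},\omega^{\otimes n}\rangle$ on $\mathcal F^Q_{\mathrm{fin}}(\mathcal H)$, $f^{(n)}\in B_0(T^n\to\mathbb C)$: linear in $f^{(n)}$, and if $f_j\to f$ pointwise with $(f_j)$ uniformly bounded and supported in a common compact set, then $\langle f_j,\omega^{\otimes n}\rangle F\to\langle f,\omega^{\otimes n}\rangle F$ in $\mathcal F^Q_{\mathrm{fin}}(\mathcal H)$ for all $F$. The vacuum state is $\tau(p):=(p\Omega,\Omega)_{\mathcal F^Q(\mathcal H)}$. *)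

(* Defs.v *)
From HB Require Import structures.
From mathcomp Require Import all_boot all_order all_algebra all_fingroup.
From mathcomp Require Import all_classical all_reals all_analysis.
From mathcomp Require Import complex.
From mathcomp Require Import zify.

Set Implicit Arguments.
Unset Strict Implicit.
Unset Printing Implicit Defensive.

Import Order.TTheory GRing.Theory Num.Theory.
Import numFieldNormedType.Exports.
Import Normc.

Local Open Scope classical_set_scope.
Local Open Scope ring_scope.

Notation borel T := (g_sigma_algebraType (@open T)).

Definition polish_space (R : realType) (T : topologicalType) : Prop :=
  (exists2 D : set T, countable D & dense D) /\
  exists dist : T -> T -> R,
    [/\ forall x y, 0 <= dist x y /\ (dist x y = 0 <-> x = y),
        forall x y, dist x y = dist y x,
        forall x y z, dist x z <= dist x y + dist y z,
        forall (x : T) (V : set T),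
          nbhs x V <-> exists2 e, 0 < e & [set y | dist x y < e] `<=` V
      & forall u : nat -> T,
          (forall e, 0 < e -> exists N : nat, forall i j,
             (N <= i)%N -> (N <= j)%N -> dist (u i) (u j) < e) ->
          exists l : T, u @ \oo --> l].

Definition radon_measure (R : realType) (T : ptopologicalType)
    (sigma : set (borel T) -> \bar R) : Prop :=
  (forall K : set T, compact K -> (sigma K < +oo)%E) /\
  (forall B : set (borel T), measurable B ->
     sigma B = ereal_sup [set sigma K | K in [set K : set T |
                                           compact K /\ K `<=` B]]).

Definition atom d (X : measurableType d) (R : realType)
    (mu : set X -> \bar R) (E : set X) : Prop :=
  [/\ measurable E, (0 < mu E)%E
    & forall B, measurable B -> B `<=` E -> mu B = 0%E \/ mu (E `\` B) = 0%E].

Definition non_atomic d (X : measurableType d) (R : realType)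
    (mu : set X -> \bar R) : Prop := forall E, ~ atom mu E.

Section tuple_measures.
Context d (X : measurableType d) (R : realType).

Definition tcons n (p : X * n.-tuple X) : n.+1.-tuple X :=
  [tuple of p.1 :: p.2].

Lemma measurable_tcons n : measurable_fun [set: X * n.-tuple X] (@tcons n).
Proof. by apply: measurable_cons. Qed.

Variable sigma : {sigma_finite_measure set X -> \bar R}.

Section step.
Variables (n : nat) (m : {sigma_finite_measure set (n.-tuple X) -> \bar R}).

Definition tuple_measureS : set (n.+1.-tuple X) -> \bar R :=
  pushforward (sigma \x m)%E (@tcons n).

Let M : {measure set (n.+1.-tuple X) -> \bar R} :=
  measure_function_pushforward__canonical__measure_function_Measure
    (sigma \x m)%E (@measurable_tcons n).

HB.instance Definition _ := isMeasure.Build _ _ _ tuple_measureS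
  (measure0 M) (measure_ge0 M) (@measure_semi_sigma_additive _ _ _ M).

Let tuple_measureS_sigma_finite : sigma_finite setT tuple_measureS.
Proof.
have /sigma_finiteP[F [TF ndF Foo]] := sigma_finiteT sigma.
have /sigma_finiteP[G [TG ndG Goo]] := sigma_finiteT m.
pose g (t : n.+1.-tuple X) : X * n.-tuple X := (thead t, [tuple of behead t]).
have mg : measurable_fun setT g.
  by apply: measurable_fun_pair; [exact: measurable_tnth|exact: measurable_behead].
have tconsK : cancel (@tcons n) g.
  by move=> [x t]; rewrite /g /tcons /=; congr pair; exact: val_inj.
exists (fun i => g @^-1` (F i `*` G i)).
  rewrite -preimage_bigcup; apply/seteqP; split => // t _.
  have [i _ Fi] : (\bigcup_i F i) (g t).1 by rewrite -TF.
  have [j _ Gj] : (\bigcup_i G i) (g t).2 by rewrite -TG.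
  exists (maxn i j) => //; split.
    by move: Fi; exact/subsetPset/ndF/leq_maxl.
  by move: Gj; exact/subsetPset/ndG/leq_maxr.
move=> i; have [mF {}Foo] := Foo i; have [mG {}Goo] := Goo i.
split.
  by rewrite -[X in measurable X]setTI; apply: mg => //; exact: measurableX.
rewrite /tuple_measureS /pushforward -comp_preimage.
rewrite (_ : g \o @tcons n = id); last by apply/funext => x; exact: tconsK.
rewrite preimage_id product_measure1E//.
by rewrite lte_mul_pinfty// ge0_fin_numE.
Qed.

HB.instance Definition _ :=
  Measure_isSigmaFinite.Build _ _ _ tuple_measureS tuple_measureS_sigma_finite.

End step.

Fixpoint tuple_measure n : {sigma_finite_measure set (n.-tuple X) -> \bar R} :=
  match n with
  | 0 => \d_([tuple] : 0.-tuple X)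
  | n.+1 => tuple_measureS (tuple_measure n)
  end.

End tuple_measures.

Section partition_measures.
Context d (X : measurableType d) (R : realType).
Variable sigma : {sigma_finite_measure set X -> \bar R}.

Lemma tuple_measure_box n (E : 'I_n -> set X) :
  (forall i, measurable (E i)) ->
  tuple_measure sigma n [set t | forall i, E i (tnth t i)] =
  (\prod_(i < n) sigma (E i))%E.
Proof.
elim: n E => [|n IHn] E mE.
  rewrite big_ord0 /= diracE mem_set//= => -[]//.
rewrite big_ord_recl -(IHn (fun i => E (lift ord0 i)))//.
rewrite /= /tuple_measureS /pushforward -product_measure1E//; last first.
  rewrite (_ : [set _ | _] = \bigcap_(i in [set: 'I_n])
      (fun t => tnth t i) @^-1` E (lift ord0 i)).
    apply: fin_bigcap_measurable => [|i _]; first exact: finite_finset.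
    by rewrite -[X in measurable X]setTI; exact: measurable_tnth.
  by apply/seteqP; split => [t tE i _|t tE i]; [exact: tE|exact: (tE i)].
congr (_ _); apply/seteqP; split => -[x t] /=.
  move=> H; split; first by have := H ord0; rewrite tnth0.
  by move=> i; have := H (lift ord0 i); rewrite tnthS.
move=> [Ex Et] i; case: (unliftP ord0 i) => [j|] ->; last by rewrite tnth0.
by rewrite tnthS.
Qed.

(* The measure [delta(ds_1 x ... x ds_k)]: integrating [g] against it is
   integrating [g (s, ..., s)] against [sigma]. *)
Definition delta k : set (k.-tuple X) -> \bar R :=
  pushforward sigma (fun s => [tuple s | _ < k]).

(* [spread V s] puts the k-th entry of [s] at all the positions of the k-th
   block of the partition [V]. *)
Definition spread n (V : {set {set 'I_n}}) (s : #|V|.-tuple X) : n.-tuple X :=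
  [tuple nth point s (index (finset.pblock V i) (enum V)) | i < n].

Lemma measurable_spread n (V : {set {set 'I_n}}) :
  measurable_fun setT (@spread n V).
Proof.
apply/measurable_fun_tnthP => i.
have [iV|iV] := ltnP (index (finset.pblock V i) (enum V)) #|V|.
  rewrite (_ : _ \o _ = fun s : #|V|.-tuple X => tnth s (Ordinal iV)).
    exact: measurable_tnth.
  by apply/funext => s /=; rewrite tnth_mktuple (tnth_nth point).
rewrite (_ : _ \o _ = cst point); first exact: measurable_cst.
by apply/funext => s /=; rewrite tnth_mktuple nth_default// size_tuple.
Qed.

Section delta_partition.
Variables (n : nat) (V : {set {set 'I_n}}).

Definition delta_partition : set (n.-tuple X) -> \bar R :=
  pushforward (tuple_measure sigma #|V|) (@spread n V).

Let M : {measure set (n.-tuple X) -> \bar R} :=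
  measure_function_pushforward__canonical__measure_function_Measure
    (tuple_measure sigma #|V|) (@measurable_spread n V).

HB.instance Definition _ := isMeasure.Build _ _ _ delta_partition
  (measure0 M) (measure_ge0 M) (@measure_semi_sigma_additive _ _ _ M).

End delta_partition.

(* [delta_partition V] is the product, over the blocks B of V, of the measures
   [delta] on the coordinates in B: *)
Lemma delta_partition_box n (V : {set {set 'I_n}}) (E : 'I_n -> set X) :
  finset.partition V [set: 'I_n]%SET -> (forall i, measurable (E i)) ->
  delta_partition V [set t | forall i, E i (tnth t i)] =
  (\prod_(B in V)
     delta [set t : #|B|.-tuple X | forall k, E (enum_val k) (tnth t k)])%E.
Proof.
move=> partV mE; have [covV triV V0] := and3P partV.
rewrite /delta_partition /pushforward.
pose F (k : 'I_#|V|) := \bigcap_(i in [set` enum_val k]) E i.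
have -> : @spread n V @^-1` [set t | forall i, E i (tnth t i)] =
    [set s | forall k, F k (tnth s k)].
  apply/seteqP; split => s /= H.
    move=> k i /= ik; have := H i; rewrite tnth_mktuple.
    rewrite (finset.def_pblock triV (enum_valP k) ik).
    by rewrite (enum_val_nth finset.set0) index_uniq ?enum_uniq -?cardE// -tnth_nth.
  move=> i; rewrite tnth_mktuple.
  have iV : i \in finset.cover V by rewrite (eqP covV) inE.
  have pV := finset.pblock_mem iV.
  have kV : (index (finset.pblock V i) (enum V) < #|V|)%N.
    by rewrite cardE index_mem mem_enum.
  rewrite -[index _ _]/(val (Ordinal kV)) -tnth_nth; apply: H => /=.
  by rewrite (enum_val_nth finset.set0) /= nth_index ?mem_enum// finset.mem_pblock.
rewrite tuple_measure_box; last first.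
  by move=> k; apply: fin_bigcap_measurable => //; exact: finite_finset.
rewrite (big_enum_val (fun B : {set _} =>
  delta [set t : #|B|.-tuple X | forall k, E (enum_val k) (tnth t k)])).
apply: eq_bigr => k _; congr (sigma _).
apply/seteqP; split => s /= H.
  by move=> i; rewrite tnth_mktuple; apply: H; exact: enum_valP.
move=> i /= ik; have := H (enum_rank_in ik i).
by rewrite tnth_mktuple enum_rankK_in.
Qed.

End partition_measures.

Section complex_functions.
Context d (X : measurableType d) (R : realType).

Definition cmeasurable (D : set X) (f : X -> R[i]) : Prop :=
  measurable_fun D (fun x => complex.Re (f x)) /\
  measurable_fun D (fun x => complex.Im (f x)).

Variable mu : {measure set X -> \bar R}.

Definition cintegral (f : X -> R[i]) : R[i] :=
  Complex (\int[mu]_x complex.Re (f x)) (\int[mu]_x complex.Im (f x)).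

Definition sqnorm (f : X -> R[i]) : \bar R :=
  (\int[mu]_x ((normc (f x)) ^+ 2)%:E)%E.

(* Elements of L^2 are represented by functions, up to equality almost
   everywhere. *)
Definition square_integrable (f : X -> R[i]) : Prop :=
  cmeasurable setT f /\ (sqnorm f < +oo)%E.

Definition L2_inner (f g : X -> R[i]) : R[i] :=
  cintegral (fun x => f x * (g x)^*%C).

End complex_functions.

Section fock_space.
Context d (X : measurableType d) (R : realType).
Variable sigma : {sigma_finite_measure set X -> \bar R}.
Variable Q : X -> X -> R[i].

Section permutations.
Variable n : nat.

Definition permute (t : n.-tuple X) (pi : 'S_n) : n.-tuple X :=
  [tuple tnth t (pi i) | i < n].

Definition Qperm (pi : 'S_n) (t : n.-tuple X) : R[i] :=
  \prod_(ij : 'I_n * 'I_n | (ij.1 < ij.2)%N && ((pi^-1)%g ij.2 < (pi^-1)%g ij.1)%N)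
     Q (tnth t ij.1) (tnth t ij.2).

(* That this is the representation generated by the Psi_j is [Psi_adjacent],
   [Psi1] and [PsiM] below. *)
Definition Psi (pi : 'S_n) (f : n.-tuple X -> R[i]) : n.-tuple X -> R[i] :=
  fun t => Qperm pi t * f (permute t pi).

Definition Psym (f : n.-tuple X -> R[i]) : n.-tuple X -> R[i] :=
  fun t => (n`!%:R)^-1 * \sum_(pi : 'S_n) Psi pi f t.

Definition Q_symmetric (f : n.-tuple X -> R[i]) : Prop :=
  square_integrable (tuple_measure sigma n) f /\
  exists2 g, square_integrable (tuple_measure sigma n) g &
    f = Psym g %[ae tuple_measure sigma n].

Lemma Psi_adjacent (i j : 'I_n) (f : n.-tuple X -> R[i]) (t : n.-tuple X) :
  j = i.+1 :> nat ->
  Psi (tperm i j) f t = Q (tnth t i) (tnth t j) * f (permute t (tperm i j)).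
Proof.
move=> ij; rewrite /Psi /Qperm; congr (_ * _).
rewrite (big_pred1 (i, j))// => -[a b] /=.
rewrite tpermV !permE /= !(fun_if (@nat_of_ord n)) xpair_eqE -!val_eqE /=.
by do ?case: eqP => /=; lia.
Qed.

Lemma Psi1 (f : n.-tuple X -> R[i]) : Psi 1%g f = f.
Proof.
apply/funext => t; rewrite /Psi /Qperm big_pred0 ?mul1r.
  by congr f; apply: eq_from_tnth => i; rewrite tnth_mktuple perm1.
by move=> [i j] /=; rewrite invg1 !perm1; lia.
Qed.

(* The product of ['S_n] is composition in diagrammatic order. *)
Lemma PsiM (pi rho : 'S_n) (f : n.-tuple X -> R[i]) :
  (forall s t, Q s t * Q t s = 1) ->
  Psi (rho * pi)%g f = Psi pi (Psi rho f).
Proof.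
move=> QK; apply/funext => t; rewrite /Psi mulrA; congr (_ * _); last first.
  by congr f; apply: eq_from_tnth => i; rewrite !tnth_mktuple permM.
rewrite /Qperm (reindex_inj (h := fun ij => ((pi^-1)%g ij.1, (pi^-1)%g ij.2))
  (P := fun ij => _ && ((rho^-1)%g ij.2 < _)%N)) /=; last first.
  by move=> [a b] [c e] /= [/perm_inj-> /perm_inj->].
under [X in _ = _ * X]eq_bigr do rewrite !tnth_mktuple !permKV.
rewrite [X in _ = _ * X](bigID (fun ij : 'I_n * 'I_n => ij.1 < ij.2)%N) /=.
rewrite [X in _ = _ * (_ * X)](reindex_inj (h := fun ij : 'I_n * 'I_n => (ij.2, ij.1))) /=; last first.
  by move=> [a b] [c e] /= [-> ->].
rewrite mulrCA; under [in LHS]eq_bigl do rewrite invMg !permM.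
rewrite [LHS]big_mkcond [X in _ = X * _]big_mkcond.
rewrite [X in _ = _ * (X * _)]big_mkcond [X in _ = _ * (_ * X)]big_mkcond.
rewrite -[X in _ = _ * X]big_split -big_split /=.
apply: eq_bigr => -[a b] _ /=.
have pE : (pi^-1%g a == pi^-1%g b :> nat) = (a == b).
  by rewrite (inj_eq val_inj) (inj_eq perm_inj).
have rE : (rho^-1%g (pi^-1%g a) == rho^-1%g (pi^-1%g b) :> nat) = (a == b).
  by rewrite (inj_eq val_inj) (inj_eq perm_inj) (inj_eq perm_inj).
move: pE rE; rewrite -(inj_eq val_inj) /=.
case: (ltngtP a b) => _; case: (ltngtP (pi^-1%g a) _) => //= _;
  by case: ltngtP => //= _ _ _; rewrite ?mul1r ?mulr1 ?QK.
Qed.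

End permutations.

Definition fock_vector := forall n, n.-tuple X -> R[i].

Definition fock_eq (F G : fock_vector) : Prop :=
  forall n, F n = G n %[ae tuple_measure sigma n].

Definition fock (F : fock_vector) : Prop :=
  (forall n, Q_symmetric (F n)) /\
  (\sum_(0 <= n <oo) (n`!%:R)%:E * sqnorm (tuple_measure sigma n) (F n) < +oo)%E.

Definition fock_fin (F : fock_vector) : Prop :=
  (forall n, Q_symmetric (F n)) /\
  exists N : nat, forall n, (N <= n)%N ->
    F n = cst 0 %[ae tuple_measure sigma n].

Definition fock_inner (F G : fock_vector) : R[i] :=
  let S N := \sum_(n < N)
    n`!%:R * L2_inner (tuple_measure sigma n) (F n) (G n) in
  Complex (limn (fun N => complex.Re (S N))) (limn (fun N => complex.Im (S N))).

Definition fock_fin_cvg (F_ : nat -> fock_vector) (F : fock_vector) : Prop :=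
  (exists N : nat, forall n, (N <= n)%N -> forall j,
     F_ j n = cst 0 %[ae tuple_measure sigma n]) /\
  forall n, (fun j => sqnorm (tuple_measure sigma n)
                        (fun t => F_ j n t - F n t)) @ \oo --> 0%E.

Definition vacuum : fock_vector := fun n _ => (n == 0%N)%:R.

Definition fock_lin (c : R[i]) (F G : fock_vector) : fock_vector :=
  fun n t => c * F n t + G n t.

Definition vacuum_state (p : fock_vector -> fock_vector) : R[i] :=
  fock_inner (p vacuum) vacuum.

Definition creation (f : X -> R) (F : fock_vector) : fock_vector := fun n =>
  match n with
  | 0 => fun _ => 0
  | m.+1 => Psym (fun t : m.+1.-tuple X =>
              (f (thead t))%:C%C * F m [tuple of behead t])
  end.

Definition neutral (f : X -> R) (F : fock_vector) : fock_vector :=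
  fun n t => (\sum_(i < n) f (tnth t i))%:C%C * F n t.

(* [H] is a value at [G] of the adjoint of [creation f], the latter being
   defined on the space of finite sequences. *)
Definition creation_adjoint (f : X -> R) (G H : fock_vector) : Prop :=
  fock H /\
  forall F, fock_fin F -> fock_inner (creation f F) G = fock_inner F H.

(* Such an [H] is unique up to [fock_eq]. *)
Definition annihilation (f : X -> R) (G : fock_vector) : fock_vector :=
  xget (fun _ _ => 0) [set H | creation_adjoint f G H].

Variable lambda : R.

Definition field (f : X -> R) (F : fock_vector) : fock_vector := fun n t =>
  @creation f F n t + lambda%:C%C * @neutral f F n t + @annihilation f F n t.

Definition field_product n (f : 'I_n -> X -> R) (F : fock_vector) :
    fock_vector :=
  foldr (fun i G => field (f i) G) F (enum 'I_n).

End fock_space.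

Section exceptional_set.
Context d (X : measurableType d) (R : realType).

(* The values on the exceptional set do not matter; this choice makes the
   identities satisfied by [Q] hold everywhere. *)
Definition extendQ (A : set (X * X)) (Q : X -> X -> R[i]) : X -> X -> R[i] :=
  fun s t => if `[< A (s, t) >] then 1 else Q s t.

Lemma extendQV (A : set (X * X)) (Q : X -> X -> R[i]) :
  (forall s t, A (s, t) -> A (t, s)) ->
  (forall s t, ~ A (s, t) -> `|Q s t| = 1) ->
  (forall s t, ~ A (s, t) -> Q s t = (Q t s)^*%C) ->
  forall s t, extendQ A Q s t * extendQ A Q t s = 1.
Proof.
move=> As Q1 Qc s t; rewrite /extendQ.
case: asboolP => [Ast|nAst].
  by rewrite asboolT ?mulr1//; exact: As.
have nAts : ~ A (t, s) by move/As.
by rewrite asboolF// (Qc t s)// -sqr_normc Q1// expr1n.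
Qed.

End exceptional_set.

Section B0.
Context (R : realType) (T : ptopologicalType).

Definition B0 (f : borel T -> R) : Prop :=
  [/\ measurable_fun setT f, exists M : R, forall t, `|f t| <= M
    & exists2 K : set T, compact K & forall t, ~ K t -> f t = 0].

Definition bounded_supported n (M : R) (K : set {ptws 'I_n -> T})
    (f : n.-tuple (borel T) -> R[i]) : Prop :=
  (forall t, normc (f t) <= M) /\ (forall t, ~ K (tnth t) -> f t = 0).

Definition B0C n (f : n.-tuple (borel T) -> R[i]) : Prop :=
  cmeasurable setT f /\
  exists M, exists2 K, compact K & bounded_supported M K f.

Definition tensor n (f : 'I_n -> borel T -> R) : n.-tuple (borel T) -> R[i] :=
  fun t => (\prod_(i < n) f i (tnth t i))%:C%C.

End B0.

(* [W f], for [f] in B_0(T^n -> C), is the family of linear operators on the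
   space of finite sequences extending f_1 (x) ... (x) f_n |->
   <f_1, omega> ... <f_n, omega> by linearity and continuity. *)
Record monomial_operators (R : realType) (T : ptopologicalType)
    (sigma : {sigma_finite_measure set (borel T) -> \bar R})
    (Q : borel T -> borel T -> R[i]) (lambda : R) (n : nat)
    (W : (n.-tuple (borel T) -> R[i]) ->
         fock_vector (borel T) R -> fock_vector (borel T) R) : Prop :=
  MonomialOperators {
  monomial_fin : forall f F, B0C f -> fock_fin sigma Q F ->
    fock_fin sigma Q (W f F) ;
  monomial_eq : forall f F G, B0C f ->
    fock_fin sigma Q F -> fock_fin sigma Q G ->
    fock_eq sigma F G -> fock_eq sigma (W f F) (W f G) ;
  monomial_operator_linear : forall f c F G, B0C f ->
    fock_fin sigma Q F -> fock_fin sigma Q G ->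
    fock_eq sigma (W f (fock_lin c F G)) (fock_lin c (W f F) (W f G)) ;
  monomial_linear : forall f g c F, B0C f -> B0C g -> fock_fin sigma Q F ->
    fock_eq sigma (W (fun t => c * f t + g t) F)
                  (fock_lin c (W f F) (W g F)) ;
  monomial_tensor : forall (f : 'I_n -> borel T -> R) F,
    (forall i, B0 (f i)) -> fock_fin sigma Q F ->
    fock_eq sigma (W (tensor f) F) (field_product sigma Q lambda f F) ;
  monomial_continuous :
    forall (f_ : nat -> n.-tuple (borel T) -> R[i]) f M K F,
    (forall j, B0C (f_ j)) -> B0C f -> compact K ->
    (forall j, bounded_supported M K (f_ j)) ->
    (forall t, (fun j => normc (f_ j t - f t)) @ \oo --> (0 : R)) ->
    fock_fin sigma Q F ->
    fock_fin_cvg sigma (fun j => W (f_ j) F) (W f F) }.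

Definition partitions_ge2 n : {set {set {set 'I_n}}} :=
  [set V | finset.partition V [set: 'I_n]%SET &
           [forall B in V, (2 <= #|B|)%N]]%SET.

(* For nonempty B these are the least and the greatest element of B, so that the
   default [point] below is never reached on the blocks of a partition. *)
Definition minB n (B : {set 'I_n}) : nat := \big[minn/n]_(i in B) i.
Definition maxB n (B : {set 'I_n}) : nat := \max_(i in B) i.

Definition Qpartition d (X : measurableType d) (R : realType)
    (Q : X -> X -> R[i]) n (V : {set {set 'I_n}}) (t : n.-tuple X) : R[i] :=
  \prod_(B1 in V) \prod_(B2 in V |
      [&& minB B1 < minB B2, minB B2 < maxB B1 & maxB B1 < maxB B2]%N)
    Q (nth point t (minB B2)) (nth point t (maxB B1)).

(* Main.v *)
(* Every vector occurring in a product of field operators applied to the vacuum is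
   the symmetrization of an explicit unsymmetrized vector: adding a particle means
   tensoring with a function on the left, and the adjointness relation together with
   the decomposition of S_{n+1} into cosets of S_n shows that annihilation acts as
   [g |-> sum_j int f(s) Q(s,t_1)...Q(s,t_{j-1}) g(t_1,...,t_{j-1},s,t_j,...) ds].
   Since symmetrization is the identity on the vacuum component, no scalar products
   are left to compute.

   Applying the operators from the last one to the first one, each step opens a new
   block (creation), adds an element to an open block (the lambda term) or closes an
   open block (annihilation); closing a block at its minimum produces a factor Q for
   each open block created later, that is, for each crossing. The vacuum component is
   thus a sum over the partitions all of whose blocks have at least two elements,
   which are encoded by the map sending an element to the maximum of its block.
   This settles the case of tensors; both sides of the formula being linear and
   continuous for bounded pointwise convergence, a monotone class argument extends it
   to all bounded functions with compact support. *)

Require Import Defs.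
From HB Require Import structures.
From mathcomp Require Import all_boot all_order all_algebra all_fingroup.
From mathcomp Require Import all_classical all_reals all_analysis.
From mathcomp Require Import measurable_realfun complex.
From mathcomp Require Import zify ring lra.

Set Implicit Arguments.
Unset Strict Implicit.
Unset Printing Implicit Defensive.

Import Order.TTheory GRing.Theory Num.Theory.
Import numFieldNormedType.Exports.
Import Normc.

Local Open Scope classical_set_scope.
Local Open Scope ring_scope.

(** * Complex-valued integration *)

(** The obstacle is that [annihilation] is known only through its adjoint relation: [xget] returns
    some solution, so what is known of it holds up to null sets, while unsymmetrized vectors are
    genuine functions. The link is [represents], equality almost everywhere after symmetrization; it
    becomes pointwise at the end because the measure on 0-tuples is a Dirac mass. All unsymmetrized
    vectors are bounded and live on powers of one set K of finite measure, a class stable under the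
    three operators in which every integral is finite. The crossings come from the order of the
    variables: they are kept in increasing order of the maxima of the open blocks. Since the largest
    index acts first, a new block has the smallest label, and tensoring on the left puts its
    variable where it belongs. Removing the variable of b at index i then costs Q(s, t_c) for each
    open label c < b. In a term that survives in the vacuum component, the block of c still receives
    an element below i, so its minimum is less than i, and i < c < b is the rest of the crossing
    condition. *)

Section complex_numbers.
Variable R : realType.
Implicit Types z w : R[i].

Lemma ReD z w : complex.Re (z + w) = complex.Re z + complex.Re w.
Proof. by case: z w => a b [c d]. Qed.

Lemma ImD z w : complex.Im (z + w) = complex.Im z + complex.Im w.
Proof. by case: z w => a b [c d]. Qed.

Lemma ReM z w : complex.Re (z * w) =
  complex.Re z * complex.Re w - complex.Im z * complex.Im w.
Proof. by case: z w => a b [c d]. Qed.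

Lemma ImM z w : complex.Im (z * w) =
  complex.Re z * complex.Im w + complex.Im z * complex.Re w.
Proof. by case: z w => a b [c d]. Qed.

Lemma normc_ge0 z : 0 <= normc z.
Proof. by case: z => a b /=; exact: sqrtr_ge0. Qed.

Lemma sqr_normcE z : normc z ^+ 2 = complex.Re z ^+ 2 + complex.Im z ^+ 2.
Proof. by case: z => a b /=; rewrite sqr_sqrtr// addr_ge0 ?sqr_ge0. Qed.

Lemma Re_le_normc z : `|complex.Re z| <= normc z.
Proof.
case: z => a b /=; rewrite -sqrtr_sqr ler_wsqrtr// lerDl; exact: sqr_ge0.
Qed.

Lemma Im_le_normc z : `|complex.Im z| <= normc z.
Proof.
case: z => a b /=; rewrite -sqrtr_sqr ler_wsqrtr// lerDr; exact: sqr_ge0.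
Qed.

Lemma normc_le_ReIm z : normc z <= `|complex.Re z| + `|complex.Im z|.
Proof.
rewrite -(@ler_pXn2r _ 2) ?nnegrE ?addr_ge0 ?normc_ge0//.
rewrite sqr_normcE sqrrD !real_normK ?num_real// lerD2r lerDl.
by rewrite mulrn_wge0// mulr_ge0.
Qed.

Lemma normc_conj z : normc z^*%C = normc z.
Proof. by case: z => a b /=; rewrite sqrrN. Qed.

Lemma normc_real (x : R) : normc x%:C%C = `|x|.
Proof. by rewrite /= expr0n /= addr0 sqrtr_sqr. Qed.

Lemma mul_conjc z : z * z^*%C = (normc z ^+ 2)%:C%C.
Proof.
rewrite sqr_normcE; case: z => a b /=; apply/eqP; rewrite eq_complex /=.
by apply/andP; split; apply/eqP; ring.
Qed.

End complex_numbers.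

Section complex_measurability.
Context d (X : measurableType d) (R : realType).
Implicit Types f g : X -> R[i].
Local Notation cmeas := (@cmeasurable d X R setT).

Lemma cmeasurable_cst (c : R[i]) : cmeas (cst c).
Proof. by split; exact: measurable_cst. Qed.

Lemma cmeasurableD f g : cmeas f -> cmeas g -> cmeas (fun x => f x + g x).
Proof.
move=> [fr fi] [gr gi]; split.
  by under eq_fun do rewrite ReD; exact: measurable_funD.
by under eq_fun do rewrite ImD; exact: measurable_funD.
Qed.

Lemma cmeasurableM f g : cmeas f -> cmeas g -> cmeas (fun x => f x * g x).
Proof.
move=> [fr fi] [gr gi]; split.
  under eq_fun do rewrite ReM.
  by apply: measurable_funB; exact: measurable_funM.
under eq_fun do rewrite ImM.
by apply: measurable_funD; exact: measurable_funM.
Qed.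

Lemma cmeasurable_conj f : cmeas f -> cmeas (fun x => (f x)^*%C).
Proof.
move=> [fr fi]; split.
  by rewrite (_ : (fun _ => _) = fun x => complex.Re (f x))//; apply/funext => x; case: (f x).
rewrite (_ : (fun _ => _) = fun x => - complex.Im (f x)).
  exact: measurableT_comp.
by apply/funext => x; case: (f x).
Qed.

Lemma cmeasurable_real (u : X -> R) :
  measurable_fun setT u -> cmeas (fun x => (u x)%:C%C).
Proof. by move=> mu; split => //=; exact: measurable_cst. Qed.

Lemma cmeasurable_sum (I : Type) (s : seq I) (P : pred I) (h : I -> X -> R[i]) :
  (forall i, cmeas (h i)) -> cmeas (fun x => \sum_(i <- s | P i) h i x).
Proof.
move=> mh; elim: s => [|i s IH].
  by under eq_fun do rewrite big_nil; exact: cmeasurable_cst.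
under eq_fun do rewrite big_cons.
by case: (P i) => //; exact: cmeasurableD.
Qed.

Lemma cmeasurable_prod (I : Type) (s : seq I) (P : pred I) (h : I -> X -> R[i]) :
  (forall i, cmeas (h i)) -> cmeas (fun x => \prod_(i <- s | P i) h i x).
Proof.
move=> mh; elim: s => [|i s IH].
  by under eq_fun do rewrite big_nil; exact: cmeasurable_cst.
under eq_fun do rewrite big_cons.
by case: (P i) => //; exact: cmeasurableM.
Qed.

Lemma measurable_normc f : cmeas f -> measurable_fun setT (fun x => normc (f x)).
Proof.
move=> [fr fi].
rewrite (_ : (fun _ => _) = fun x =>
    Num.sqrt (complex.Re (f x) ^+ 2 + complex.Im (f x) ^+ 2)).
  apply: measurableT_comp.
    by apply: continuous_measurable_fun; exact: sqrt_continuous.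
  by apply: measurable_funD; exact: measurable_funX.
by apply/funext => x; case: (f x).
Qed.

End complex_measurability.

Lemma cmeasurable_comp d d' (X : measurableType d) (Y : measurableType d')
    (R : realType) (f : Y -> R[i]) (h : X -> Y) :
  measurable_fun setT h -> cmeasurable setT f -> cmeasurable setT (f \o h).
Proof. by move=> mh [fr fi]; split; [exact: (measurableT_comp fr)|exact: (measurableT_comp fi)]. Qed.

Definition cintegrable d (X : measurableType d) (R : realType)
    (mu : set X -> \bar R) (f : X -> R[i]) : Prop :=
  cmeasurable setT f /\ (\int[mu]_x (normc (f x))%:E < +oo)%E.

Section complex_integral.
Context d (X : measurableType d) (R : realType).
Variable mu : {measure set X -> \bar R}.
Implicit Types (f g : X -> R[i]) (c : R[i]).
Local Notation int := (cintegrable mu).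

Lemma cintegrable_normc f :
  int f -> mu.-integrable setT (fun x => (normc (f x))%:E).
Proof.
move=> [mf foo]; apply/integrableP; split.
  by apply/measurable_EFinP; exact: measurable_normc.
by under eq_integral do rewrite gee0_abs ?lee_fin ?normc_ge0//.
Qed.

Lemma dominated_cintegrable f (h : X -> R) : cmeasurable setT f ->
  mu.-integrable setT (EFin \o h) -> (forall x, normc (f x) <= h x) -> int f.
Proof.
move=> mf /integrableP[mh hoo] fh; split=> //.
apply: le_lt_trans hoo; apply: ge0_le_integral => //.
- by move=> x _; rewrite lee_fin normc_ge0.
- by apply/measurable_EFinP; exact: measurable_normc.
- exact: measurableT_comp.
by move=> x _ /=; rewrite lee_fin (le_trans (fh x))// ler_norm.
Qed.

Lemma le_cintegrable f g : cmeasurable setT f -> int g ->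
  (forall x, normc (f x) <= normc (g x)) -> int f.
Proof. by move=> mf /cintegrable_normc ig; exact: dominated_cintegrable ig. Qed.

Lemma cintegrable_Re f :
  int f -> mu.-integrable setT (EFin \o (fun x => complex.Re (f x))).
Proof.
move=> fi; apply: le_integrable (cintegrable_normc fi) => //.
  by apply/measurable_EFinP; case: fi => -[].
by move=> x _ /=; rewrite lee_fin [leRHS]ger0_norm ?normc_ge0// Re_le_normc.
Qed.

Lemma cintegrable_Im f :
  int f -> mu.-integrable setT (EFin \o (fun x => complex.Im (f x))).
Proof.
move=> fi; apply: le_integrable (cintegrable_normc fi) => //.
  by apply/measurable_EFinP; case: fi => -[].
by move=> x _ /=; rewrite lee_fin [leRHS]ger0_norm ?normc_ge0// Im_le_normc.
Qed.

Lemma cintegrable0 : int (fun _ => 0).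
Proof.
split; first exact: cmeasurable_cst.
by under eq_integral do rewrite normc0; rewrite integral0.
Qed.

Lemma cintegrableD f g : int f -> int g -> int (fun x => f x + g x).
Proof.
move=> fi gi; apply: (@dominated_cintegrable _ (fun x => normc (f x) + normc (g x))).
- by apply: cmeasurableD; [case: fi|case: gi].
- have := integrableD measurableT (cintegrable_normc fi) (cintegrable_normc gi).
  by [].
- by move=> x; exact: le_normcD.
Qed.

Lemma cintegrableZ c f : int f -> int (fun x => c * f x).
Proof.
move=> fi; apply: (@dominated_cintegrable _ (fun x => normc c * normc (f x))).
- by apply: cmeasurableM; [exact: cmeasurable_cst|case: fi].
- by have := integrableZl measurableT (normc c) (cintegrable_normc fi).
- by move=> x; rewrite normcM.
Qed.

Lemma cintegrable_conj f : int f -> int (fun x => (f x)^*%C).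
Proof.
move=> fi; apply: le_cintegrable (fi) _; first by apply: cmeasurable_conj; case: fi.
by move=> x; rewrite normc_conj.
Qed.

Lemma cintegrable_sum (I : Type) (s : seq I) (P : pred I) (h : I -> X -> R[i]) :
  (forall i, int (h i)) -> int (fun x => \sum_(i <- s | P i) h i x).
Proof.
move=> mh; elim: s => [|i s IH].
  by under eq_fun do rewrite big_nil; exact: cintegrable0.
under eq_fun do rewrite big_cons.
by case: (P i) => //; exact: cintegrableD.
Qed.

Lemma cintegral0 : cintegral mu (fun _ => 0 : R[i]) = 0.
Proof. by rewrite /cintegral /= Rintegral_cst// mul0r. Qed.

Lemma cintegralD f g : int f -> int g ->
  cintegral mu (fun x => f x + g x) = cintegral mu f + cintegral mu g.
Proof.
move=> fi gi; rewrite /cintegral.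
have -> : (fun x => complex.Re (f x + g x)) =
    (fun x => complex.Re (f x) + complex.Re (g x)) by apply/funext=> x; rewrite ReD.
have -> : (fun x => complex.Im (f x + g x)) =
    (fun x => complex.Im (f x) + complex.Im (g x)) by apply/funext=> x; rewrite ImD.
rewrite !RintegralD//; try exact: cintegrable_Re; exact: cintegrable_Im.
Qed.

Lemma cintegralZ c f : int f ->
  cintegral mu (fun x => c * f x) = c * cintegral mu f.
Proof.
move=> fi; rewrite /cintegral.
have iR := cintegrable_Re fi; have iI := cintegrable_Im fi.
have -> : (fun x => complex.Re (c * f x)) =
    (fun x => complex.Re c * complex.Re (f x) - complex.Im c * complex.Im (f x)).
  by apply/funext=> x; rewrite ReM.
have -> : (fun x => complex.Im (c * f x)) =
    (fun x => complex.Re c * complex.Im (f x) + complex.Im c * complex.Re (f x)).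
  by apply/funext=> x; rewrite ImM.
have iZ a (u : X -> R) : mu.-integrable setT (EFin \o u) ->
    mu.-integrable setT (EFin \o (fun x => a * u x)).
  by move=> iu; have := integrableZl measurableT a iu.
rewrite RintegralB ?RintegralD//; try by apply: iZ.
by rewrite !RintegralZl//; case: c => a b.
Qed.

Lemma cintegral_conj f : int f ->
  cintegral mu (fun x => (f x)^*%C) = (cintegral mu f)^*%C.
Proof.
move=> fi; rewrite /cintegral /=.
have -> : (fun x => complex.Re (f x)^*%C) = (fun x => complex.Re (f x)).
  by apply/funext=> x; case: (f x).
have -> : (fun x => complex.Im (f x)^*%C) = (fun x => -1 * complex.Im (f x)).
  by apply/funext=> x; case: (f x) => a b /=; rewrite mulN1r.
by rewrite RintegralZl// ?mulN1r//; exact: cintegrable_Im.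
Qed.

Lemma cintegral_sum (I : Type) (s : seq I) (P : pred I) (h : I -> X -> R[i]) :
  (forall i, int (h i)) ->
  cintegral mu (fun x => \sum_(i <- s | P i) h i x) =
  \sum_(i <- s | P i) cintegral mu (h i).
Proof.
move=> mh; elim: s => [|i s IH].
  by under eq_fun do rewrite big_nil; rewrite big_nil cintegral0.
under eq_fun do rewrite big_cons.
rewrite big_cons; case: (P i) => //.
by rewrite cintegralD ?IH//; exact: cintegrable_sum.
Qed.

Lemma ae_eq_cintegral f g : cmeasurable setT f -> cmeasurable setT g ->
  f = g %[ae mu] -> cintegral mu f = cintegral mu g.
Proof.
move=> [fr fi] [gr gi] fg; rewrite /cintegral /Rintegral; congr (Complex (fine _) (fine _)).
  apply: ae_eq_integral => //; try exact/measurable_EFinP.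
  by move: fg; apply: filterS => x /[apply] ->.
apply: ae_eq_integral => //; try exact/measurable_EFinP.
by move: fg; apply: filterS => x /[apply] ->.
Qed.

(** Real and imaginary parts are bounded separately, whence the factor 2; it is harmless in the
    limits taken below. *)
Lemma normc_cintegral_le f (h : X -> R) : cmeasurable setT f ->
  mu.-integrable setT (EFin \o h) -> (forall x, normc (f x) <= h x) ->
  normc (cintegral mu f) <= 2 * \int[mu]_x h x.
Proof.
move=> mf ih fh; have fi := dominated_cintegrable mf ih fh.
apply: le_trans (normc_le_ReIm _) _; rewrite mulr_natl mulr2n /=.
apply: lerD.
  apply: le_trans (le_normr_Rintegral _ _) _ => //; first exact: cintegrable_Re.
  apply: le_Rintegral => //; first exact/integrable_norm/cintegrable_Re.
  by move=> x _; rewrite (le_trans _ (fh x))// Re_le_normc.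
apply: le_trans (le_normr_Rintegral _ _) _ => //; first exact: cintegrable_Im.
apply: le_Rintegral => //; first exact/integrable_norm/cintegrable_Im.
by move=> x _; rewrite (le_trans _ (fh x))// Im_le_normc.
Qed.

(** Convergence is stated through the real numbers [normc (f_ j x - f x)], the form used by
    [monomial_continuous]. Dominated convergence applies to these moduli, and [normc_cintegral_le]
    transfers it to the integrals. *)
Lemma cdominated_convergence (f_ : nat -> X -> R[i]) f (h : X -> R) :
  (forall j, cmeasurable setT (f_ j)) -> cmeasurable setT f ->
  mu.-integrable setT (EFin \o h) -> (forall j x, normc (f_ j x) <= h x) ->
  (forall x, (fun j => normc (f_ j x - f x)) @ \oo --> (0 : R)) ->
  (fun j => normc (cintegral mu (f_ j) - cintegral mu f)) @ \oo --> (0 : R).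
Proof.
move=> mf_ mf ih fh cvf.
have fi j : int (f_ j) by exact: dominated_cintegrable ih (fh j).
pose u j x := normc (f_ j x - f x).
(* The bound passes to the pointwise limit, so the moduli of the differences are dominated by
   [2 * h]. *)
have h_lim x : normc (f x) <= h x.
  apply/ler_addgt0Pr => e e0.
  have /cvgrPdist_lt/(_ e e0)[N _ /(_ N (leqnn N))] := cvf x.
  rewrite sub0r normrN ger0_norm ?normc_ge0// => lte.
  rewrite (_ : f x = f_ N x - (f_ N x - f x)); last by rewrite opprB addrC subrK.
  by rewrite (le_trans (le_normcD _ _))// normcN lerD// ltW.
have iff : int f by exact: dominated_cintegrable ih h_lim.
have mu_ j : measurable_fun setT (u j).
  apply: measurable_normc; apply: cmeasurableD => //.
  under eq_fun do rewrite -mulN1r.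
  by apply: cmeasurableM => //; exact: cmeasurable_cst.
have uh j x : u j x <= 2 * h x.
  rewrite /u (le_trans (le_normcD _ _))// normcN mulr_natl mulr2n.
  exact: lerD.
have ih2 : mu.-integrable setT (fun x => (2 * h x)%:E).
  by have := integrableZl measurableT 2 ih.
have : ([sequence \int[mu]_x (u j x)%:E]_j @ \oo --> \int[mu]_x (cst 0 x : \bar R))%E.
  have [|||| _ _] //:= @dominated_convergence _ _ _ mu setT measurableT
    (fun j x => (u j x)%:E) (cst 0%E) (fun x => (2 * h x)%:E) _ _ _ ih2.
  - by move=> j; exact/measurable_EFinP.
  - by apply: aeW => x _; apply: cvg_EFin; [exact: nearW|exact: cvf].
  - by apply: aeW => x j _; rewrite gee0_abs lee_fin// normc_ge0.
rewrite integral0 => cvu.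
have iu j : mu.-integrable setT (EFin \o u j).
  apply: le_integrable ih2 => //; first exact/measurable_EFinP.
  move=> x _ /=; rewrite lee_fin ger0_norm ?normc_ge0//.
  by rewrite (le_trans (uh j x))// ler_norm.
have cvu' : (fun j => 2 * \int[mu]_x (u j x)) @ \oo --> (0 : R).
  rewrite -[X in _ --> X](mulr0 2); apply: cvgMl_tmp.
  exact: (fine_cvg cvu).
apply: (squeeze_cvgr _ (cvg_cst 0) cvu').
apply: nearW => j; rewrite normc_ge0 andTb.
rewrite (_ : cintegral mu (f_ j) - cintegral mu f =
             cintegral mu (fun x => f_ j x + -1 * f x)).
  apply: normc_cintegral_le; last by move=> x; rewrite mulN1r.
    apply: cmeasurableD => //.
    by apply: cmeasurableM => //; exact: cmeasurable_cst.
  exact: iu.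
by rewrite cintegralD ?cintegralZ ?mulN1r//; exact: cintegrableZ.
Qed.

End complex_integral.

(** * Measures on tuples *)

Section image_measure.
Context d d' (X : measurableType d) (Y : measurableType d') (R : realType).
Variables (mu : {measure set X -> \bar R}) (nu : {measure set Y -> \bar R}).
Variable phi : X -> Y.
Hypotheses (mphi : measurable_fun setT phi)
  (nuE : forall B, measurable B -> nu B = mu (phi @^-1` B)).

(** [nu] only has to agree with the image of [mu] on measurable sets, so that these lemmas serve
    permutations, [tcons] and [spread] alike, whose image measures are declared separately. *)
Lemma ge0_integral_image (f : Y -> \bar R) :
  measurable_fun setT f -> (forall y, 0 <= f y)%E ->
  (\int[nu]_y f y = \int[mu]_x f (phi x))%E.
Proof.
move=> mf f0; rewrite -[RHS]/(\int[mu]_(x in phi @^-1` setT) (f \o phi) x)%E.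
rewrite -(ge0_integral_pushforward mphi)//.
by apply: (eq_measure_integral (measure_function_pushforward__canonical__measure_function_Measure mu mphi)) => B mB _; exact: nuE.
Qed.

Lemma cintegrable_image (f : Y -> R[i]) : cmeasurable setT f ->
  cintegrable mu (f \o phi) -> cintegrable nu f.
Proof.
move=> mf [_ foo]; split => //; rewrite ge0_integral_image//.
- by apply/measurable_EFinP; exact: measurable_normc.
- by move=> x; rewrite lee_fin normc_ge0.
Qed.

Lemma cintegrable_comp (f : Y -> R[i]) :
  cintegrable nu f -> cintegrable mu (f \o phi).
Proof.
move=> [mf foo]; split; first exact: cmeasurable_comp.
rewrite -(@ge0_integral_image (fun y => (normc (f y))%:E))//.
- by apply/measurable_EFinP; exact: measurable_normc.
- by move=> x; rewrite lee_fin normc_ge0.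
Qed.

Lemma cintegral_image (f : Y -> R[i]) :
  cintegrable nu f -> cintegral nu f = cintegral mu (fun x => f (phi x)).
Proof.
move=> nuf; have intf := cintegrable_comp nuf.
have [[fr fi] _] := nuf.
rewrite /cintegral /Rintegral.
have iR := cintegrable_Re intf; have iI := cintegrable_Im intf.
have E (h : Y -> \bar R) : (\int[nu]_y h y = \int[pushforward mu phi]_y h y)%E.
  by apply: (eq_measure_integral (measure_function_pushforward__canonical__measure_function_Measure mu mphi)) => B mB _; exact: nuE.
rewrite !E; congr (Complex (fine _) (fine _)).
  by rewrite (integral_pushforward mphi)//; exact/measurable_EFinP.
by rewrite (integral_pushforward mphi)//; exact/measurable_EFinP.
Qed.

Lemma ae_image (P : Y -> Prop) :
  (\forall y \ae nu, P y) -> \forall x \ae mu, P (phi x).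
Proof.
move=> [N [mN N0 PN]]; exists (phi @^-1` N); split.
- by rewrite -[X in measurable X]setTI; exact: mphi.
- by rewrite -nuE.
- by move=> x Px; exact: PN.
Qed.

End image_measure.

(** * Fubini's theorem for complex-valued functions *)

Section complex_fubini.
Context d d' (X : measurableType d) (Y : measurableType d') (R : realType).
Variables (m1 : {sigma_finite_measure set X -> \bar R}).
Variables (m2 : {sigma_finite_measure set Y -> \bar R}).

(** For [x] in a null set the inner integral may be infinite, and [fine] replaces it by 0; the outer
    integral does not see the change. *)
Lemma Rintegral12_prod (f : X * Y -> R) :
  (m1 \x m2)%E.-integrable setT (EFin \o f) ->
  \int[(m1 \x m2)%E]_z f z = \int[m1]_x (\int[m2]_y f (x, y)).
Proof.
move=> intf; rewrite {1 2}/Rintegral -integral12_prod_meas1//; congr fine.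
have iF := integrable_fubini_F intf.
have mF := measurable_int _ iF.
apply: ae_eq_integral => //.
  apply/measurable_EFinP.
  exact: (measurableT_comp (fine_measurable measurableT) mF).
have := integrable_ae measurableT iF.
by apply: filterS => x /[apply] Fx; rewrite /fubini_F /= /Rintegral fineK.
Qed.

Lemma integrable_fubini_G (f : X * Y -> \bar R) :
  (m1 \x m2)%E.-integrable setT f ->
  m2.-integrable setT (fun y => \int[m1]_x f (x, y))%E.
Proof.
move=> intf; have mf := measurable_int _ intf.
apply/integrableP; split; first exact: measurable_fubini_G intf.
rewrite (le_lt_trans _ ((integrable21ltyP m1 m2 mf).1 intf))//.
apply: ge0_le_integral => //.
- by apply: measurableT_comp => //; exact: measurable_fubini_G intf.
- apply: (measurable_fun_fubini_tonelli_G (abse \o f)) => //=.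
  exact: measurableT_comp.
- move=> y _; apply: le_abse_integral => //.
  by apply: measurableT_comp => //; exact: measurable_pair2.
Qed.

Lemma Rintegral21_prod (f : X * Y -> R) :
  (m1 \x m2)%E.-integrable setT (EFin \o f) ->
  \int[(m1 \x m2)%E]_z f z = \int[m2]_y (\int[m1]_x f (x, y)).
Proof.
move=> intf; rewrite {1 2}/Rintegral -integral21_prod_meas1//; congr fine.
have iG := integrable_fubini_G intf.
have mG := measurable_int _ iG.
apply: ae_eq_integral => //.
  apply/measurable_EFinP.
  exact: (measurableT_comp (fine_measurable measurableT) mG).
have := integrable_ae measurableT iG.
by apply: filterS => x /[apply] Fx; rewrite /fubini_G /= /Rintegral fineK.
Qed.

Lemma cintegral12_prod (f : X * Y -> R[i]) : cintegrable (m1 \x m2)%E f ->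
  cintegral (m1 \x m2)%E f =
  cintegral m1 (fun x => cintegral m2 (fun y => f (x, y))).
Proof.
move=> intf; rewrite /cintegral /=; congr Complex; apply: Rintegral12_prod.
  exact: cintegrable_Re.
exact: cintegrable_Im.
Qed.

Lemma cintegral21_prod (f : X * Y -> R[i]) : cintegrable (m1 \x m2)%E f ->
  cintegral (m1 \x m2)%E f =
  cintegral m2 (fun y => cintegral m1 (fun x => f (x, y))).
Proof.
move=> intf; rewrite /cintegral /=; congr Complex; apply: Rintegral21_prod.
  exact: cintegrable_Re.
exact: cintegrable_Im.
Qed.

End complex_fubini.

(** * Boxes and the permutation invariance of the product measure *)

Section boxes.
Context d (X : measurableType d).

Definition box n (E : 'I_n -> set X) : set (n.-tuple X) :=
  [set t | forall i, E i (tnth t i)].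

Definition boxes n : set (set (n.-tuple X)) :=
  [set box E | E in [set E | forall i, measurable (E i)]].

Lemma measurable_box n (E : 'I_n -> set X) :
  (forall i, measurable (E i)) -> measurable (box E).
Proof.
move=> mE; rewrite (_ : box E = \bigcap_(i in [set: 'I_n])
    (fun t => tnth t i) @^-1` E i).
  apply: fin_bigcap_measurable => [|i _]; first exact: finite_finset.
  by rewrite -[X in measurable X]setTI; exact: measurable_tnth.
by apply/seteqP; split => [t tE i _|t tE i]; [exact: tE|exact: (tE i)].
Qed.

Lemma setI_closed_boxes n : setI_closed (@boxes n).
Proof.
move=> _ _ [E mE <-] [F mF <-]; exists (fun i => E i `&` F i) => /=.
  by move=> i; exact: measurableI.
apply/seteqP; split=> t /=; first by move=> EF; split=> i; case: (EF i).
by move=> [tE tF] i; split.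
Qed.

(** Preimages under one coordinate generate the sigma-algebra, and each is a box whose other sides
    are the whole space. *)
Lemma measurable_tuple_boxes n :
  (@measurable _ (n.-tuple X)) = <<s @boxes n >>.
Proof.
apply/seteqP; split; last first.
  apply: smallest_sub; first exact: sigma_algebra_measurable.
  by move=> _ [E mE <-]; exact: measurable_box.
apply: smallest_sub; first exact: smallest_sigma_algebra.
move=> A; rewrite -bigcup_seq/= => -[i _ [B mB <-]].
apply: sub_sigma_algebra; exists (fun j => if j == i then B else setT).
  by move=> j /=; case: ifP.
apply/seteqP; split=> t /=.
  by move=> /(_ i); rewrite eqxx.
by move=> [_ tB] j; case: eqP => [->|].
Qed.

End boxes.

Section tuple_measure_theory.
Context d (X : measurableType d) (R : realType).
Variable sigma : {sigma_finite_measure set X -> \bar R}.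
Local Notation mu := (tuple_measure sigma).

Lemma measurable_permute n (pi : 'S_n) :
  measurable_fun setT (fun t : n.-tuple X => permute t pi).
Proof.
apply/measurable_fun_tnthP => i.
rewrite (_ : _ \o _ = (fun t : n.-tuple X => tnth t (pi i))).
  exact: measurable_tnth.
by apply/funext => t /=; rewrite tnth_mktuple.
Qed.

Lemma tuple_measure_boxE n (E : 'I_n -> set X) : (forall i, measurable (E i)) ->
  mu n (box E) = (\prod_(i < n) sigma (E i))%E.
Proof. exact: tuple_measure_box. Qed.

(** On boxes both sides are the same product of side measures up to order. Boxes form a generating
    pi-system, and the cubes over an increasing sequence of sets of finite measure exhaust the
    space, so the two measures agree. *)
Lemma tuple_measure_permute n (pi : 'S_n) (B : set (n.-tuple X)) :
  measurable B -> pushforward (mu n) (fun t => permute t pi) B = mu n B.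
Proof.
have /sigma_finiteP[F [TF ndF Foo]] := sigma_finiteT sigma.
pose M : {measure set (n.-tuple X) -> \bar R} :=
  measure_function_pushforward__canonical__measure_function_Measure
    (mu n) (measurable_permute pi).
move=> mB; rewrite -[LHS]/(M B).
have MboxE (E : 'I_n -> set X) : (forall i, measurable (E i)) ->
    M (box E) = mu n (box E).
  move=> mE; rewrite /M /= /pushforward.
  rewrite (_ : _ @^-1` _ = box (fun i => E ((pi^-1)%g i))).
    rewrite !tuple_measure_boxE//.
    rewrite [RHS](reindex_inj (@perm_inj _ (pi^-1)%g)) //=.
  apply/seteqP; split=> t /= H i.
    by have := H ((pi^-1)%g i); rewrite tnth_mktuple permKV.
  by have := H (pi i); rewrite tnth_mktuple permK.
apply: (measure_unique (@boxes _ X n) (fun k => box (fun=> F k))) => //.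
- exact: measurable_tuple_boxes.
- exact: setI_closed_boxes.
- by move=> k; exists (fun=> F k) => // i /=; case: (Foo k).
- apply/seteqP; split => // t _.
  have FT (i : 'I_n) : exists k, F k (tnth t i).
    have : setT (tnth t i) by [].
    by rewrite TF => -[k _ Fk]; exists k.
  have [k kP] := boolp.choice FT.
  (* The coordinates may lie in different sets [F k]; monotonicity puts them all in the one of
     largest index. *)
  exists (\max_(i < n) k i)%N => // i.
  have /ndF/subsetPset/(_ (tnth t i)) := leq_bigmax i (F := k).
  by apply; exact: kP.
- by move=> _ [E mE <-]; exact: MboxE.
- move=> k; rewrite MboxE; last by move=> i; case: (Foo k).
  rewrite tuple_measure_boxE; last by move=> i; case: (Foo k).
  suff /andP[] : (0 <= \prod_(i < n) sigma (F k) < +oo)%E by [].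
  elim/big_rec : _ => [|i x _ /andP[x0 xoo]]; first by rewrite lee01 ltry.
  have [_ Fkoo] := Foo k.
  by rewrite mule_ge0//= lte_mul_pinfty// ge0_fin_numE.
Qed.

Lemma permute_image n (pi : 'S_n) (B : set (n.-tuple X)) :
  measurable B -> mu n B = mu n ((fun t => permute t pi) @^-1` B).
Proof. by move=> mB; rewrite -(tuple_measure_permute pi mB). Qed.

Lemma cintegral_permute n (pi : 'S_n) (f : n.-tuple X -> R[i]) :
  cintegrable (mu n) f ->
  cintegral (mu n) (fun t => f (permute t pi)) = cintegral (mu n) f.
Proof.
by move=> fi; rewrite -(cintegral_image (measurable_permute pi) (@permute_image n pi) fi).
Qed.

Lemma ge0_integral_permute n (pi : 'S_n) (f : n.-tuple X -> \bar R) :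
  measurable_fun setT f -> (forall t, 0 <= f t)%E ->
  (\int[mu n]_t f (permute t pi) = \int[mu n]_t f t)%E.
Proof.
move=> mf f0.
by rewrite -(ge0_integral_image (measurable_permute pi) (@permute_image n pi)).
Qed.

Lemma ae_permute n (pi : 'S_n) (P : n.-tuple X -> Prop) :
  (\forall t \ae mu n, P t) -> \forall t \ae mu n, P (permute t pi).
Proof. exact: (ae_image (measurable_permute pi) (@permute_image n pi)). Qed.

Let tconsE n (B : set (n.+1.-tuple X)) :
  measurable B -> mu n.+1 B = (sigma \x mu n)%E (@tcons _ X n @^-1` B).
Proof. by []. Qed.

Lemma cintegral_tcons n (h : n.+1.-tuple X -> R[i]) : cintegrable (mu n.+1) h ->
  cintegral (mu n.+1) h =
  cintegral sigma (fun s => cintegral (mu n) (fun t => h (tcons (s, t)))).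
Proof.
move=> hi; rewrite (cintegral_image (@measurable_tcons _ X n) (@tconsE n) hi).
rewrite cintegral12_prod//.
exact: (cintegrable_comp (@measurable_tcons _ X n) (@tconsE n) hi).
Qed.

Lemma cintegral_tcons_swap n (h : n.+1.-tuple X -> R[i]) :
  cintegrable (mu n.+1) h ->
  cintegral (mu n.+1) h =
  cintegral (mu n) (fun t => cintegral sigma (fun s => h (tcons (s, t)))).
Proof.
move=> hi; rewrite (cintegral_image (@measurable_tcons _ X n) (@tconsE n) hi).
rewrite cintegral21_prod//.
exact: (cintegrable_comp (@measurable_tcons _ X n) (@tconsE n) hi).
Qed.

Lemma ge0_integral_tcons n (h : n.+1.-tuple X -> \bar R) :
  measurable_fun setT h -> (forall t, 0 <= h t)%E ->
  (\int[mu n.+1]_t h t = \int[sigma]_s \int[mu n]_t h (tcons (s, t)))%E.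
Proof.
move=> mh h0.
rewrite (ge0_integral_image (@measurable_tcons _ X n) (@tconsE n))//.
rewrite (@fubini_tonelli1 _ _ _ _ _ _ _ (h \o @tcons _ X n))//.
  by apply: (measurableT_comp mh); exact: measurable_tcons.
by move=> x; exact: h0.
Qed.

Lemma tcons_behead n (s : X) (t : n.-tuple X) :
  behead_tuple (tcons (s, t)) = t.
Proof. exact: val_inj. Qed.

(** The preimage of a null set [N] is the product of [setT] and [N], null even for infinite [sigma]
    since an infinite value times 0 is 0. *)
Lemma ae_behead n (P : n.-tuple X -> Prop) :
  (\forall t \ae mu n, P t) ->
  \forall t \ae mu n.+1, P (@behead_tuple n.+1 X t).
Proof.
move=> [N [mN N0 PN]]; exists (@behead_tuple n.+1 X @^-1` N).
have mpre : measurable (@behead_tuple n.+1 X @^-1` N).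
  by rewrite -[X in measurable X]setTI; exact: measurable_behead.
split=> //; last by move=> t Pt; exact: PN.
rewrite tconsE// (_ : _ @^-1` _ = setT `*` N).
  by rewrite product_measure1E// N0 mule0.
apply/seteqP; split=> -[s t]; rewrite /preimage/= tcons_behead//.
by case.
Qed.

(** The measure on 0-tuples is a Dirac mass. Through this lemma the vacuum component of a vector
    known up to null sets becomes a definite number. *)
Lemma tuple_measure0 (P : 0.-tuple X -> Prop) :
  (\forall t \ae mu 0, P t) -> forall t, P t.
Proof.
move=> [N [mN /= N0 PN]] t; rewrite (tuple0 t); apply: contrapT => Pt.
have := PN [tuple] Pt => Nt; move: N0.
by rewrite diracE mem_set// => /eqP; rewrite onee_eq0.
Qed.

Lemma fun_tuple0 (T : Type) (h : 0.-tuple X -> T) : h = cst (h [tuple]).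
Proof. by apply/funext => t; rewrite (tuple0 t). Qed.

Lemma cintegral_tuple0 (h : 0.-tuple X -> R[i]) :
  cintegral (mu 0) h = h [tuple].
Proof.
rewrite (fun_tuple0 h) /cintegral /Rintegral /=.
rewrite !integral_dirac//; try exact: measurable_cst.
by rewrite !diracT !mul1e /=; case: (h _).
Qed.

End tuple_measure_theory.

(** * Square-integrable functions and functions supported in a box *)

Lemma integrable_Mindic d (X : measurableType d) (R : realType)
    (mu : {measure set X -> \bar R}) (A : set X) (M : R) :
  measurable A -> (mu A < +oo)%E ->
  mu.-integrable setT (EFin \o (fun x => M * \1_A x)).
Proof.
move=> mA Aoo; suff i1 : mu.-integrable setT (EFin \o (\1_A : X -> R)).
  by have := integrableZl measurableT M i1.
apply/integrableP; split; first exact/measurable_EFinP/measurable_indic.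
rewrite (eq_integral (fun x => (\1_A x)%:E)); last first.
  by move=> t _; rewrite gee0_abs// lee_fin.
by rewrite integral_indic// setIT.
Qed.

Section square_integrable_functions.
Context d (X : measurableType d) (R : realType).
Variable mu : {measure set X -> \bar R}.
Implicit Types f g : X -> R[i].
Local Notation L2 := (square_integrable mu).

Lemma square_integrableP f : L2 f <->
  cmeasurable setT f /\ mu.-integrable setT (EFin \o (fun x => normc (f x) ^+ 2)).
Proof.
have E x : (`| (normc (f x) ^+ 2)%:E | = (normc (f x) ^+ 2)%:E)%E.
  by rewrite gee0_abs// lee_fin exprn_ge0// normc_ge0.
split=> -[mf foo]; split=> //.
  apply/integrableP; split.
    by apply/measurable_EFinP; apply: measurable_funX; exact: measurable_normc.
  by under eq_integral do rewrite E.
by move/integrableP: foo => [_]; under eq_integral do rewrite E.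
Qed.

Lemma dominated_square_integrable f (h : X -> R) : cmeasurable setT f ->
  mu.-integrable setT (EFin \o h) -> (forall x, normc (f x) ^+ 2 <= h x) -> L2 f.
Proof.
move=> mf ih fh; apply/square_integrableP; split=> //.
apply: le_integrable ih => //.
  by apply/measurable_EFinP; apply: measurable_funX; exact: measurable_normc.
move=> x _ /=; rewrite lee_fin ger0_norm ?exprn_ge0 ?normc_ge0//.
by rewrite (le_trans (fh x))// ler_norm.
Qed.

Lemma square_integrable0 : L2 (fun _ => 0).
Proof.
apply: (@dominated_square_integrable _ (cst 0)).
- exact: cmeasurable_cst.
- exact: integrable0.
- by move=> x; rewrite normc0 expr0n.
Qed.

Lemma square_integrableD f g : L2 f -> L2 g -> L2 (fun x => f x + g x).
Proof.
move=> /square_integrableP[mf i_f] /square_integrableP[mg ig].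
apply: (@dominated_square_integrable _
  (fun x => 2 * (normc (f x) ^+ 2 + normc (g x) ^+ 2))).
- exact: cmeasurableD.
- by have := integrableZl measurableT 2 (integrableD measurableT i_f ig).
- move=> x.
  have : normc (f x + g x) ^+ 2 <= (normc (f x) + normc (g x)) ^+ 2.
    by rewrite ler_pXn2r ?nnegrE ?addr_ge0 ?normc_ge0// le_normcD.
  by have := sqr_ge0 (normc (f x) - normc (g x)); nra.
Qed.

Lemma square_integrableM f g (M : R) : cmeasurable setT g ->
  (forall x, normc (g x) <= M) -> L2 f -> L2 (fun x => g x * f x).
Proof.
move=> mg gM /square_integrableP[mf i_f].
apply: (@dominated_square_integrable _ (fun x => M ^+ 2 * normc (f x) ^+ 2)).
- exact: cmeasurableM.
- by have := integrableZl measurableT (M ^+ 2) i_f.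
- move=> x; rewrite normcM exprMn ler_wpM2r ?exprn_ge0 ?normc_ge0//.
  by rewrite ler_pXn2r ?nnegrE ?normc_ge0// (le_trans (normc_ge0 (g x))).
Qed.

Lemma square_integrableZ (c : R[i]) f : L2 f -> L2 (fun x => c * f x).
Proof.
by apply: (@square_integrableM _ (cst c) (normc c)) => //; exact: cmeasurable_cst.
Qed.

Lemma square_integrable_sum (I : Type) (s : seq I) (P : pred I)
    (h : I -> X -> R[i]) :
  (forall i, L2 (h i)) -> L2 (fun x => \sum_(i <- s | P i) h i x).
Proof.
move=> mh; elim: s => [|i s IH].
  by under eq_fun do rewrite big_nil; exact: square_integrable0.
under eq_fun do rewrite big_cons.
by case: (P i) => //; exact: square_integrableD.
Qed.

Lemma cintegrable_inner f g : L2 f -> L2 g ->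
  cintegrable mu (fun x => f x * (g x)^*%C).
Proof.
move=> /square_integrableP[mf i_f] /square_integrableP[mg ig].
apply: (@dominated_cintegrable _ _ _ _ _
  (fun x => normc (f x) ^+ 2 + normc (g x) ^+ 2)).
- by apply: cmeasurableM => //; exact: cmeasurable_conj.
- by have := integrableD measurableT i_f ig.
- move=> x; rewrite normcM normc_conj.
  have := sqr_ge0 (normc (f x) - normc (g x)).
  have := normc_ge0 (f x); have := normc_ge0 (g x); nra.
Qed.

Lemma L2_innerZl c f h : L2 f -> L2 h ->
  L2_inner mu (fun x => c * f x) h = c * L2_inner mu f h.
Proof.
move=> *; rewrite /L2_inner -cintegralZ; last exact: cintegrable_inner.
by under eq_fun do rewrite -mulrA.
Qed.

Lemma L2_inner_conj f g : L2 f -> L2 g ->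
  L2_inner mu f g = (L2_inner mu g f)^*%C.
Proof.
move=> *; rewrite /L2_inner -cintegral_conj; last exact: cintegrable_inner.
by under [in RHS]eq_fun do rewrite rmorphM /= conjcK mulrC.
Qed.

Lemma L2_inner_suml (I : Type) (s : seq I) (P : pred I) (h : I -> X -> R[i]) g :
  (forall i, L2 (h i)) -> L2 g ->
  L2_inner mu (fun x => \sum_(i <- s | P i) h i x) g =
  \sum_(i <- s | P i) L2_inner mu (h i) g.
Proof.
move=> hL gL; rewrite /L2_inner -cintegral_sum; last first.
  by move=> i; exact: cintegrable_inner.
by under eq_fun do rewrite mulr_suml.
Qed.

Lemma L2_inner_sumr (I : Type) (s : seq I) (P : pred I) (h : I -> X -> R[i]) g :
  (forall i, L2 (h i)) -> L2 g ->
  L2_inner mu g (fun x => \sum_(i <- s | P i) h i x) =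
  \sum_(i <- s | P i) L2_inner mu g (h i).
Proof.
move=> hL gL; rewrite L2_inner_conj//; last exact: square_integrable_sum.
rewrite L2_inner_suml// (rmorph_sum (@conjc R)).
by apply: eq_bigr => i _; exact/esym/L2_inner_conj.
Qed.

Lemma L2_innerZr (c : R[i]) f h : L2 f -> L2 h ->
  L2_inner mu f (fun x => c * h x) = c^*%C * L2_inner mu f h.
Proof.
move=> fL hL; rewrite L2_inner_conj//; last exact: square_integrableZ.
by rewrite L2_innerZl// rmorphM [in RHS]L2_inner_conj.
Qed.

Lemma L2_innerDr f g h : L2 f -> L2 g -> L2 h ->
  L2_inner mu h (fun x => f x + g x) = L2_inner mu h f + L2_inner mu h g.
Proof.
move=> *; rewrite /L2_inner -cintegralD; try exact: cintegrable_inner.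
by under eq_fun do rewrite rmorphD mulrDr.
Qed.

Lemma ae_eq_L2_inner f f' g : cmeasurable setT f -> cmeasurable setT f' ->
  cmeasurable setT g ->
  f = f' %[ae mu] -> L2_inner mu f g = L2_inner mu f' g.
Proof.
move=> mf mf' mg ff'; apply: ae_eq_cintegral; try by apply: cmeasurableM => //; exact: cmeasurable_conj.
by move: ff'; apply: filterS => x /[apply] ->.
Qed.

Lemma L2_inner_eq0 f : L2 f -> L2_inner mu f f = 0 -> f = (fun _ => 0) %[ae mu].
Proof.
move=> /square_integrableP[mf i_f].
have -> : L2_inner mu f f = (\int[mu]_x (normc (f x) ^+ 2))%:C%C.
  rewrite /L2_inner; under eq_fun do rewrite mul_conjc.
  by rewrite /cintegral/= Rintegral_cst// mul0r.
move=> [] /eqP; rewrite /Rintegral fine_eq0; last exact: integrable_fin_num.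
move=> /eqP i0.
have mh : measurable_fun setT (fun x => (normc (f x) ^+ 2)%:E).
  by apply/measurable_EFinP; apply: measurable_funX; exact: measurable_normc.
have : (\int[mu]_x `|(normc (f x) ^+ 2)%:E| = 0)%E.
  rewrite -[RHS]i0; apply: eq_integral => x _.
  by rewrite gee0_abs// lee_fin exprn_ge0// normc_ge0.
move=> /(ae_eq_integral_abs _ measurableT mh).
apply: filterS => x /[apply] /= [[]] /eqP; rewrite expf_eq0/= => /eqP.
exact: eq0_normc.
Qed.

End square_integrable_functions.

(** * Bounded functions supported in a cube of finite measure *)

Section box_functions.
Context d (X : measurableType d) (R : realType).
Variables (sigma : {sigma_finite_measure set X -> \bar R}) (K : set X).
Hypotheses (mK : measurable K) (Koo : (sigma K < +oo)%E).
Local Notation mu := (tuple_measure sigma).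

(** With [sigma K] finite these functions are integrable and square integrable. The class is
    preserved by each [Psi], by tensoring with a bounded function supported in [K] and by partial
    integration, so the unsymmetrized vectors never leave it. *)
Definition box_fun n (g : n.-tuple X -> R[i]) : Prop :=
  [/\ cmeasurable setT g, exists M : R, forall t, normc (g t) <= M
    & forall t, (exists i, ~ K (tnth t i)) -> g t = 0].

Let Kn n : set (n.-tuple X) := box (fun _ : 'I_n => K).

Lemma integrable_indic_box n (M : R) :
  (mu n).-integrable setT (EFin \o (fun t => M * \1_(@Kn n) t)).
Proof.
have mKn : measurable (@Kn n) by exact: measurable_box.
have Knoo : (mu n (@Kn n) < +oo)%E.
  rewrite tuple_measure_boxE//.
  suff /andP[] : (0 <= \prod_(i < n) sigma K < +oo)%E by [].
  elim/big_rec : _ => [|i x _ /andP[x0 xoo]]; first by rewrite lee01 ltry.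
  by rewrite mule_ge0//= lte_mul_pinfty// ge0_fin_numE.
exact: integrable_Mindic.
Qed.

Lemma box_fun_bound n (g : n.-tuple X -> R[i]) : box_fun g ->
  exists M : R, 0 <= M /\ forall t, normc (g t) <= M * \1_(@Kn n) t.
Proof.
move=> [mg [M gM] g0]; exists M; split.
  exact: le_trans (normc_ge0 (g (nseq_tuple n point))) (gM _).
move=> t; rewrite indicE; have [tK|] := boolP (t \in @Kn n); first by rewrite mulr1.
rewrite notin_setE => /existsNP tK.
by rewrite (g0 _ tK) normc0 mulr0.
Qed.

Lemma box_fun_cintegrable n (g : n.-tuple X -> R[i]) :
  box_fun g -> cintegrable (mu n) g.
Proof.
move=> gK; have [M [_ gM]] := box_fun_bound gK.
apply: (@dominated_cintegrable _ _ _ _ _ (fun t => M * \1_(@Kn n) t)) => //.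
  by case: gK.
exact: integrable_indic_box.
Qed.

Lemma box_fun_square_integrable n (g : n.-tuple X -> R[i]) :
  box_fun g -> square_integrable (mu n) g.
Proof.
move=> gK; have [M [M0 gM]] := box_fun_bound gK.
apply: (@dominated_square_integrable _ _ _ _ _ (fun t => M ^+ 2 * \1_(@Kn n) t)).
- by case: gK.
- exact: integrable_indic_box.
move=> t.
have : normc (g t) ^+ 2 <= (M * \1_(@Kn n) t) ^+ 2.
  by rewrite ler_pXn2r ?nnegrE ?normc_ge0// (le_trans (normc_ge0 _) (gM t)).
move=> /le_trans; apply.
by rewrite exprMn indicE; case: (_ \in _); rewrite ?expr1n ?expr0n.
Qed.

Lemma box_fun0 n : @box_fun n (fun _ => 0).
Proof.
split=> //.
by exists 0 => t; rewrite normc0.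
Qed.

Lemma box_funD n (g h : n.-tuple X -> R[i]) : box_fun g -> box_fun h ->
  box_fun (fun t => g t + h t).
Proof.
move=> [mg [M gM] g0] [mh [N hN] h0]; split; first exact: cmeasurableD.
  by exists (M + N) => t; rewrite (le_trans (le_normcD _ _))// lerD.
by move=> t tK; rewrite g0// h0// addr0.
Qed.

Lemma box_fun_sum n (I : Type) (s : seq I) (P : pred I)
    (h : I -> n.-tuple X -> R[i]) :
  (forall i, box_fun (h i)) -> box_fun (fun t => \sum_(i <- s | P i) h i t).
Proof.
move=> mh; elim: s => [|i s IH].
  by under eq_fun do rewrite big_nil; exact: box_fun0.
under eq_fun do rewrite big_cons.
by case: (P i) => //; exact: box_funD.
Qed.

Lemma box_funMl n (u g : n.-tuple X -> R[i]) (M : R) : cmeasurable setT u ->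
  (forall t, normc (u t) <= M) -> box_fun g -> box_fun (fun t => u t * g t).
Proof.
move=> mu_ uM [mg [N gN] g0]; split; first exact: cmeasurableM.
  by exists (M * N) => t; rewrite normcM ler_pM ?normc_ge0.
by move=> t tK; rewrite g0// mulr0.
Qed.

Lemma box_funZ n (c : R[i]) (g : n.-tuple X -> R[i]) :
  box_fun g -> box_fun (fun t => c * g t).
Proof.
by apply: (@box_funMl _ (cst c) _ (normc c)) => //; exact: cmeasurable_cst.
Qed.

Lemma box_fun_slice n (h : n.+1.-tuple X -> R[i]) (t : n.-tuple X) :
  box_fun h -> cintegrable sigma (fun s => h (tcons (s, t))).
Proof.
move=> [mh [M hM] h0].
have i1 := integrable_Mindic M mK Koo.
apply: dominated_cintegrable i1 _ => /=.
  apply: (@cmeasurable_comp _ _ _ _ _ h (fun s => tcons (s, t))) => //.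
  apply: measurableT_comp (@measurable_tcons _ X n) _.
  exact: measurable_pair2.
move=> s; rewrite indicE; have [sK|] := boolP (s \in K); first by rewrite mulr1.
rewrite notin_setE => sK; rewrite h0 ?normc0 ?mulr0//.
by exists ord0.
Qed.

Lemma box_fun_integral n (h : n.+1.-tuple X -> R[i]) : box_fun h ->
  box_fun (fun t => cintegral sigma (fun s => h (tcons (s, t)))).
Proof.
move=> hK; have hi := box_fun_cintegrable hK; have [mh [M hM] h0] := hK.
have hip : cintegrable (sigma \x mu n)%E (h \o @tcons _ X n).
  apply: cintegrable_comp hi; first exact: measurable_tcons.
  by [].
have i1 := integrable_Mindic M mK Koo.
split.
- split => /=.
    have /integrable_fubini_G/measurable_int mG := cintegrable_Re hip.
    exact: (measurableT_comp (fine_measurable measurableT) mG).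
  have /integrable_fubini_G/measurable_int mG := cintegrable_Im hip.
  exact: (measurableT_comp (fine_measurable measurableT) mG).
- exists (2 * \int[sigma]_x (M * \1_K x)) => t.
  apply: normc_cintegral_le => //; first by case: (box_fun_slice t hK).
  move=> s; rewrite indicE; have [sK|] := boolP (s \in K); first by rewrite mulr1.
  rewrite notin_setE => sK; rewrite h0 ?normc0 ?mulr0//.
  by exists ord0.
- move=> t [i ti]; rewrite -[RHS](cintegral0 sigma); congr cintegral.
  apply/funext => s; apply: h0; exists (lift ord0 i).
  by rewrite tnthS.
Qed.

End box_functions.

(** * The representation of the symmetric group *)

Section symmetrization.
Context d (X : measurableType d) (R : realType).
Variable sigma : {sigma_finite_measure set X -> \bar R}.
Variable q : X -> X -> R[i].
Hypotheses (qK : forall s t, q s t * q t s = 1)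
  (q1 : forall s t, normc (q s t) = 1)
  (mq : cmeasurable setT (fun p : X * X => q p.1 p.2)).
Local Notation mu := (tuple_measure sigma).
Local Notation L2 n := (square_integrable (mu n)).

Lemma permuteM n (pi rho : 'S_n) (t : n.-tuple X) :
  permute (permute t pi) rho = permute t (rho * pi)%g.
Proof. by apply: eq_from_tnth => i; rewrite !tnth_mktuple permM. Qed.

Lemma permute1 n (t : n.-tuple X) : permute t 1%g = t.
Proof. by apply: eq_from_tnth => i; rewrite tnth_mktuple perm1. Qed.

Lemma normc_Qperm n (pi : 'S_n) (t : n.-tuple X) : normc (Qperm q pi t) = 1.
Proof.
rewrite /Qperm; elim/big_ind : _ => [|x y x1 y1|//]; first exact: normc1.
by rewrite normcM x1 y1 mulr1.
Qed.

Lemma cmeasurable_Qperm n (pi : 'S_n) : cmeasurable setT (@Qperm _ X R q n pi).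
Proof.
rewrite /Qperm; apply: cmeasurable_prod => -[i j] /=.
apply: (@cmeasurable_comp _ _ _ _ _ (fun p : X * X => q p.1 p.2)
  (fun t : n.-tuple X => (tnth t i, tnth t j))) => //.
by apply: measurable_fun_pair; exact: measurable_tnth.
Qed.

Lemma cmeasurable_permute n (pi : 'S_n) (f : n.-tuple X -> R[i]) :
  cmeasurable setT f -> cmeasurable setT (fun t => f (permute t pi)).
Proof.
by apply: (@cmeasurable_comp _ _ _ _ _ f); exact: measurable_permute.
Qed.

Lemma square_integrable_Psi n (pi : 'S_n) f : L2 n f -> L2 n (Psi q pi f).
Proof.
move=> [mf foo]; apply: (@square_integrableM _ _ _ _ _ _ 1).
- exact: cmeasurable_Qperm.
- by move=> t; rewrite normc_Qperm.
split; first exact: cmeasurable_permute.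
rewrite /sqnorm (@ge0_integral_permute _ _ _ _ _ _ (fun t => (normc (f t) ^+ 2)%:E))//.
- by apply/measurable_EFinP; apply: measurable_funX; exact: measurable_normc.
- by move=> t; rewrite lee_fin exprn_ge0// normc_ge0.
Qed.

Lemma Psi_sum n (pi : 'S_n) (I : Type) (s : seq I) (P : pred I)
    (h : I -> n.-tuple X -> R[i]) :
  Psi q pi (fun t => \sum_(i <- s | P i) h i t) =
  (fun t => \sum_(i <- s | P i) Psi q pi (h i) t).
Proof. by apply/funext => t; rewrite /Psi mulr_sumr. Qed.

Lemma PsiZ n (pi : 'S_n) (c : R[i]) (f : n.-tuple X -> R[i]) :
  Psi q pi (fun t => c * f t) = (fun t => c * Psi q pi f t).
Proof. by apply/funext => t; rewrite /Psi mulrCA. Qed.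

Lemma Psym_sum n (I : Type) (s : seq I) (P : pred I)
    (h : I -> n.-tuple X -> R[i]) :
  Psym q (fun t => \sum_(i <- s | P i) h i t) =
  (fun t => \sum_(i <- s | P i) Psym q (h i) t).
Proof.
apply/funext => t; rewrite /Psym -mulr_sumr exchange_big; congr (_ * _).
by apply: eq_bigr => pi _; rewrite Psi_sum.
Qed.

Lemma PsymZ n (c : R[i]) (f : n.-tuple X -> R[i]) :
  Psym q (fun t => c * f t) = (fun t => c * Psym q f t).
Proof.
apply/funext => t; rewrite /Psym [RHS]mulrCA; congr (_ * _).
rewrite mulr_sumr.
by apply: eq_bigr => pi _; rewrite PsiZ.
Qed.

Lemma PsymD n (f g : n.-tuple X -> R[i]) :
  Psym q (fun t => f t + g t) = (fun t => Psym q f t + Psym q g t).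
Proof.
apply/funext => t; rewrite /Psym -mulrDr -big_split; congr (_ * _).
by apply: eq_bigr => pi _; rewrite /Psi mulrDr.
Qed.

Lemma Psym_Psi n (pi : 'S_n) (f : n.-tuple X -> R[i]) :
  Psym q (Psi q pi f) = Psym q f.
Proof.
apply/funext => t; rewrite /Psym; congr (_ * _).
rewrite [RHS](reindex_inj (mulgI pi)); apply: eq_bigr => rho _.
by rewrite PsiM.
Qed.

Lemma Psi_Psym n (pi : 'S_n) (f : n.-tuple X -> R[i]) :
  Psi q pi (Psym q f) = Psym q f.
Proof.
rewrite /Psym PsiZ Psi_sum; apply/funext => t; congr (_ * _).
rewrite [RHS](reindex_inj (mulIg pi)); apply: eq_bigr => rho _.
by rewrite PsiM.
Qed.

Lemma card_perm_neq0 n : (n`!%:R : R[i]) != 0.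
Proof. by rewrite pnatr_eq0 -lt0n fact_gt0. Qed.

Lemma sum_perm_cst n (c : R[i]) :
  (n`!%:R)^-1 * (\sum_(pi : 'S_n) c) = c.
Proof.
rewrite sumr_const card_Sn.
by rewrite -[c *+ _]mulr_natl mulKf// card_perm_neq0.
Qed.

Lemma Psym_id n (f : n.-tuple X -> R[i]) : Psym q (Psym q f) = Psym q f.
Proof.
apply/funext => t; rewrite {1}/Psym.
under eq_bigr do rewrite Psi_Psym.
exact: sum_perm_cst.
Qed.

Lemma square_integrable_Psym n f : L2 n f -> L2 n (Psym q f).
Proof.
move=> fL; apply: square_integrableZ; apply: square_integrable_sum => pi.
exact: square_integrable_Psi.
Qed.

(** Applying the composite of [Psi pi] and its inverse to the constant function 1 shows that the two
    multipliers are inverse to each other; for a number of modulus 1 the inverse is the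
    conjugate. *)
Lemma conj_Qperm n (pi : 'S_n) (t : n.-tuple X) :
  (Qperm q (pi^-1)%g t)^*%C = Qperm q pi (permute t (pi^-1)%g).
Proof.
have := PsiM (pi^-1)%g pi (fun=> 1) qK.
rewrite mulgV Psi1 => /(congr1 (@^~ t)); rewrite /Psi mulr1 => E.
have : Qperm q (pi^-1)%g t * (Qperm q (pi^-1)%g t)^*%C = 1.
  by rewrite mul_conjc normc_Qperm expr1n.
rewrite {1}E; apply: mulfI.
by apply/eqP => Q0; have /eqP := normc_Qperm (pi^-1)%g t; rewrite Q0 normc0 eq_sym oner_eq0.
Qed.

(** Unitarity of the representation: the measure is invariant under permuting the variables, and
    [conj_Qperm] accounts for the multiplier. *)
Lemma L2_inner_Psi n (pi : 'S_n) u v : L2 n u -> L2 n v ->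
  L2_inner (mu n) (Psi q pi u) v = L2_inner (mu n) u (Psi q (pi^-1)%g v).
Proof.
move=> uL vL; rewrite /L2_inner -(cintegral_permute (pi^-1)%g); last first.
  by apply: cintegrable_inner => //; exact: square_integrable_Psi.
congr cintegral; apply/funext => t; rewrite /Psi permuteM mulgV permute1.
by rewrite -conj_Qperm rmorphM mulrCA mulrA.
Qed.

Lemma L2_inner_Psym n u v : L2 n u -> L2 n v ->
  L2_inner (mu n) (Psym q u) v = L2_inner (mu n) u (Psym q v).
Proof.
move=> uL vL; rewrite /Psym L2_innerZl//; last first.
  by apply: square_integrable_sum => pi; exact: square_integrable_Psi.
rewrite L2_innerZr//; last first.
  by apply: square_integrable_sum => pi; exact: square_integrable_Psi.
rewrite conjc_inv conjc_nat; congr (_ * _).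
rewrite L2_inner_suml//; last by move=> pi; exact: square_integrable_Psi.
rewrite L2_inner_sumr//; last by move=> pi; exact: square_integrable_Psi.
rewrite [RHS](reindex_inj invg_inj); apply: eq_bigr => pi _.
exact: L2_inner_Psi.
Qed.

Lemma ae_eq_Psi n (pi : 'S_n) f g : f = g %[ae mu n] ->
  Psi q pi f = Psi q pi g %[ae mu n].
Proof.
move=> /(ae_permute pi); apply: filterS => t fg _.
by rewrite /Psi fg.
Qed.

Lemma ae_eq_sum n (I : Type) (s : seq I) (f g : I -> n.-tuple X -> R[i]) :
  (forall i, f i = g i %[ae mu n]) ->
  (fun t => \sum_(i <- s) f i t) = (fun t => \sum_(i <- s) g i t) %[ae mu n].
Proof.
move=> fg; elim: s => [|i s IH].
  by apply: aeW => t _; rewrite !big_nil.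
move: IH (fg i); apply: filterS2 => t E1 E2 _.
by rewrite !big_cons E1// E2.
Qed.

Lemma ae_eq_Psym n f g : f = g %[ae mu n] -> Psym q f = Psym q g %[ae mu n].
Proof.
move=> fg; have := @ae_eq_sum n _ (index_enum _) _ _ (fun pi : 'S_n => ae_eq_Psi pi fg).
by apply: filterS => t E _; rewrite /Psym E.
Qed.

End symmetrization.

(** * Tensoring on the left, cosets of the stabilizer of the head, and the adjoint *)

Section creation_head.
Context d (X : measurableType d) (R : realType).
Variable sigma : {sigma_finite_measure set X -> \bar R}.
Variable q : X -> X -> R[i].
Hypotheses (qK : forall s t, q s t * q t s = 1)
  (q1 : forall s t, normc (q s t) = 1)
  (mq : cmeasurable setT (fun p : X * X => q p.1 p.2)).
Local Notation mu := (tuple_measure sigma).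
Local Notation L2 n := (square_integrable (mu n)).

Definition head_tensor (f : X -> R) n (F : n.-tuple X -> R[i]) :
    n.+1.-tuple X -> R[i] :=
  fun t => (f (thead t))%:C%C * F (@behead_tuple n.+1 X t).

Lemma tnth_behead_tuple n (t : n.+1.-tuple X) (i : 'I_n) :
  tnth (@behead_tuple n.+1 X t) i = tnth t (lift ord0 i).
Proof. by case/tupleP: t => x t; rewrite tnthS; congr tnth; exact: val_inj. Qed.

Lemma QpermE n (pi : 'S_n) (t : n.-tuple X) :
  Qperm q pi t = \prod_(i < n) \prod_(j < n)
    if ((i < j) && ((pi^-1)%g j < (pi^-1)%g i))%N then q (tnth t i) (tnth t j)
    else 1.
Proof.
rewrite pair_bigA /= -big_mkcond; exact: eq_bigr.
Qed.

(** A permutation fixing 0 has no inversion involving 0, so only the inversions among the tail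
    variables contribute. *)
Lemma Qperm_lift0 n (s : 'S_n) (t : n.+1.-tuple X) :
  Qperm q (lift_perm ord0 ord0 s) t = Qperm q s (@behead_tuple n.+1 X t).
Proof.
rewrite !QpermE big_ord_recl big1 ?mul1r; last first.
  by move=> j _; rewrite lift_permV lift_perm_id ltn0 andbF.
apply: eq_bigr => i _; rewrite big_ord_recl mul1r; apply: eq_bigr => j _.
rewrite lift_permV !lift_perm_lift !tnth_behead_tuple /=.
by rewrite /bump /= !add1n !ltnS.
Qed.

Lemma permute_lift0 n (s : 'S_n) (t : n.+1.-tuple X) :
  @behead_tuple n.+1 X (permute t (lift_perm ord0 ord0 s)) =
  permute (@behead_tuple n.+1 X t) s.
Proof.
apply: eq_from_tnth => i.
by rewrite tnth_behead_tuple !tnth_mktuple lift_perm_lift tnth_behead_tuple.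
Qed.

Lemma Psi_head_tensor (f : X -> R) n (s : 'S_n) (F : n.-tuple X -> R[i]) :
  head_tensor f (Psi q s F) = Psi q (lift_perm ord0 ord0 s) (head_tensor f F).
Proof.
apply/funext => t; rewrite /head_tensor /Psi Qperm_lift0 permute_lift0 mulrCA.
by rewrite /thead tnth_mktuple lift_perm_id.
Qed.

Lemma head_tensor_sum f n (I : Type) (s : seq I) (F : I -> n.-tuple X -> R[i]) :
  head_tensor f (fun t => \sum_(i <- s) F i t) =
  (fun t => \sum_(i <- s) head_tensor f (F i) t).
Proof. by apply/funext => t; rewrite /head_tensor mulr_sumr. Qed.

Lemma head_tensorZ f n (c : R[i]) (F : n.-tuple X -> R[i]) :
  head_tensor f (fun t => c * F t) = (fun t => c * head_tensor f F t).
Proof. by apply/funext => t; rewrite /head_tensor mulrCA. Qed.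

(** A permutation of the tail is a permutation fixing 0, which [Psym] absorbs. Hence creation may be
    carried out on unsymmetrized vectors. *)
Lemma Psym_head_tensor_Psym f n (F : n.-tuple X -> R[i]) :
  Psym q (head_tensor f (Psym q F)) = Psym q (head_tensor f F).
Proof.
rewrite {2}/Psym head_tensorZ head_tensor_sum PsymZ Psym_sum; apply/funext => t.
under eq_bigr do rewrite Psi_head_tensor Psym_Psi//.
exact: sum_perm_cst.
Qed.

(* The permutations [lift_perm ord0 j 1] represent the cosets of the stabilizer of [ord0]. *)
Lemma Psym_head_tensor f n (F : n.-tuple X -> R[i]) :
  (fun t => n.+1%:R * Psym q (head_tensor f F) t) =
  (fun t => \sum_(j < n.+1)
     Psi q (lift_perm ord0 j 1%g) (head_tensor f (Psym q F)) t).
Proof.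
apply/funext => t; rewrite /Psym.
rewrite factS natrM invfM mulrA mulrA divff ?pnatr_eq0// mul1r.
rewrite (reindex (fun js : 'I_n.+1 * 'S_n => lift_perm ord0 js.1 js.2)) /=.
  rewrite -(pair_bigA _ (fun j s => Psi q (lift_perm ord0 j s) (head_tensor f F) t)) /=.
  rewrite mulr_sumr; apply: eq_bigr => j _.
  rewrite head_tensorZ head_tensor_sum PsiZ Psi_sum; congr (_ * _).
  apply: eq_bigr => s _; rewrite Psi_head_tensor -PsiM// lift_permM.
  by rewrite mulg1.
apply/onW_bij/inj_card_bij; last first.
  by rewrite card_prod card_ord !card_Sn factS.
move=> [j s] [j' s'] /= /permP E.
have jj' : j = j' by have := E ord0; rewrite !lift_perm_id.
subst j'; congr pair; apply/permP => i; have := E (lift ord0 i).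
by rewrite !lift_perm_lift => /lift_inj.
Qed.

(** This permutation only moves position [j] to the head, so its inversions are the pairs formed by
    the head and one of the [j] variables that were jumped over. *)
Lemma Qperm_lift_ord0 n (j : 'I_n.+1) (s : X) (t : n.-tuple X) :
  Qperm q (lift_perm j ord0 1%g) (tcons (s, t)) =
  \prod_(k < n | (k < j)%N) q s (tnth t k).
Proof.
rewrite QpermE big_ord_recl [X in _ * X]big1 ?mulr1; last first.
  move=> i _; rewrite big_ord_recl big1 ?mulr1//= => k _.
  rewrite lift_permV !lift_perm_lift invg1 !perm1 /= /bump /= !add1n.
  by case: ifP => //; lia.
rewrite big_ord_recl mul1r [RHS]big_mkcond; apply: eq_bigr => k _.
rewrite lift_permV lift_perm_lift lift_perm_id invg1 perm1.
rewrite tnth0 tnthS /= /bump; congr (if _ then _ else _).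
by case: (leqP j k) => jk /=; lia.
Qed.

(* The j-th summand of the annihilation operator removes the variable in
   position [j], after having moved it to the head. *)
Definition annih (f : X -> R) n (g : n.+1.-tuple X -> R[i]) : n.-tuple X -> R[i] :=
  fun t => \sum_(j < n.+1) cintegral sigma
    (fun s => (f s)%:C%C * Psi q (lift_perm j ord0 1%g) g (tcons (s, t))).

Section box_supported.
Variables (K : set X) (mK : measurable K) (Koo : (sigma K < +oo)%E).
Local Notation bfun := (box_fun K).

Definition supported_fun (f : X -> R) : Prop :=
  [/\ measurable_fun setT f, exists M : R, forall x, `|f x| <= M
    & forall x, ~ K x -> f x = 0].

Variables (f : X -> R) (fK : supported_fun f).

Lemma measurable_thead n : measurable_fun setT (@thead n X).
Proof. exact: measurable_tnth. Qed.

Lemma cmeasurable_head_tensor n (F : n.-tuple X -> R[i]) :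
  cmeasurable setT F -> cmeasurable setT (head_tensor f F).
Proof.
have [mf _ _] := fK => mF; apply: cmeasurableM.
  apply: (@cmeasurable_comp _ _ _ _ _ (fun x => (f x)%:C%C)).
    exact: measurable_thead.
  exact: cmeasurable_real.
by apply: (@cmeasurable_comp _ _ _ _ _ F) => //; exact: measurable_behead.
Qed.

(** [F] is an arbitrary square-integrable function because the adjoint relation is tested against
    all finite vectors. Tonelli splits the norm, and the factor of [f] is at most [M ^+ 2] times the
    measure of [K]. *)
Lemma square_integrable_head_tensor n (F : n.-tuple X -> R[i]) :
  L2 n F -> L2 n.+1 (head_tensor f F).
Proof.
move=> [mF Foo]; have [mf [M fM] f0] := fK.
have mHF := cmeasurable_head_tensor mF.
split=> //.
have mnF : measurable_fun setT (fun t => (normc (F t) ^+ 2)%:E).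
  by apply/measurable_EFinP; apply: measurable_funX; exact: measurable_normc.
rewrite /sqnorm ge0_integral_tcons; last 2 first.
- by apply/measurable_EFinP; apply: measurable_funX; exact: measurable_normc.
- by move=> t; rewrite lee_fin exprn_ge0// normc_ge0.
have E s : (\int[mu n]_t (normc (head_tensor f F (tcons (s, t))) ^+ 2)%:E =
    (`|f s| ^+ 2)%:E * \int[mu n]_t (normc (F t) ^+ 2)%:E)%E.
  rewrite -ge0_integralZl//; last first.
    by move=> t _; rewrite lee_fin exprn_ge0// normc_ge0.
  apply: eq_integral => t _.
  by rewrite /head_tensor tcons_behead /thead tnth0 normcM normc_real exprMn.
under eq_integral do rewrite E.
rewrite ge0_integralZr//; last 2 first.
- by apply/measurable_EFinP; apply: measurable_funX; exact: measurableT_comp.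
- by apply: integral_ge0 => t _; rewrite lee_fin exprn_ge0// normc_ge0.
have F0 : (0 <= \int[mu n]_t (normc (F t) ^+ 2)%:E)%E.
  by apply: integral_ge0 => t _; rewrite lee_fin exprn_ge0// normc_ge0.
rewrite muleC lte_mul_pinfty// ?ge0_fin_numE//.
have i1 := integrable_Mindic (M ^+ 2) mK Koo.
have /integrableP[_ /=] := i1; apply: le_lt_trans.
apply: ge0_le_integral => //.
- by apply/measurable_EFinP; apply: measurable_funX; exact: measurableT_comp.
- apply/measurable_EFinP; apply: measurableT_comp => //.
  by apply: measurable_funM => //; exact: measurable_indic.
move=> x _; rewrite lee_fin indicE.
have [xK|] := boolP (x \in K).
  by rewrite mulr1 (le_trans _ (ler_norm _))// ler_pXn2r ?nnegrE// (le_trans _ (fM x)).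
by rewrite notin_setE => xK; rewrite f0// normr0 expr0n/= mulr0 normr0.
Qed.

Lemma box_fun_head_tensor n (F : n.-tuple X -> R[i]) :
  bfun F -> bfun (head_tensor f F).
Proof.
move=> [mF [M FM] F0]; have [mf [N fN] f0] := fK.
split; first exact: cmeasurable_head_tensor.
  by exists (N * M) => t; rewrite normcM normc_real ler_pM ?normc_ge0.
move=> t [k]; case: (unliftP ord0 k) => [j|] -> tK.
  rewrite /head_tensor F0 ?mulr0//; exists j.
  by rewrite tnth_behead_tuple.
by rewrite /head_tensor f0 ?mul0r.
Qed.

Lemma box_fun_Psi n (pi : 'S_n) (g : n.-tuple X -> R[i]) :
  bfun g -> bfun (Psi q pi g).
Proof.
move=> [mg [M gM] g0]; apply: (@box_funMl _ _ _ _ _ _ _ 1).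
- exact: cmeasurable_Qperm.
- by move=> t; rewrite normc_Qperm.
split; first exact: cmeasurable_permute.
  by exists M.
move=> t [i ti]; apply: g0; exists ((pi^-1)%g i).
by rewrite tnth_mktuple permKV.
Qed.

Lemma box_fun_head_mul n (g : n.+1.-tuple X -> R[i]) :
  bfun g -> bfun (fun t => (f (thead t))%:C%C * g t).
Proof.
have [mf [N fN] f0] := fK; apply: (@box_funMl _ _ _ _ _ _ _ N).
  apply: (@cmeasurable_comp _ _ _ _ _ (fun x => (f x)%:C%C)).
    exact: measurable_thead.
  exact: cmeasurable_real.
by move=> t; rewrite normc_real.
Qed.

Lemma box_fun_annih n (g : n.+1.-tuple X -> R[i]) (j : 'I_n.+1) : bfun g ->
  bfun (fun t => cintegral sigma
    (fun s => (f s)%:C%C * Psi q (lift_perm j ord0 1%g) g (tcons (s, t)))).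
Proof.
move=> gK.
have := box_fun_integral mK Koo (box_fun_head_mul (box_fun_Psi (lift_perm j ord0 1%g) gK)).
by under [X in bfun X -> _]eq_fun do under eq_fun do rewrite /thead tnth0.
Qed.

(** By Fubini the adjoint of tensoring with [f] integrates the head variable against [f], which is
    real and so equals its conjugate. *)
Lemma L2_inner_head_tensor n (F : n.-tuple X -> R[i]) (g : n.+1.-tuple X -> R[i]) :
  L2 n F -> bfun g ->
  L2_inner (mu n.+1) (head_tensor f F) g =
  L2_inner (mu n) F (fun t => cintegral sigma (fun s => (f s)%:C%C * g (tcons (s, t)))).
Proof.
move=> FL gK; rewrite /L2_inner cintegral_tcons_swap; last first.
  apply: cintegrable_inner; first exact: square_integrable_head_tensor.
  exact: box_fun_square_integrable gK.
congr cintegral; apply/funext => t.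
have fgi : cintegrable sigma (fun s => (f s)%:C%C * g (tcons (s, t))).
  have := box_fun_slice mK Koo t (box_fun_head_mul gK).
  by under eq_fun do rewrite /thead tnth0.
rewrite -cintegral_conj// -cintegralZ; last exact: cintegrable_conj.
congr cintegral; apply/funext => s.
rewrite /head_tensor tcons_behead /thead tnth0 rmorphM /= oppr0.
by rewrite mulrCA mulrA.
Qed.

(** Self-adjointness and idempotence of [Psym] gather the symmetrization on the left factors. There
    [n.+1] times the symmetrized tensor is a sum over cosets, and each summand is carried to the
    right by [L2_inner_Psi] and [L2_inner_head_tensor]. The factor [n.+1] is the quotient of the
    Fock weights of the two degrees. *)
Lemma L2_inner_annih n (F : n.-tuple X -> R[i]) (g : n.+1.-tuple X -> R[i]) :
  L2 n F -> bfun g ->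
  n.+1%:R * L2_inner (mu n.+1) (Psym q (head_tensor f F)) (Psym q g) =
  L2_inner (mu n) (Psym q F) (Psym q (annih f g)).
Proof.
move=> FL gK.
have PFL := square_integrable_Psym q1 mq FL.
have HL G := @square_integrable_head_tensor n G.
have gL := box_fun_square_integrable mK Koo gK.
have aL : L2 n (annih f g).
  apply: (@box_fun_square_integrable _ _ _ _ K) => //.
  by apply: box_fun_sum => j; exact: box_fun_annih.
rewrite -L2_inner_Psym//; last first.
  by apply: square_integrable_Psym => //; exact: HL.
rewrite Psym_id// -L2_innerZl//; last first.
  by apply: square_integrable_Psym => //; exact: HL.
rewrite Psym_head_tensor L2_inner_suml//; last first.
  by move=> j; apply: square_integrable_Psi => //; exact: HL.
rewrite -[in RHS]L2_inner_Psym// Psym_id//.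
rewrite /annih L2_inner_sumr//; last first.
  move=> j; apply: (@box_fun_square_integrable _ _ _ _ K) => //.
  exact: box_fun_annih.
apply: eq_bigr => j _; rewrite L2_inner_Psi//; last exact: HL.
rewrite lift_permV invg1 L2_inner_head_tensor//.
exact: box_fun_Psi.
Qed.

End box_supported.
End creation_head.

(** * Annihilation operators *)

Section field_operators.
Context d (X : measurableType d) (R : realType).
Variable sigma : {sigma_finite_measure set X -> \bar R}.
Variable q : X -> X -> R[i].
Hypotheses (qK : forall s t, q s t * q t s = 1)
  (q1 : forall s t, normc (q s t) = 1)
  (mq : cmeasurable setT (fun p : X * X => q p.1 p.2)).
Variables (K : set X) (mK : measurable K) (Koo : (sigma K < +oo)%E).
Variable lambda : R.
Local Notation mu := (tuple_measure sigma).
Local Notation L2 n := (square_integrable (mu n)).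
Local Notation bfun := (box_fun K).
Implicit Types (f : X -> R) (g F G H : fock_vector X R).

Definition box_vector g : Prop :=
  (forall n, bfun (g n)) /\
  exists N : nat, forall n, (N <= n)%N -> g n = (fun _ => 0).

Definition sym_vector g : fock_vector X R := fun n => Psym q (g n).

Lemma Psym0 n : Psym q (fun _ : n.-tuple X => 0 : R[i]) = (fun _ => 0).
Proof.
apply/funext => t; rewrite /Psym big1 ?mulr0// => pi _.
by rewrite /Psi mulr0.
Qed.

Lemma fock_inner_fin N F G :
  (forall n, (N <= n)%N -> L2_inner (mu n) (F n) (G n) = 0) ->
  fock_inner sigma F G = \sum_(n < N) n`!%:R * L2_inner (mu n) (F n) (G n).
Proof.
move=> FG0; rewrite /fock_inner.
pose S M := \sum_(n < M) n`!%:R * L2_inner (mu n) (F n) (G n).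
rewrite -[RHS]/(S N).
have SN M : (N <= M)%N -> S M = S N.
  move=> NM; rewrite /S -(subnKC NM) big_split_ord /= [X in _ + X]big1 ?addr0//.
  by move=> i _; rewrite FG0 ?mulr0// leq_addr.
have E (u : R[i] -> R) : limn (fun M => u (S M)) = u (S N).
  by apply: lim_near_cst => //; exists N => // M /= /SN ->.
rewrite -[LHS]/(Complex (limn (fun M => complex.Re (S M)))
  (limn (fun M => complex.Im (S M)))).
by rewrite (E (@complex.Re R)) (E (@complex.Im R)); case: (S N).
Qed.

Lemma L2_inner0l n (u : n.-tuple X -> R[i]) :
  L2_inner (mu n) (fun _ => 0) u = 0.
Proof.
by rewrite /L2_inner; under eq_fun do rewrite mul0r; rewrite cintegral0.
Qed.

Lemma L2_inner0r n (u : n.-tuple X -> R[i]) :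
  L2_inner (mu n) u (fun _ => 0) = 0.
Proof.
rewrite /L2_inner; under eq_fun do rewrite conjc0 mulr0.
by rewrite cintegral0.
Qed.

Lemma Q_symmetricP n (u : n.-tuple X -> R[i]) :
  Q_symmetric sigma q u -> L2 n u /\ Psym q u = u %[ae mu n].
Proof.
move=> [uL [h hL uh]]; split => //.
have := ae_eq_Psym q uh; rewrite Psym_id// => Pu.
by move: uh Pu; apply: filterS2 => t E1 E2 _; rewrite E1// E2.
Qed.

Lemma Q_symmetric_Psym n (u : n.-tuple X -> R[i]) :
  L2 n u -> Q_symmetric sigma q (Psym q u).
Proof.
by move=> uL; split; [exact: square_integrable_Psym|exists u => //; exact: aeW].
Qed.

Lemma box_vector_annih f g : supported_fun K f -> box_vector g ->
  box_vector (fun n => annih sigma q f (g n.+1)).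
Proof.
move=> fK [gK [N gN]]; split.
  by move=> n; apply: box_fun_sum => j; exact: box_fun_annih.
exists N => n Nn; apply/funext => t; rewrite /annih big1// => j _.
rewrite gN 1?leqW// -[RHS](cintegral0 sigma); congr cintegral.
by apply/funext => s; rewrite /Psi !mulr0.
Qed.

Lemma sqnorm0 n : sqnorm (mu n) (fun _ => 0 : R[i]) = 0%E.
Proof.
rewrite /sqnorm; under eq_integral do rewrite normc0 expr0n.
by rewrite integral0.
Qed.

(** Existence half of the identification of [annihilation]; with [fock_eq_adjoint] it determines the
    value chosen by [xget] up to null sets. *)
Lemma creation_adjoint_box f g : supported_fun K f -> box_vector g ->
  creation_adjoint sigma q f (sym_vector g)
    (sym_vector (fun n => annih sigma q f (g n.+1))).
Proof.
move=> fK gB; have [aK [M aM]] := box_vector_annih fK gB.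
have [gK [N gN]] := gB.
have aL n : L2 n (annih sigma q f (g n.+1)).
  exact: (@box_fun_square_integrable _ _ _ _ K).
split.
  split; first by move=> n; exact: Q_symmetric_Psym.
  rewrite (nneseries_split 0 M); last first.
    move=> n _; rewrite mule_ge0 ?lee_fin//.
    by apply: integral_ge0 => t _; rewrite lee_fin exprn_ge0// normc_ge0.
  rewrite eseries0 ?adde0; last first.
    by move=> n; rewrite add0n => Mn _; rewrite /sym_vector aM// Psym0 sqnorm0 mule0.
  apply: lte_sum_pinfty => n _.
  rewrite lte_mul_pinfty ?lee_fin//.
  by have [] := square_integrable_Psym q1 mq (aL n).
move=> F [FQ _]; rewrite (@fock_inner_fin N.+1); last first.
  move=> n Nn; rewrite /sym_vector gN 1?ltnW// Psym0; exact: L2_inner0r.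
rewrite (@fock_inner_fin N); last first.
  move=> n Nn; rewrite /sym_vector (_ : annih _ _ _ _ = fun=> 0) ?Psym0.
    exact: L2_inner0r.
  apply/funext => t; rewrite /annih big1// => j _.
  rewrite gN 1?leqW// -[RHS](cintegral0 sigma); congr cintegral.
  by apply/funext => s; rewrite /Psi !mulr0.
(* A created vector has no component in degree 0, so the sum shifts by one; the weight (n+1)!
   supplies the factor required by [L2_inner_annih]. *)
rewrite big_ord_recl /creation L2_inner0l mulr0 add0r; apply: eq_bigr => n _.
have [FL PF] := Q_symmetricP (FQ n).
rewrite -[LHS]/(n.+1`!%:R * L2_inner (mu n.+1)
  (Psym q (head_tensor f (F n))) (Psym q (g n.+1))).
rewrite factS natrM -mulrA mulrCA.
rewrite -(ae_eq_L2_inner (f := Psym q (F n))); first last.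
- exact: PF.
- by have [] := square_integrable_Psym q1 mq (aL n).
- by case: FL.
- by have [] := square_integrable_Psym q1 mq FL.
by congr (_ * _); exact: (L2_inner_annih qK q1 mq mK Koo).
Qed.

(** Uniqueness half. Test vectors must be finite while [H] and [H'] are only in Fock space, so the
    difference is tested one degree at a time: [D] carries it in degree [n] and vanishes
    elsewhere. *)
Lemma fock_eq_adjoint f G H H' : creation_adjoint sigma q f G H ->
  creation_adjoint sigma q f G H' -> fock_eq sigma H H'.
Proof.
move=> [[HQ _] HG] [[HQ' _] HG'] n.
have [HL _] := HQ n; have [HL' _] := HQ' n.
pose D : fock_vector X R := fun m t =>
  if m == n then H m t + -1 * H' m t else 0.
have DL m : Q_symmetric sigma q (D m).
  rewrite /D; case: (eqVneq m n) => _.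
    have [Hm [h hL Hh]] := HQ m; have [Hm' [h' hL' Hh']] := HQ' m.
    split; first by apply: square_integrableD => //; exact: square_integrableZ.
    exists (fun t => h t + -1 * h' t).
      by apply: square_integrableD => //; exact: square_integrableZ.
    rewrite PsymD PsymZ; move: Hh Hh'.
    by apply: filterS2 => t E1 E2 _; rewrite E1// E2.
  by rewrite -[X in Q_symmetric _ _ X]Psym0; apply: Q_symmetric_Psym; exact: square_integrable0.
have Dfin : fock_fin sigma q D.
  split=> //; exists n.+1 => m nm; apply: aeW => t _.
  by rewrite /D gtn_eqF.
have D0 (J : fock_vector X R) : fock_inner sigma D J =
    n`!%:R * L2_inner (mu n) (D n) (J n).
  rewrite (@fock_inner_fin n.+1); last first.
    by move=> m nm; rewrite /D gtn_eqF// L2_inner0l.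
  rewrite big_ord_recr /= big1 ?add0r// => i _.
  by rewrite /D ltn_eqF// L2_inner0l mulr0.
have := HG D Dfin; rewrite HG'// !D0 => /(mulfI (card_perm_neq0 R n)) E.
have [DnL _] := DL n.
have := L2_inner_eq0 DnL; rewrite {2}/D eqxx.
have -> : L2_inner (mu n) (D n) (fun t => H n t + -1 * H' n t) = 0.
  rewrite L2_innerDr//; last exact: square_integrableZ.
  by rewrite L2_innerZr// E (rmorphN1 (@conjc R)) mulN1r addrN.
move=> /(_ erefl); apply: filterS => t /[apply].
by rewrite /D eqxx mulN1r => /eqP; rewrite subr_eq0 => /eqP.
Qed.

End field_operators.

(** * Field operators before symmetrization *)

Section raw_field_operators.
Context d (X : measurableType d) (R : realType).
Variable sigma : {sigma_finite_measure set X -> \bar R}.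
Variable q : X -> X -> R[i].
Hypotheses (qK : forall s t, q s t * q t s = 1)
  (q1 : forall s t, normc (q s t) = 1)
  (mq : cmeasurable setT (fun p : X * X => q p.1 p.2)).
Variables (K : set X) (mK : measurable K) (Koo : (sigma K < +oo)%E).
Variable lambda : R.
Local Notation mu := (tuple_measure sigma).
Local Notation L2 n := (square_integrable (mu n)).
Local Notation bfun := (box_fun K).
Local Notation bvec := (box_vector K).
Implicit Types (f : X -> R) (g F G H : fock_vector X R).

Definition raw_creation f g : fock_vector X R := fun n =>
  match n with 0 => fun _ => 0 | m.+1 => head_tensor f (g m) end.

Definition raw_annihilation f g : fock_vector X R :=
  fun n => annih sigma q f (g n.+1).

Definition raw_field f g : fock_vector X R := fun n t =>
  raw_creation f g t + lambda%:C%C * neutral f g t + raw_annihilation f g t.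

Lemma box_vector_creation f g :
  supported_fun K f -> bvec g -> bvec (raw_creation f g).
Proof.
move=> fK [gK [N gN]]; split.
  by case=> [|n]; [exact: box_fun0|exact: box_fun_head_tensor].
exists N.+1 => -[//|n] Nn; apply/funext => t.
by rewrite /= /head_tensor gN ?mulr0.
Qed.

Lemma box_vector_neutral f g :
  supported_fun K f -> bvec g -> bvec (neutral f g).
Proof.
move=> [mf [M fM] _] [gK [N gN]]; split; last first.
  by exists N => n Nn; apply/funext => t; rewrite /neutral gN// mulr0.
move=> n; apply: (@box_funMl _ _ _ _ _ _ _ (M *+ n)) => //.
  apply: cmeasurable_real; apply: measurable_sum => i.
  by apply: measurableT_comp => //; exact: measurable_tnth.
move=> t; rewrite normc_real (le_trans (ler_norm_sum _ _ _))//.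
rewrite -[in leRHS](card_ord n) -sumr_const; exact: ler_sum.
Qed.

Lemma box_vectorD g h : bvec g -> bvec h -> bvec (fun n t => g n t + h n t).
Proof.
move=> [gK [N gN]] [hK [M hM]]; split; first by move=> n; exact: box_funD.
exists (maxn M N) => n; rewrite geq_max => /andP[Mn Nn].
by apply/funext => t; rewrite gN// hM// addr0.
Qed.

Lemma box_vector_sum (I : eqType) (s : seq I) (h : I -> fock_vector X R) :
  (forall i, i \in s -> bvec (h i)) -> bvec (fun n t => \sum_(i <- s) h i n t).
Proof.
elim: s => [_|i s IH hB].
  split=> [n|]; first by under eq_fun do rewrite big_nil; exact: box_fun0.
  by exists 0 => n _; under eq_fun do rewrite big_nil.
rewrite (_ : (fun n t => _) = (fun n t => h i n t + \sum_(i <- s) h i n t)).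
  apply: box_vectorD; first by apply: hB; rewrite mem_head.
  by apply: IH => k ks; apply: hB; rewrite inE ks orbT.
by apply/functional_extensionality_dep => n; apply/funext => t; rewrite big_cons.
Qed.

Lemma box_vectorZ (c : R[i]) g : bvec g -> bvec (fun n t => c * g n t).
Proof.
move=> [gK [N gN]]; split; first by move=> n; exact: box_funZ.
by exists N => n Nn; apply/funext => t; rewrite gN// mulr0.
Qed.

Lemma box_vector_field f g :
  supported_fun K f -> bvec g -> bvec (raw_field f g).
Proof.
move=> fK gB; apply: box_vectorD.
  apply: box_vectorD; first exact: box_vector_creation.
  by apply: box_vectorZ; exact: box_vector_neutral.
exact: box_vector_annih.
Qed.

(** The sum of [f] over all coordinates is permutation invariant, so multiplication by it commutes
    with symmetrization. *)
Lemma neutral_Psym f g n :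
  neutral f (sym_vector q g) (n := n) = Psym q (neutral f g (n := n)).
Proof.
apply/funext => t; rewrite /neutral /sym_vector /Psym mulrCA mulr_sumr.
congr (_ * _); apply: eq_bigr => pi _; rewrite /Psi mulrCA; congr (_ * (_ %:C%C * _)).
rewrite [LHS](reindex_inj (@perm_inj _ pi)); apply: eq_bigr => i _.
by rewrite tnth_mktuple.
Qed.

(** [G] is a product of field operators applied to the vacuum, controlled only up to null sets; [g]
    is explicit. Measurability of [G] is recorded so that it can be replaced inside integrals. *)
Definition represents G g : Prop :=
  forall n, cmeasurable setT (G n) /\ G n = Psym q (g n) %[ae mu n].

Lemma cmeasurable_Psym n (u : n.-tuple X -> R[i]) :
  cmeasurable setT u -> cmeasurable setT (Psym q u).
Proof.
move=> mu_; apply: cmeasurableM; first exact: cmeasurable_cst.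
apply: cmeasurable_sum => pi; apply: cmeasurableM; first exact: cmeasurable_Qperm.
exact: cmeasurable_permute.
Qed.

(** The adjoint relation sees [G] only through integrals, so a change on a null set leaves its
    solutions the same. *)
Lemma represents_adjoint f G g : supported_fun K f -> bvec g ->
  represents G g ->
  creation_adjoint sigma q f G = creation_adjoint sigma q f (sym_vector q g).
Proof.
move=> fK [gB _] Gg; apply/funext => H; apply/propext.
suff E F : fock_fin sigma q F ->
    fock_inner sigma (creation q f F) G =
    fock_inner sigma (creation q f F) (sym_vector q g).
  split=> -[HQ HE]; split; try exact: HQ.
    by move=> F Ffin; rewrite -(E F Ffin); exact: HE.
  by move=> F Ffin; rewrite (E F Ffin); exact: HE.
move=> [FQ _]; rewrite /fock_inner.
suff E n : L2_inner (mu n) (creation q f F (n := n)) (G n) =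
           L2_inner (mu n) (creation q f F (n := n)) (sym_vector q g (n := n)).
  congr (Complex (limn _) (limn _)); apply/funext => N; congr (_ (_ : R[i]));
    apply: eq_bigr => i _; congr (_ * _); exact: E.
have [mG Ggn] := Gg n.
have mc : cmeasurable setT (creation q f F (n := n)).
  case: n {mG Ggn} => [|n]; first exact: cmeasurable_cst.
  apply: cmeasurable_Psym; apply: (cmeasurable_head_tensor fK).
  by have [[]] := FQ n.
apply: ae_eq_cintegral.
- by apply: cmeasurableM => //; exact: cmeasurable_conj.
- apply: cmeasurableM => //; apply: cmeasurable_conj.
  by apply: cmeasurable_Psym; have [] := gB n.
by move: Ggn; apply: filterS => t /[apply] ->.
Qed.

Lemma represents_field f G g : supported_fun K f -> bvec g ->
  represents G g -> represents (field sigma q lambda f G) (raw_field f g).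
Proof.
move=> fK gB Gg n.
have aG' : creation_adjoint sigma q f G (sym_vector q (raw_annihilation f g)).
  rewrite (represents_adjoint fK gB Gg).
  exact: (creation_adjoint_box qK q1 mq mK Koo fK gB).
(* A solution exists, so [xget] returns one and not its default value. *)
have aG : creation_adjoint sigma q f G (annihilation sigma q f G).
  by rewrite /annihilation; apply: xgetPex; exists (sym_vector q (raw_annihilation f g)).
have aE := fock_eq_adjoint q1 mq aG aG' n.
have [mGn Ggn] := Gg n.
have nE : neutral f G (n := n) = Psym q (neutral f g (n := n)) %[ae mu n].
  move: Ggn; apply: filterS => t E _.
  by rewrite -neutral_Psym /neutral /sym_vector E.
have cE : creation q f G (n := n) = Psym q (raw_creation f g (n := n)) %[ae mu n].
  case: n {mGn Ggn aE nE} => [|n].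
    by apply: aeW => t _; rewrite /= Psym0.
  rewrite /= -(Psym_head_tensor_Psym qK) -[X in X = _ %[ae _]]/(Psym q (head_tensor f (G n))).
  apply: ae_eq_Psym; have [_ /ae_behead] := Gg n.
  by apply: filterS => t E _; rewrite /head_tensor E.
split.
  apply: cmeasurableD.
    apply: cmeasurableD.
      case: n {mGn Ggn aE nE cE} => [|n]; first exact: cmeasurable_cst.
      apply: cmeasurable_Psym; apply: (cmeasurable_head_tensor fK).
      by have [] := Gg n.
    apply: cmeasurableM; first exact: cmeasurable_cst.
    apply: cmeasurableM => //; apply: cmeasurable_real.
    have [mf _ _] := fK; apply: measurable_sum => i.
    by apply: measurableT_comp => //; exact: measurable_tnth.
  by have [[/(_ n)[[]]]] := aG.
rewrite /raw_field PsymD PsymD PsymZ.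
move: nE aE cE; apply: filterS3 => t E1 E2 E3 _.
by rewrite /field E1// E2// E3.
Qed.

Lemma Psym_tuple0 (u : 0.-tuple X -> R[i]) : Psym q u = u.
Proof.
apply/funext => t; rewrite /Psym -[RHS](sum_perm_cst 0).
congr (_ * _); apply: eq_bigr => pi _; rewrite /Psi.
rewrite [permute _ _]tuple0 [t]tuple0 [Qperm _ _ _]big1 ?mul1r//.
by move=> [[]].
Qed.

Lemma box_vector_vacuum : bvec (@vacuum _ X R).
Proof.
split.
  case=> [|n]; rewrite /vacuum /=; last exact: box_fun0.
  split; first exact: cmeasurable_cst.
    by exists 1 => t; rewrite normc1.
  by move=> t [[]].
by exists 1%N => -[].
Qed.

Lemma represents_vacuum : represents (@vacuum _ X R) (@vacuum _ X R).
Proof.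
move=> n; split; first exact: cmeasurable_cst.
apply: aeW => t _; case: n t => [|n] t; first by rewrite Psym_tuple0.
by rewrite /vacuum /= Psym0.
Qed.

Definition raw_product n (f : 'I_n -> X -> R) (s : seq 'I_n) g : fock_vector X R :=
  foldr (fun i G => raw_field (f i) G) g s.

Lemma box_vector_product n (f : 'I_n -> X -> R) s g :
  (forall i, supported_fun K (f i)) -> bvec g -> bvec (raw_product f s g).
Proof. by move=> fK gB; elim: s => //= i s IH; exact: box_vector_field. Qed.

Lemma field_product_vacuum n (f : 'I_n -> X -> R) :
  (forall i, supported_fun K (f i)) ->
  field_product sigma q lambda f (@vacuum _ X R) [tuple] =
  raw_product f (enum 'I_n) (@vacuum _ X R) [tuple].
Proof.
move=> fK; have : represents (field_product sigma q lambda f (@vacuum _ X R))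
                    (raw_product f (enum 'I_n) (@vacuum _ X R)).
  rewrite /field_product; elim: (enum 'I_n) => [|i s IH] /=.
    exact: represents_vacuum.
  apply: represents_field => //; apply: box_vector_product => //.
  exact: box_vector_vacuum.
move=> /(_ 0)[_]; rewrite Psym_tuple0 => /tuple_measure0; exact.
Qed.

End raw_field_operators.

Lemma vacuum_stateE d (X : measurableType d) (R : realType)
    (sigma : {sigma_finite_measure set X -> \bar R})
    (p : fock_vector X R -> fock_vector X R) :
  vacuum_state sigma p = p (@vacuum _ X R) 0 [tuple].
Proof.
rewrite /vacuum_state (@fock_inner_fin _ _ _ _ 1%N).
  rewrite big_ord_recl big_ord0 addr0 mul1r /L2_inner cintegral_tuple0.
  by rewrite /vacuum conjc_nat; exact: mulr1.
case=> // n _; rewrite -[RHS](L2_inner0r sigma (p (@vacuum _ X R) n.+1)).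
by [].
Qed.

(** * Expansion of products of field operators *)

Section assignments.
Context (X : Type) (n : nat).
Implicit Types (x : n.-tuple X) (o : seq 'I_n) (s : seq X).

(* Variables not listed in [o] keep their value in [x], since then [index j o] is
   out of range. *)
Definition assign x o s : n.-tuple X :=
  [tuple nth (tnth x j) s (index j o) | j < n].

Lemma tnth_assign x o s j : tnth (assign x o s) j = nth (tnth x j) s (index j o).
Proof. by rewrite tnth_mktuple. Qed.

Lemma assign_nil x : assign x [::] [::] = x.
Proof. by apply: eq_from_tnth => j; rewrite tnth_assign. Qed.

Lemma assign_cons x b o u s : b \notin o -> size s = size o ->
  assign x (b :: o) (u :: s) = assign (assign x [:: b] [:: u]) o s.
Proof.
move=> bo so; apply: eq_from_tnth => j; rewrite !tnth_assign /=.
case: eqVneq => [<-|bj] //=.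
by rewrite nth_default// so memNindex.
Qed.

Lemma map_assign x o s : uniq o -> size s = size o ->
  [seq tnth (assign x o s) j | j <- o] = s.
Proof.
move=> uo so; case: o uo so => [|b0 o] uo so; first by case: s so.
apply: (@eq_from_nth _ (tnth x b0)); first by rewrite size_map so.
move=> k; rewrite size_map => ko.
rewrite (nth_map b0)// tnth_assign index_uniq//; apply: set_nth_default.
by rewrite so.
Qed.

(** Functions of the variables of the open blocks are kept as functions of all [n] variables. This
    predicate records which ones they really use, so that the filler values left by [assign] are
    harmless. *)
Definition depends_on (Y : Type) (A : {pred 'I_n}) (G : n.-tuple X -> Y) : Prop :=
  forall x y, (forall b, b \in A -> tnth x b = tnth y b) -> G x = G y.

End assignments.

(** The analogue of [unbump] for positions in a list, to be matched with [lift] on the side of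
    tuples. *)
Lemma index_rem (T : eqType) (s : seq T) (b c : T) : uniq s -> b \in s -> c != b ->
  index c (rem b s) = (index c s - (index b s < index c s))%N.
Proof.
elim: s => // a s IH /= /andP[as_ us]; rewrite inE.
case: (eqVneq a b) => [<- _|ab /=]; first by rewrite eq_sym => /negbTE-> /=; lia.
move=> bs cb.
have [_|_] := eqVneq a c; first by rewrite ltn0.
by rewrite IH// ltnS; case: ltnP => H; lia.
Qed.

Lemma big_take_tuple (R : Type) (idx : R) (op : Monoid.law idx) (T : Type)
    (k j : nat) (t : k.-tuple T) (F : T -> R) : (j <= k)%N ->
  \big[op/idx]_(l < k | (l < j)%N) F (tnth t l) = \big[op/idx]_(u <- take j t) F u.
Proof.
move=> jk; case: k t jk => [|k] t jk.
  by rewrite (tuple0 t) big_nil big1 // => -[].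
pose u0 := tnth t ord0.
rewrite (big_nth u0) size_takel ?size_tuple// big_mkord.
rewrite (@big_ord_widen _ _ _ j k.+1 (fun l => F (nth u0 (take j t) l)))//.
by apply: eq_bigr => l lj; rewrite nth_take// (tnth_nth u0).
Qed.

Lemma enum_ord_sorted n (A : {set 'I_n}) :
  sorted (fun a b : 'I_n => (a < b)%N) (enum A).
Proof.
rewrite /enum_mem -enumT; apply: sorted_filter; first by move=> ? ? ?; exact: ltn_trans.
by have := iota_ltn_sorted 0 n; rewrite -val_enum_ord sorted_map enumT.
Qed.

Lemma enum_setU1_min n (A : {set 'I_n}) (i : 'I_n) :
  (forall b, b \in A -> (i < b)%N) -> enum (i |: A)%SET = i :: enum A.
Proof.
move=> Ai; apply: (@irr_sorted_eq _ (fun a b : 'I_n => (a < b)%N)).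
- by move=> ? ? ?; exact: ltn_trans.
- by move=> ?; exact: ltnn.
- exact: enum_ord_sorted.
- rewrite /= path_sortedE; last by move=> ? ? ?; exact: ltn_trans.
  rewrite enum_ord_sorted andbT; apply/allP => b; rewrite mem_enum; exact: Ai.
- by move=> b; rewrite mem_enum !inE mem_enum.
Qed.

Lemma enum_setD1 n (A : {set 'I_n}) (b : 'I_n) :
  enum (A :\ b)%SET = rem b (enum A).
Proof.
rewrite rem_filter ?enum_uniq// /enum_mem -filter_predI.
by apply: eq_filter => j; rewrite /= !inE.
Qed.

(** Turns the product over positions arising from a permutation into the product over labels in
    [contract]. *)
Lemma take_index_enum n (A : {set 'I_n}) (b : 'I_n) : b \in A ->
  take (index b (enum A)) (enum A) = [seq d : 'I_n <- enum A | (d < b)%N].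
Proof.
move=> bA; have bE : b \in enum A by rewrite mem_enum.
have := enum_ord_sorted A; set e := enum A in bE *.
have tr : transitive (fun a b : 'I_n => (a < b)%N) by move=> ? ? ?; exact: ltn_trans.
elim: e bE => // a e IH; rewrite inE /= => bE.
rewrite path_sortedE// => /andP[/allP ae se].
case: (eqVneq a b) bE => [ab _|ab]; last first.
  by move=> be; rewrite ae//= IH.
rewrite ab ltnn take0; apply/esym/eqP; rewrite -[_ == _]negbK -has_filter.
by apply/hasPn => d /ae; rewrite ab -leqNgt => /ltnW.
Qed.

(** * Linearity of the unsymmetrized field operators *)

Section linearity.
Context d (X : measurableType d) (R : realType).
Variable sigma : {sigma_finite_measure set X -> \bar R}.
Variable q : X -> X -> R[i].
Hypotheses (q1 : forall s t, normc (q s t) = 1)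
  (mq : cmeasurable setT (fun p : X * X => q p.1 p.2)).
Variables (K : set X) (mK : measurable K) (Koo : (sigma K < +oo)%E).
Variable lambda : R.
Local Notation bvec := (box_vector K).
Local Notation raw_field := (raw_field sigma q lambda).
Local Notation raw_product := (raw_product sigma q lambda).

Lemma raw_field0 f : raw_field f (fun n t => 0) = (fun n t => 0).
Proof.
apply/functional_extensionality_dep => n; apply/funext => t.
rewrite /raw_field /raw_annihilation /annih /neutral [X in _ + X]big1; last first.
  move=> j _; rewrite -[RHS](cintegral0 sigma); congr cintegral.
  by apply/funext => s; rewrite /Psi !mulr0.
by case: n t => [|n] t; rewrite /raw_creation ?/head_tensor !mulr0 !addr0.
Qed.

(** The annihilation part needs integrable slices to be additive, hence the restriction to box
    vectors. *)
Lemma raw_fieldD f g h : supported_fun K f -> bvec g -> bvec h ->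
  raw_field f (fun n t => g n t + h n t) =
  (fun n t => raw_field f g t + raw_field f h t).
Proof.
move=> fK [gK _] [hK _]; apply/functional_extensionality_dep => n; apply/funext => t.
have E : raw_annihilation sigma q f (fun n t => g n t + h n t) t =
    raw_annihilation sigma q f g t + raw_annihilation sigma q f h t.
  rewrite /raw_annihilation /annih -big_split; apply: eq_bigr => j _ /=.
  have sl u : box_fun K u -> cintegrable sigma
      (fun s => (f s)%:C%C * Psi q (lift_perm j ord0 1%g) u (tcons (s, t))).
    move=> uK.
    have := box_fun_slice mK Koo t (box_fun_head_mul fK (box_fun_Psi q1 mq (lift_perm j ord0 1%g) uK)).
    by under eq_fun do rewrite /thead tnth0.
  rewrite -cintegralD; try exact: sl.
  by congr cintegral; apply/funext => s; rewrite /Psi -mulrDr -mulrDr.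
rewrite /raw_field E /neutral !mulrDr.
have -> : raw_creation f (fun n t => g n t + h n t) t =
    raw_creation f g t + raw_creation f h t.
  case: n t {E} => [|n] t; rewrite /raw_creation ?addr0//.
  by rewrite /head_tensor mulrDr.
ring.
Qed.

Lemma raw_field_sum f (I : eqType) (s : seq I) (h : I -> fock_vector X R) :
  supported_fun K f -> (forall i, i \in s -> bvec (h i)) ->
  raw_field f (fun n t => \sum_(i <- s) h i n t) =
  (fun n t => \sum_(i <- s) raw_field f (h i) t).
Proof.
move=> fK; elim: s => [_|i s IH hB].
  transitivity (raw_field f (fun n t => 0)).
    by congr (raw_field f _); apply/functional_extensionality_dep => n;
       apply/funext => t; rewrite big_nil.
  rewrite raw_field0; apply/functional_extensionality_dep => n.
  by apply/funext => t; rewrite big_nil.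
transitivity (raw_field f (fun n t => h i n t + \sum_(i <- s) h i n t)).
  by congr (raw_field f _); apply/functional_extensionality_dep => n;
     apply/funext => t; rewrite big_cons.
have hs k : k \in s -> bvec (h k) by move=> ks; apply: hB; rewrite inE ks orbT.
rewrite raw_fieldD//; last exact: box_vector_sum.
  rewrite IH//; apply/functional_extensionality_dep => n.
  by apply/funext => t; rewrite big_cons.
by apply: hB; rewrite mem_head.
Qed.

Lemma raw_product_sum n (f : 'I_n -> X -> R) l (I : eqType) (s : seq I)
    (h : I -> fock_vector X R) :
  (forall i, supported_fun K (f i)) -> (forall i, i \in s -> bvec (h i)) ->
  raw_product f l (fun n t => \sum_(i <- s) h i n t) =
  (fun n t => \sum_(i <- s) raw_product f l (h i) t).
Proof.
move=> fK hB; elim: l => [//|a l IH] /=.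
rewrite IH raw_field_sum// => i si.
by apply: (box_vector_product q1 mq mK Koo) => //; exact: hB.
Qed.

Lemma raw_productD n (f : 'I_n -> X -> R) l (g h : fock_vector X R) :
  (forall i, supported_fun K (f i)) -> bvec g -> bvec h ->
  raw_product f l (fun n t => g n t + h n t) =
  (fun n t => raw_product f l g t + raw_product f l h t).
Proof.
move=> fK gB hB; elim: l => [//|a l IH] /=.
by rewrite IH raw_fieldD//; exact: (box_vector_product q1 mq mK Koo).
Qed.

End linearity.

(** * Vectors whose variables are labelled by the open blocks *)

Section open_vectors.
Context d (X : measurableType d) (R : realType).
Variable sigma : {sigma_finite_measure set X -> \bar R}.
Variable q : X -> X -> R[i].
Variables (n : nat) (x0 : n.-tuple X).
Implicit Types (A : {set 'I_n}) (G : n.-tuple X -> R[i]) (f : X -> R).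

(* The function [G] of the variables labelled by [A], in increasing order. *)
Definition open_vector A G : fock_vector X R := fun k t =>
  if k == #|A| then G (assign x0 (enum A) t) else 0.

Lemma size_enum A : size (enum A) = #|A|. Proof. by rewrite cardE. Qed.

(** The new label is smaller than all open ones, so its variable stands first in the increasing
    enumeration, where creation puts it. *)
Lemma creation_open_vector f A G (i : 'I_n) : (forall b, b \in A -> (i < b)%N) ->
  depends_on (mem A) G ->
  raw_creation f (open_vector A G) =
  open_vector (i |: A)%SET (fun x => (f (tnth x i))%:C%C * G x).
Proof.
move=> Ai GA; have iA : i \notin A by apply/negP => /Ai; rewrite ltnn.
apply/functional_extensionality_dep => k; apply/funext => t.
rewrite /open_vector cardsU1 iA add1n (enum_setU1_min Ai).
case: k t => [//|k] t; rewrite /= /head_tensor eqSS.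
case: eqP => [kA|_]; last by rewrite mulr0.
case/tupleP: t => u t; rewrite tnth_assign /= eqxx /thead tnth0; congr (_ * _).
apply: GA => b bA; rewrite !tnth_assign /=.
have [bi|bi] := eqVneq i b; first by rewrite -bi (negbTE iA) in bA.
by rewrite /=.
Qed.

Lemma neutral_open_vector f A G :
  neutral f (open_vector A G) =
  (fun k t => \sum_(b in A) open_vector A (fun x => (f (tnth x b))%:C%C * G x) t).
Proof.
apply/functional_extensionality_dep => k; apply/funext => t.
rewrite /neutral /open_vector; case: eqP => [kA|_]; last by rewrite mulr0 big1.
rewrite -mulr_suml rmorph_sum; congr (_ * _).
rewrite -(big_tuple _ _ t xpredT (fun s => (f s)%:C%C)).
have st : size t = size (enum A) by rewrite size_tuple size_enum.
rewrite -{1}(map_assign x0 (enum_uniq A) st) big_map.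
by rewrite big_enum.
Qed.

Definition set1var (x : n.-tuple X) (b : 'I_n) (s : X) := assign x [:: b] [:: s].

(** Closes the block [b]: its variable is integrated out after passing the variables of the smaller
    open labels, that is, of the blocks opened after [b], at the cost of one [q] each. *)
Definition contract f A (b : 'I_n) G : n.-tuple X -> R[i] := fun x =>
  cintegral sigma (fun s =>
    (f s)%:C%C * (\prod_(c in A | (c < b)%N) q s (tnth x c)) * G (set1var x b s)).

(** Position [j] of the increasing enumeration is the label [b]: the positions to its left are the
    smaller labels, and without it the others enumerate [A] minus [b]. *)
Lemma annih_open_vector f A G k (j : 'I_k.+1) (t : k.-tuple X) :
  depends_on (mem A) G -> #|A| = k.+1 ->
  forall b, index b (enum A) = j ->
  cintegral sigma (fun s => (f s)%:C%C *
    Psi q (lift_perm j ord0 1%g) (open_vector A G (n := k.+1)) (tcons (s, t))) =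
  open_vector (A :\ b)%SET (contract f A b G) t.
Proof.
move=> GA cA b bj.
have bA : b \in A by rewrite -mem_enum -index_mem bj size_enum cA ltn_ord.
have cAb : #|(A :\ b)%SET| = k by move: (cardsD1 b A); rewrite bA cA; lia.
rewrite /open_vector cAb eqxx /contract; congr cintegral; apply/funext => s.
rewrite /Psi Qperm_lift_ord0 cA eqxx mulrA; congr (_ * _ * _).
  have jk : (j <= k)%N by rewrite -ltnS.
  rewrite (big_take_tuple _ t (q s) jk).
  set x := assign x0 _ t.
  have st : size t = size (enum (A :\ b)%SET) by rewrite size_tuple size_enum cAb.
  rewrite -{1}(map_assign x0 (enum_uniq _) st) -/x -map_take big_map.
  rewrite (_ : take j _ = take (index b (enum A)) (enum A)); last first.
    by rewrite bj enum_setD1 remE bj take_size_cat// size_takel// size_enum cA ltnW.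
  by rewrite take_index_enum// big_filter big_enum_cond.
apply: GA => c cA'; rewrite tnth_assign /set1var tnth_assign [index c [:: b]]/=.
set y := permute _ _.
have cm : (index c (enum A) < k.+1)%N.
  by rewrite -cA -size_enum index_mem mem_enum.
rewrite -[index c _]/(val (Ordinal cm)) -tnth_nth /y tnth_mktuple.
have [cb|bc] := eqVneq b c.
  rewrite (_ : Ordinal cm = j); last by apply: val_inj; rewrite /= -cb bj.
  by rewrite lift_perm_id tnth0.
(* A position other than [j] is [lift j l], where [l] is the position of [c] once [b] is removed. *)
case: (unliftP j (Ordinal cm)) => [l El|Ej]; last first.
  move/(congr1 val): Ej; rewrite /= -bj => E.
  have bE : b \in enum A by rewrite mem_enum.
  by move: bc; rewrite -(nth_index b bE) -E nth_index ?eqxx// mem_enum.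
rewrite El lift_perm_lift perm1 tnthS tnth_assign (tnth_nth (tnth x0 c)).
congr nth; rewrite enum_setD1 index_rem ?enum_uniq ?mem_enum//; last first.
  by rewrite eq_sym.
have /= -> := congr1 val El; rewrite bj.
exact/esym/(bumpK j l).
Qed.

Lemma annihilation_open_vector f A G : depends_on (mem A) G ->
  raw_annihilation sigma q f (open_vector A G) =
  (fun k t => \sum_(b in A) open_vector (A :\ b)%SET (contract f A b G) t).
Proof.
move=> GA; apply/functional_extensionality_dep => k; apply/funext => t.
rewrite /raw_annihilation /annih.
have [cA|cA] := eqVneq #|A| k.+1; last first.
  rewrite big1; last first.
    move=> j _; rewrite -[RHS](cintegral0 sigma); congr cintegral.
    by apply/funext => s; rewrite /Psi /open_vector eq_sym (negbTE cA) !mulr0.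
  rewrite big1// => b bA; rewrite /open_vector ifF//.
  by apply: contra_neqF cA => /eqP->; rewrite (cardsD1 b A) bA add1n.
rewrite -[RHS](big_enum _ _ A (fun b => open_vector (A :\ b)%SET (contract f A b G) t)).
have sz : size (enum A) = k.+1 by rewrite size_enum.
have [b0 b0A] : exists b0, b0 \in A by apply/card_gt0P; rewrite cA.
rewrite (big_nth b0) sz big_mkord; apply: eq_bigr => j _.
apply: annih_open_vector => //.
by rewrite index_uniq ?enum_uniq// sz.
Qed.

Lemma depends_contract f A b G : depends_on (mem A) G ->
  depends_on (mem (A :\ b)%SET) (contract f A b G).
Proof.
move=> GA x y xy; rewrite /contract; congr cintegral; apply/funext => s.
congr (_ * _ * _).
  apply: eq_bigr => c /andP[cA cb]; rewrite xy// !inE cA andbT.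
  by rewrite neq_ltn cb.
apply: GA => c cA; rewrite /set1var !tnth_assign /=.
by have [//|bc] := eqVneq b c; rewrite /= xy// !inE eq_sym bc.
Qed.

End open_vectors.

Section open_box_vectors.
Context d (X : measurableType d) (R : realType).
Variable sigma : {sigma_finite_measure set X -> \bar R}.
Variable q : X -> X -> R[i].
Hypotheses (q1 : forall s t, normc (q s t) = 1)
  (mq : cmeasurable setT (fun p : X * X => q p.1 p.2)).
Variables (K : set X) (mK : measurable K) (Koo : (sigma K < +oo)%E).
Variables (n : nat) (x0 : n.-tuple X).
Local Notation bvec := (box_vector K).
Local Notation ovec := (open_vector x0).
Implicit Types (A : {set 'I_n}) (G : n.-tuple X -> R[i]) (f : X -> R).

Lemma box_vector_annih_open f A G b : depends_on (mem A) G -> b \in A ->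
  supported_fun K f -> bvec (ovec A G) ->
  bvec (ovec (A :\ b)%SET (contract sigma q f A b G)).
Proof.
move=> GA bA fK [vK _]; split; last first.
  exists #|A|.+1 => k Ak; apply/funext => t; rewrite /open_vector ifF//.
  by apply/eqP => E; move: Ak; rewrite E; have := subset_leq_card (subD1set A b); lia.
move=> k; have [cA|cA] := eqVneq #|A| k.+1; last first.
  rewrite (_ : ovec _ _ (n := k) = fun=> 0); first exact: box_fun0.
  apply/funext => t; rewrite /open_vector ifF//.
  by apply: contra_neqF cA => /eqP->; rewrite (cardsD1 b A) bA add1n.
have bj : (index b (enum A) < k.+1)%N by rewrite -cA -size_enum index_mem mem_enum.
have := box_fun_annih q1 mq mK Koo fK (Ordinal bj) (vK k.+1).
congr box_fun; apply/funext => t.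
exact: (annih_open_vector sigma q x0 f (j := Ordinal bj) t GA cA erefl).
Qed.

Lemma box_vector_neutral_open (c : R[i]) f A G b :
  supported_fun K f -> bvec (ovec A G) ->
  bvec (ovec A (fun x => c * (f (tnth x b))%:C%C * G x)).
Proof.
move=> [mf [M fM] _] [vK [N vN]].
have E k : ovec A (fun x => c * (f (tnth x b))%:C%C * G x) (n := k) =
    fun t => c * (f (tnth (assign x0 (enum A) t) b))%:C%C * ovec A G t.
  by apply/funext => t; rewrite /open_vector; case: ifP => //; rewrite mulr0.
split=> [k|]; last by exists N => k Nk; rewrite E vN//; apply/funext => t; rewrite mulr0.
rewrite E; apply: (@box_funMl _ _ _ _ _ _ _ (normc c * M)) => //.
  apply: cmeasurableM; first exact: cmeasurable_cst.
  apply: cmeasurable_real; apply: measurableT_comp => //.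
  have [bk|bk] := ltnP (index b (enum A)) k.
    under eq_fun do rewrite tnth_assign -[index b _]/(val (Ordinal bk)) -tnth_nth.
    exact: measurable_tnth.
  under eq_fun do rewrite tnth_assign nth_default ?size_tuple//.
  exact: measurable_cst.
by move=> t; rewrite normcM normc_real ler_wpM2l ?normc_ge0.
Qed.

End open_box_vectors.

(** * Block maps, built from the largest index downwards *)

Section block_maps.
Variable n : nat.
Implicit Types (phi psi : {ffun 'I_n -> 'I_n}) (A : {set 'I_n}) (m : nat).

Definition before phi m (b : 'I_n) : bool :=
  [exists j : 'I_n, (j < m)%N && (phi j == b)].

(** The maxima of the blocks that straddle the cut at [m]; they label the variables alive once the
    operators from [m] on have acted. *)
Definition open_labels phi m : {set 'I_n} :=
  [set b : 'I_n | [&& (m <= b)%N, phi b == b & before phi m b]].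

(* [phi] maps every element to the maximum of its block, for a partition
   without singletons. *)
Definition block_map phi : bool :=
  [forall b : 'I_n, [&& (b <= phi b)%N, phi (phi b) == phi b
                      & (phi b == b) ==> before phi b b]].

(** The block maps still reachable from a state: they keep the choices made from [m] on, and exactly
    the blocks of [A] continue below [m]. *)
Definition completes phi m A psi : bool :=
  [&& block_map psi, [forall b : 'I_n, (m <= b)%N ==> (psi b == phi b)]
    & open_labels psi m == A].

(* [phi] describes the blocks of the elements that are at least [m], [A] being
   the set of maxima of the blocks which still have to be completed. *)
Definition partial_block_map m A phi : Prop :=
  [/\ forall b : 'I_n, (b <= phi b)%N /\ phi (phi b) = phi b,
      forall b : 'I_n, (b < m)%N -> phi b = b,
      forall b, b \in A -> (m <= b)%N /\ phi b = b
    & forall b : 'I_n, (m <= b)%N -> phi b = b -> b \in A \/ before phi b b].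

Lemma beforeP phi m b :
  reflect (exists2 j : 'I_n, (j < m)%N & phi j = b) (before phi m b).
Proof.
apply: (iffP existsP) => [[j /andP[jm /eqP]]|[j jm jb]]; exists j => //.
by rewrite jm jb eqxx.
Qed.

Lemma beforeS phi (i b : 'I_n) : before phi i.+1 b = before phi i b || (phi i == b).
Proof.
apply/beforeP/orP => [[j]|[/beforeP[j ji jb]|/eqP ib]].
- rewrite ltnS leq_eqVlt => /orP[/eqP/val_inj->|ji] jb.
    by right; apply/eqP.
  by left; apply/beforeP; exists j.
- by exists j => //; rewrite ltnW.
- by exists i.
Qed.

Lemma block_mapP phi :
  reflect (forall b : 'I_n, [/\ (b <= phi b)%N, phi (phi b) = phi b
                       & phi b = b -> before phi b b]) (block_map phi).
Proof.
apply: (iffP forallP) => H b.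
  by have /and3P[-> /eqP-> /implyP I] := H b; split=> // /eqP.
have [-> -> I] := H b; rewrite eqxx /=; apply/implyP => /eqP; exact: I.
Qed.

Lemma partial_block_map0 phi : partial_block_map 0 finset.set0 phi -> block_map phi.
Proof.
move=> [H1 _ _ H4]; apply/block_mapP => b; have [? ?] := H1 b; split=> //.
by move=> /(H4 b (leq0n _))[]//; rewrite inE.
Qed.

(** Nothing lies below 0, so a state with open blocks has no completion. This mirrors the vanishing
    of the vacuum component of a vector that still contains particles. *)
Lemma completes0 phi A psi : partial_block_map 0 A phi ->
  completes phi 0 A psi = (A == finset.set0) && (psi == phi).
Proof.
move=> pb; have o0 : open_labels psi 0 = finset.set0.
  by apply/setP => b; rewrite !inE /before; apply/negbTE/negP => /and3P[_ _ /existsP[j]].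
rewrite /completes o0 [_ == A]eq_sym; apply/and3P/andP.
  move=> [_ /forallP E /eqP A0]; split; first exact/eqP.
  by apply/eqP/ffunP => b; apply/eqP; have := E b.
move=> [/eqP A0 /eqP->]; rewrite A0 in pb *; split=> //.
  exact: partial_block_map0.
by apply/forallP => b; rewrite eqxx.
Qed.

Definition redirect phi (i b : 'I_n) : {ffun 'I_n -> 'I_n} :=
  [ffun j => if j == i then b else phi j].

Lemma redirectE phi i b : redirect phi i b i = b.
Proof. by rewrite ffunE eqxx. Qed.

Lemma redirectN phi i b j : j != i -> redirect phi i b j = phi j.
Proof. by rewrite ffunE => /negbTE->. Qed.

Section step.
Variables (i : 'I_n) (A : {set 'I_n}) (phi : {ffun 'I_n -> 'I_n}).
Hypothesis pb : partial_block_map i.+1 A phi.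

Let Ai b : b \in A -> (i < b)%N. Proof. by case: pb => _ _ + _ => /[apply] -[]. Qed.

Let Afix b : b \in A -> phi b = b. Proof. by case: pb => _ _ + _ => /[apply] -[]. Qed.

Let neAi b : b \in A -> b != i. Proof. by move=> /Ai; apply: contraTneq => ->; rewrite ltnn. Qed.

Let phii : phi i = i. Proof. by case: pb => _ + _ _; apply. Qed.

Let ltn_leq (b : 'I_n) : b != i -> (i < b)%N = (i <= b)%N.
Proof.
move=> bi; rewrite ltn_neqAle; suff -> : i != b :> nat by [].
by apply: contra_neq bi => /val_inj.
Qed.

(** The map is unchanged: an unprocessed index is already sent to itself, as the maximum of a new
    block must be. *)
Lemma partial_block_map_new : partial_block_map i (i |: A)%SET phi.
Proof.
case: pb => H1 H2 H3 H4; split=> //.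
- by move=> b bi; apply: H2; rewrite ltnS ltnW.
- by move=> b; rewrite !inE => /orP[/eqP->//|/H3[/ltnW]].
- move=> b; rewrite leq_eqVlt => /orP[/eqP/val_inj<- _|ib].
    by left; rewrite !inE eqxx.
  by move=> /(H4 b ib)[bA|]; [left; rewrite !inE bA orbT|right].
Qed.

Let redirect_before (b c : 'I_n) : (i < c)%N -> phi c = c -> before phi c c ->
  before (redirect phi i b) c c.
Proof.
move=> ic cc /beforeP[j jc jE]; apply/beforeP; exists j => //.
rewrite redirectN//; apply: contraTneq ic => ji.
by rewrite -jE ji phii ltnn.
Qed.

Let redirect1 b : b \in A ->
  forall c : 'I_n, (c <= redirect phi i b c)%N /\
    redirect phi i b (redirect phi i b c) = redirect phi i b c.
Proof.
case: pb => H1 H2 H3 H4 bA c; have [->|ci] := eqVneq c i.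
  by rewrite redirectE redirectN ?neAi// Afix// ltnW// Ai.
rewrite (redirectN _ _ ci); have [cc cE] := H1 c; split=> //.
rewrite redirectN//; apply: contra_neq ci => ci.
by apply: val_inj; have := H2 c; rewrite -ci in cc *; rewrite ltnS => /(_ cc) ->.
Qed.

Lemma partial_block_map_add b : b \in A -> partial_block_map i A (redirect phi i b).
Proof.
move=> bA; split; first exact: redirect1.
- move=> c ci; rewrite redirectN; last by rewrite neq_ltn ci.
  by case: pb => _ H2 _ _; apply: H2; rewrite ltnS ltnW.
- move=> c cA; rewrite redirectN ?neAi//; split; [exact/ltnW/Ai|exact: Afix].
- move=> c; rewrite leq_eqVlt => /orP[/eqP/val_inj<-|ic].
    by rewrite redirectE => bi; move: (neAi bA); rewrite bi eqxx.
  rewrite redirectN ?neq_ltn ?ic ?orbT// => cc.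
  case: pb => _ _ _ /(_ c ic cc)[]; first by left.
  by right; exact: redirect_before.
Qed.

(** The map is the same as when [i] is added to the block; only [b] leaves the open labels, and [i]
    now witnesses that the block is no singleton. *)
Lemma partial_block_map_close b : b \in A ->
  partial_block_map i (A :\ b)%SET (redirect phi i b).
Proof.
move=> bA; have [H1 H2 H3 H4] := partial_block_map_add bA; split=> //.
  by move=> c; rewrite !inE => /andP[_ /H3].
move=> c ic cc; have [cA|] := H4 c ic cc; last by right.
have [->|cb] := eqVneq c b; last by left; rewrite !inE cb.
by right; apply/beforeP; exists i; rewrite ?Ai// redirectE.
Qed.

Let agree_step psi (c : 'I_n) chi : (forall j, j != i -> chi j = phi j) ->
  chi i = c ->
  [forall b : 'I_n, (i <= b)%N ==> (psi b == chi b)] =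
  [forall b : 'I_n, (i < b)%N ==> (psi b == phi b)] && (psi i == c).
Proof.
move=> chiE chii; apply/forallP/andP => [H|[/forallP H /eqP pc] b].
  split; last by have := H i; rewrite leqnn chii.
  apply/forallP => b; apply/implyP => ib; have := H b; rewrite ltnW//= chiE//.
  by rewrite neq_ltn ib orbT.
have [->|bi] := eqVneq b i; first by rewrite pc chii eqxx implybT.
by apply/implyP; rewrite leq_eqVlt val_eqE eq_sym (negbTE bi) /= => ib;
  have := H b; rewrite ib chiE.
Qed.

(** A block map has no singletons, so if it fixes [i] the block of [i] reaches below [i], which
    makes [i] an open label at level [i]. *)
Lemma completes_new psi :
  completes phi i (i |: A)%SET psi = completes phi i.+1 A psi && (psi i == i).
Proof.
rewrite /completes (@agree_step psi i)//.
case: (boolP (block_map psi)) => //= /block_mapP psiB.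
case: (boolP [forall b, _]) => //= _.
case: (eqVneq (psi i) i) => [pi|]; rewrite ?andbT ?andbF//=.
have -> : open_labels psi i = (i |: open_labels psi i.+1)%SET.
  apply/setP => b; rewrite !inE beforeS pi; have [->|bi] := eqVneq b i.
    by rewrite leqnn pi eqxx /=; have [_ _ ->] := psiB i.
  by rewrite orbF /= (ltn_leq bi).
apply/eqP/eqP => [E|->//].
apply/setP => b; have /setP/(_ b) := E; rewrite !in_setU1.
have [->|bi] //= := eqVneq b i.
rewrite inE ltnn => _; apply/esym/negbTE/negP => /Ai.
by rewrite ltnn.
Qed.

(** Adding to a block and closing it produce the same map. Their completions are told apart by
    whether the block still has an element below [i]: if so, [b] stays open; if not, [i] is the
    minimum. *)
Lemma completes_add psi b : b \in A ->
  completes (redirect phi i b) i A psi =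
  [&& completes phi i.+1 A psi, psi i == b & before psi i b].
Proof.
move=> bA; rewrite /completes (@agree_step psi b); last 2 first.
- by move=> j; exact: redirectN.
- exact: redirectE.
case: (boolP (block_map psi)) => //= /block_mapP psiB.
case: (boolP [forall b, _]) => //= /forallP agr.
case: (eqVneq (psi i) b) => [pib|]; rewrite ?andbF//=.
have psib : psi b = b by have /eqP := implyP (agr b) (Ai bA); rewrite Afix.
have E : before psi i b -> open_labels psi i = open_labels psi i.+1.
  move=> ib; apply/setP => c; rewrite !inE beforeS pib.
  have [->|ci] := eqVneq c i.
    by rewrite ltnn pib (negbTE (neAi bA)) andbF.
  rewrite (ltn_leq ci).
  by have [<-|] := eqVneq b c; rewrite ?ib ?orbF.
apply/eqP/andP => [iA|[/eqP<- /E//]].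
have ib : before psi i b by move: bA; rewrite -iA inE => /and3P[].
by rewrite -(E ib) iA.
Qed.

Lemma completes_close psi b : b \in A ->
  completes (redirect phi i b) i (A :\ b)%SET psi =
  [&& completes phi i.+1 A psi, psi i == b & ~~ before psi i b].
Proof.
move=> bA; rewrite /completes (@agree_step psi b); last 2 first.
- by move=> j; exact: redirectN.
- exact: redirectE.
case: (boolP (block_map psi)) => //= /block_mapP psiB.
case: (boolP [forall b, _]) => //= /forallP agr.
case: (eqVneq (psi i) b) => [pib|]; rewrite ?andbF//=.
have psib : psi b = b by have /eqP := implyP (agr b) (Ai bA); rewrite Afix.
have E : ~~ before psi i b -> open_labels psi i = (open_labels psi i.+1 :\ b)%SET.
  move=> ib; apply/setP => c; rewrite !inE beforeS pib.
  have [->|ci] := eqVneq c i.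
    by rewrite ltnn pib (negbTE (neAi bA)) !andbF.
  rewrite (ltn_leq ci).
  have [->|cb] := eqVneq c b; first by rewrite (negbTE ib) !andbF.
  by rewrite orbF.
have bS : b \in open_labels psi i.+1.
  by rewrite inE Ai// psib eqxx beforeS pib eqxx orbT.
apply/eqP/andP => [iA|[/eqP<- /E//]].
have ib : ~~ before psi i b.
  apply/negP => ib; have : b \in open_labels psi i.
    by rewrite inE ltnW ?Ai// psib eqxx.
  by rewrite iA !inE eqxx.
split=> //; rewrite -(finset.setD1K bS) -(E ib) iA.
by rewrite finset.setD1K.
Qed.

Lemma completes_label psi : completes phi i.+1 A psi -> psi i != i -> psi i \in A.
Proof.
move=> /and3P[/block_mapP psiB _ /eqP<-] pii.
have [ip pp _] := psiB i.
by rewrite inE pp eqxx beforeS eqxx orbT !andbT (ltn_leq pii).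
Qed.

(** In each completion [i] is a maximum, a middle element or a minimum of its block. The three sums
    match the creation, neutral and annihilation parts of a field operator. *)
Lemma sum_completes (V : nmodType) (F : {ffun 'I_n -> 'I_n} -> V) :
  \sum_(psi | completes phi i.+1 A psi) F psi =
  \sum_(psi | completes phi i (i |: A)%SET psi) F psi +
  \sum_(b in A) \sum_(psi | completes (redirect phi i b) i A psi) F psi +
  \sum_(b in A) \sum_(psi | completes (redirect phi i b) i (A :\ b)%SET psi) F psi.
Proof.
rewrite (bigID (fun psi : {ffun _} => psi i == i)) /= -addrA; congr (_ + _).
  by apply: eq_bigl => psi; rewrite completes_new.
rewrite (partition_big (fun psi : {ffun _} => psi i) (mem A)); last first.
  by move=> psi /andP[]; exact: completes_label.
rewrite -big_split; apply: eq_bigr => b bA /=.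
rewrite (bigID (fun psi => before psi i b)) /=; congr (_ + _).
  apply: eq_bigl => psi; rewrite completes_add//.
  case: (completes _ _ _ _) => //=.
  case: (eqVneq (psi i) b) => [->|_]; last by rewrite andbF.
  by rewrite neAi.
apply: eq_bigl => psi; rewrite completes_close//.
case: (completes _ _ _ _) => //=.
case: (eqVneq (psi i) b) => [->|_]; last by rewrite andbF.
by rewrite neAi.
Qed.

End step.
End block_maps.

(** * The vacuum component as a sum over block maps *)

Section expansion.
Context d (X : measurableType d) (R : realType).
Variable sigma : {sigma_finite_measure set X -> \bar R}.
Variable q : X -> X -> R[i].
Hypotheses (q1 : forall s t, normc (q s t) = 1)
  (mq : cmeasurable setT (fun p : X * X => q p.1 p.2)).
Variables (K : set X) (mK : measurable K) (Koo : (sigma K < +oo)%E).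
Variable lambda : R.
Variables (n : nat) (x0 : n.-tuple X) (f : 'I_n -> X -> R).
Hypothesis fK : forall i, supported_fun K (f i).
Local Notation bvec := (box_vector K).
Local Notation ovec := (open_vector x0).
Implicit Types (A : {set 'I_n}) (G : n.-tuple X -> R[i]).
Implicit Types phi psi : {ffun 'I_n -> 'I_n}.

Definition new_block (i : 'I_n) G : n.-tuple X -> R[i] :=
  fun x => (f i (tnth x i))%:C%C * G x.

Definition add_block (i b : 'I_n) G : n.-tuple X -> R[i] :=
  fun x => lambda%:C%C * (f i (tnth x b))%:C%C * G x.

(** The case is read off [psi] alone, and so is the set of open labels when a block is closed; each
    block map thus contributes a plain [foldr] with no running state. *)
Definition process psi (i : 'I_n) G : n.-tuple X -> R[i] :=
  if psi i == i then new_block i G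
  else if before psi i (psi i) then add_block i (psi i) G
  else contract sigma q (f i) (open_labels psi i.+1) (psi i) G.

Lemma raw_field_open_vector (i : 'I_n) A G :
  (forall b, b \in A -> (i < b)%N) -> depends_on (mem A) G ->
  raw_field sigma q lambda (f i) (ovec A G) =
  (fun k t => ovec (i |: A)%SET (new_block i G) t +
    \sum_(b <- enum A) ovec A (add_block i b G) t +
    \sum_(b <- enum A) ovec (A :\ b)%SET (contract sigma q (f i) A b G) t).
Proof.
move=> Ai GA; apply/functional_extensionality_dep => k; apply/funext => t.
rewrite /raw_field (creation_open_vector x0 (f i) Ai GA) neutral_open_vector.
rewrite annihilation_open_vector// mulr_sumr !big_enum.
congr (_ + _ + _); apply: eq_bigr => b bA.
rewrite /open_vector /add_block; case: ifP => _; last by rewrite mulr0.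
by rewrite mulrA.
Qed.

(** Induction on the number [m] of operators still to be applied, for all states [A], [phi] and the
    function [G] they carry. One operator splits the vector by [raw_field_open_vector], and the
    completions split the same way by [sum_completes]. *)
Lemma raw_product_expansion m A phi G : (m <= n)%N ->
  partial_block_map m A phi -> depends_on (mem A) G -> bvec (ovec A G) ->
  raw_product sigma q lambda f (take m (enum 'I_n)) (ovec A G) [tuple] =
  \sum_(psi | completes phi m A psi)
    foldr (process psi) G (take m (enum 'I_n)) x0.
Proof.
elim: m A phi G => [|m IH] A phi G mn pb GA vK.
  under eq_bigl do rewrite completes0//.
  (* An open vector can have a vacuum component only when no label is open. *)
  rewrite take0 /= /open_vector eq_sym cards_eq0.
  case: eqP => [A0|_] /=; last by rewrite big_pred0.
  by rewrite big_pred1_eq A0 enum_set0 assign_nil.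
pose i := Ordinal mn.
have takeS : take m.+1 (enum 'I_n) = rcons (take m (enum 'I_n)) i.
  rewrite (take_nth i) ?size_enum_ord//; congr rcons.
  by apply: val_inj; rewrite /= nth_enum_ord.
have {}pb : partial_block_map i.+1 A phi by [].
have [_ _ HA _] := pb.
have Ai b : b \in A -> (i < b)%N by move=> /HA[].
have Am b : b \in A -> (b != i) by move=> /Ai; apply: contraTneq => ->; rewrite ltnn.
have vnew : bvec (ovec (i |: A)%SET (new_block i G)).
  by rewrite /new_block -(creation_open_vector x0 (f i) Ai GA); exact: box_vector_creation.
have vadd b : bvec (ovec A (add_block i b G)).
  exact: box_vector_neutral_open.
have vclose b : b \in A -> bvec (ovec (A :\ b)%SET (contract sigma q (f i) A b G)).
  by move=> bA; exact: (box_vector_annih_open q1 mq mK Koo).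
have vaddS : bvec (fun k t => \sum_(b <- enum A) ovec A (add_block i b G) t).
  exact: box_vector_sum.
have vcloseS : bvec (fun k t => \sum_(b <- enum A)
    ovec (A :\ b)%SET (contract sigma q (f i) A b G) t).
  by apply: box_vector_sum => b; rewrite mem_enum; exact: vclose.
rewrite takeS /raw_product foldr_rcons -/(raw_product _ _ _ _ _ _).
rewrite raw_field_open_vector// (raw_productD q1 mq mK Koo)//; last first.
  exact: box_vectorD.
rewrite (raw_productD q1 mq mK Koo)// !(raw_product_sum q1 mq mK Koo)//; last first.
  by move=> b; rewrite mem_enum; exact: vclose.
rewrite (sum_completes pb) !big_enum; congr (_ + _ + _).
- rewrite (IH _ phi)//; [|exact: ltnW|exact: (partial_block_map_new pb)|].
    apply: eq_bigr => psi /and3P[_ /forallP/(_ i) + _].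
    rewrite leqnn => /eqP psii; rewrite foldr_rcons [process psi i G]/process psii.
    by have [_ /(_ i (ltnSn _)) -> _ _] := pb; rewrite eqxx.
  move=> x y xy; rewrite /new_block xy ?inE ?eqxx//; congr (_ * _).
  by apply: GA => b bA; apply: xy; rewrite !inE bA orbT.
- apply: eq_bigr => b bA; rewrite (IH _ (redirect phi i b))//.
  + apply: eq_bigr => psi; rewrite (completes_add pb)// => /and3P[_ /eqP psib ib].
    by rewrite foldr_rcons [process psi i G]/process psib (negbTE (Am b bA)) ib.
  + exact: ltnW.
  + exact: (partial_block_map_add pb).
  by move=> x y xy; rewrite /add_block xy// (GA x y xy).
- apply: eq_bigr => b bA; rewrite (IH _ (redirect phi i b))//.
  + apply: eq_bigr => psi; rewrite (completes_close pb)// => /and3P[C /eqP psib ib].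
    rewrite foldr_rcons [process psi i G]/process psib (negbTE (Am b bA)) (negbTE ib).
    (* By [completes], the open labels that [process] reads off [psi] are those in [A]. *)
    by have /and3P[_ _ /eqP->] := C.
  + exact: ltnW.
  + exact: (partial_block_map_close pb).
  + exact: depends_contract.
  exact: vclose.
Qed.

Lemma raw_product_vacuum :
  raw_product sigma q lambda f (enum 'I_n) (@vacuum _ X R) [tuple] =
  \sum_(psi | block_map psi) foldr (process psi) (fun=> 1) (enum 'I_n) x0.
Proof.
have vE : @vacuum _ X R = ovec finset.set0 (fun=> 1).
  apply/functional_extensionality_dep => k; apply/funext => t.
  by rewrite /vacuum /open_vector cards0; case: eqP.
have tn : enum 'I_n = take n (enum 'I_n) by rewrite take_oversize ?size_enum_ord.
(* Before any operator acts, every index is unprocessed: the map is the identity and no block is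
   open. *)
rewrite tn vE (@raw_product_expansion _ _ [ffun i => i])//.
- apply: eq_bigl => psi; rewrite /completes; case: (block_map psi) => //=.
  apply/andP; split; first by apply/forallP => b; rewrite leqNgt ltn_ord.
  by apply/eqP/setP => b; rewrite !inE leqNgt ltn_ord.
- split=> [b|b _|b|b]; rewrite ?ffunE ?inE//.
  by rewrite leqNgt ltn_ord.
- by rewrite -vE; exact: box_vector_vacuum.
Qed.

End expansion.

(** * Integration over the variables of a list of labels *)

Section label_integrals.
Context d (X : measurableType d) (R : realType).
Variable sigma : {sigma_finite_measure set X -> \bar R}.
Variables (K : set X) (mK : measurable K) (Koo : (sigma K < +oo)%E).
Variable n : nat.
Local Notation mu := (tuple_measure sigma).
Implicit Types (L : seq 'I_n) (H : n.-tuple X -> R[i]) (x : n.-tuple X).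

Definition label_integral L H x : R[i] :=
  cintegral (mu (size L)) (fun s : (size L).-tuple X => H (assign x L s)).

(** Support in [K] is required only for the coordinates in [S], those that may be integrated; the
    others are parameters. *)
Definition label_fun (S : {pred 'I_n}) H : Prop :=
  [/\ cmeasurable setT H, exists M : R, forall x, normc (H x) <= M
    & forall x b, b \in S -> ~ K (tnth x b) -> H x = 0].

Lemma measurable_assign k x L :
  measurable_fun setT (fun s : k.-tuple X => assign x L s).
Proof.
apply/measurable_fun_tnthP => i.
have [ik|ik] := ltnP (index i L) k.
  rewrite (_ : _ \o _ = fun s : k.-tuple X => tnth s (Ordinal ik)).
    exact: measurable_tnth.
  by apply/funext => s; rewrite -[LHS]/(tnth (assign x L s) i) tnth_assign [RHS](tnth_nth (tnth x i)).
rewrite (_ : _ \o _ = cst (tnth x i)); first exact: measurable_cst.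
by apply/funext => s; rewrite -[LHS]/(tnth (assign x L s) i) tnth_assign nth_default// size_tuple.
Qed.

Lemma box_fun_assign k (S : {pred 'I_n}) H L x : k = size L -> uniq L ->
  {subset L <= S} -> label_fun S H ->
  box_fun K (fun s : k.-tuple X => H (assign x L s)).
Proof.
move=> kL uL LS [mH [M HM] H0]; split.
- apply: (@cmeasurable_comp _ _ _ _ _ H) => //.
  exact: measurable_assign.
- by exists M.
move=> t [l tl]; have lL : (l < size L)%N by rewrite -kL.
have [b0 _] : exists b0, b0 \in L.
  by case: L lL {kL uL LS} => // b0 ? _; exists b0; rewrite mem_head.
apply: (H0 _ (nth b0 L l)); first exact/LS/mem_nth.
by rewrite tnth_assign index_uniq// -tnth_nth.
Qed.

Lemma label_integralM (S : {pred 'I_n}) L H (u : n.-tuple X -> R[i]) x :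
  uniq L -> {subset L <= S} -> label_fun S H ->
  depends_on [predC L] u ->
  label_integral L (fun y => u y * H y) x = u x * label_integral L H x.
Proof.
move=> uL LS HS uN; rewrite /label_integral -cintegralZ; last first.
  exact: box_fun_cintegrable (box_fun_assign x erefl uL LS HS).
congr cintegral; apply/funext => s; congr (_ * _).
apply: uN => b /=; rewrite inE => bL; rewrite tnth_assign nth_default//.
by rewrite memNindex// size_tuple.
Qed.

Lemma label_integral_cons (S : {pred 'I_n}) b L H x :
  uniq (b :: L) -> {subset b :: L <= S} -> label_fun S H ->
  label_integral (b :: L) H x =
  cintegral sigma (fun s => label_integral L H (set1var x b s)).
Proof.
move=> ubL bLS HS; rewrite /label_integral cintegral_tcons; last first.
  exact: box_fun_cintegrable (box_fun_assign x erefl ubL bLS HS).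
congr cintegral; apply/funext => s; congr cintegral; apply/funext => t.
have /andP[bL _] := ubL.
by rewrite /tcons /= assign_cons// size_tuple.
Qed.

Lemma label_funM (S S' : {pred 'I_n}) (u H : n.-tuple X -> R[i]) :
  label_fun S u -> label_fun S' H ->
  label_fun [predU S & S'] (fun x => u x * H x).
Proof.
move=> [mu_ [N uN] u0] [mH [M HM] H0]; split; first exact: cmeasurableM.
  by exists (N * M) => x; rewrite normcM ler_pM ?normc_ge0.
move=> x b; rewrite inE => /orP[bS|bS'] xb; first by rewrite (u0 x b)// mul0r.
by rewrite (H0 x b)// mulr0.
Qed.

Lemma eq_label_fun (S S' : {pred 'I_n}) H : S =i S' -> label_fun S H -> label_fun S' H.
Proof. by move=> SS' [? ? H0]; split=> // x b; rewrite -SS'; exact: H0. Qed.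

(** The order of integration is free because the tuple measure is permutation invariant. This
    reconciles the order in which blocks are closed with the enumeration of the partition. *)
Lemma perm_label_integral (S : {pred 'I_n}) k L L' H x : uniq L ->
  {subset L <= S} -> label_fun S H -> perm_eq L L' -> size L' = k ->
  label_integral L H x =
  cintegral (mu k) (fun s : k.-tuple X => H (assign x L' s)).
Proof.
move=> uL LS HS LL' kL'; have kL : size L = k by rewrite (perm_size LL').
pose l : k.-tuple 'I_n := tcast kL (in_tuple L).
have lE : l = L :> seq _ by rewrite /l val_tcast.
have -> : label_integral L H x =
    cintegral (mu k) (fun s : k.-tuple X => H (assign x L s)).
  by rewrite /label_integral; case: _ / kL {l lE}.
have [pi L'E] : exists pi : 'S_k, L' = [tuple tnth l (pi i) | i < k].
  by apply/tuple_permP; rewrite perm_sym lE.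
have HL : cintegrable (mu k) (fun s : k.-tuple X => H (assign x L s)).
  exact: box_fun_cintegrable (box_fun_assign x _ uL LS HS).
rewrite -(cintegral_permute (pi^-1)%g HL).
congr cintegral; apply/funext => s; congr H; apply: eq_from_tnth => j.
rewrite !tnth_assign; have [jl|jl] := boolP (j \in L); last first.
  rewrite !nth_default// memNindex ?size_tuple ?kL ?kL'//.
  by rewrite -(perm_mem LL').
have mk : (index j L < k)%N by rewrite -kL index_mem.
pose m := Ordinal mk; rewrite -[index j L]/(val m) -tnth_nth tnth_mktuple.
have uL' : uniq L' by rewrite -(perm_uniq LL').
have -> : j = nth j L' ((pi^-1)%g m).
  by rewrite L'E -tnth_nth tnth_mktuple permKV (tnth_nth j) lE nth_index.
rewrite index_uniq// ?kL'//; exact: tnth_nth.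
Qed.

End label_integrals.

(** * From nested contractions to a single integral *)

Section block_map_weights.
Context d (X : measurableType d) (R : realType).
Variable sigma : {sigma_finite_measure set X -> \bar R}.
Variable q : X -> X -> R[i].
Hypotheses (q1 : forall s t, normc (q s t) = 1)
  (mq : cmeasurable setT (fun p : X * X => q p.1 p.2)).
Variables (K : set X) (mK : measurable K) (Koo : (sigma K < +oo)%E).
Variable lambda : R.
Variables (n : nat) (f : 'I_n -> X -> R).
Hypothesis fK : forall i, supported_fun K (f i).
Variable psi : {ffun 'I_n -> 'I_n}.
Implicit Types (l : seq 'I_n) (x y : n.-tuple X) (i b c : 'I_n).
Local Notation process := (process sigma q lambda f psi).

Definition block_min i : bool := (psi i != i) && ~~ before psi i (psi i).

(** The labels integrated out while [l] is processed: a block is closed at its minimum, but its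
    variable is labelled by its maximum. *)
Definition closed_labels l : seq 'I_n := [seq psi j | j <- l & block_min j].

Definition crossing_factor i x : R[i] :=
  \prod_(c in open_labels psi i.+1 | (c < psi i)%N) q (tnth x (psi i)) (tnth x c).

(** All elements of a block use the variable of its maximum. The second factor distinguishes a
    maximum, a middle element and a minimum. *)
Definition factor i x : R[i] := (f i (tnth x (psi i)))%:C%C *
  (if psi i == i then 1 else if before psi i (psi i) then lambda%:C%C
   else crossing_factor i x).

Definition weight l x : R[i] := \prod_(j <- l) factor j x.

Lemma cmeasurable_tnth2 i b :
  cmeasurable setT (fun x : n.-tuple X => q (tnth x i) (tnth x b)).
Proof.
apply: (@cmeasurable_comp _ _ _ _ _ (fun p : X * X => q p.1 p.2)
  (fun x : n.-tuple X => (tnth x i, tnth x b))) => //.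
by apply: measurable_fun_pair; exact: measurable_tnth.
Qed.

Lemma label_fun_factor i : label_fun K (pred1 (psi i)) (factor i).
Proof.
have [mf [M fM] f0] := fK i; rewrite /factor; split.
- apply: cmeasurableM.
    by apply: cmeasurable_real; apply: measurableT_comp => //; exact: measurable_tnth.
  case: (psi i == i); first exact: cmeasurable_cst.
  case: (before psi i (psi i)); first exact: cmeasurable_cst.
  by apply: cmeasurable_prod => c; exact: cmeasurable_tnth2.
- exists (M * (1 + `|lambda|)) => x; rewrite normcM normc_real ler_pM ?normc_ge0//.
  case: ifP => _; first by rewrite normc1 lerDl.
  case: ifP => _; first by rewrite normc_real lerDr.
  rewrite (_ : normc _ = 1) ?lerDl// /crossing_factor.
  elim/big_ind : _ => [|u v u1 v1|//]; first exact: normc1.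
  by rewrite normcM u1 v1 mulr1.
- by move=> x b /eqP-> xK; rewrite /factor f0// mul0r.
Qed.

Lemma label_fun_weight l : label_fun K [in map psi l] (weight l).
Proof.
elim: l => [|i l IH].
  rewrite /weight; split; first by under eq_fun do rewrite big_nil; exact: cmeasurable_cst.
    by exists 1 => x; rewrite big_nil normc1.
  by [].
rewrite (_ : weight (i :: l) = fun x => factor i x * weight l x); last first.
  by apply/funext => x; rewrite /weight big_cons.
have := label_funM (label_fun_factor i) IH.
by apply: eq_label_fun => b; rewrite !inE.
Qed.

(** A block with an element at most [i] has its minimum before all of [l], so it is not closed
    there. *)
Lemma before_closed i l c : path (fun a b : 'I_n => (a < b)%N) i l ->
  before psi i.+1 c -> c \notin closed_labels l.
Proof.
rewrite path_sortedE; last by move=> ? ? ?; exact: ltn_trans.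
move=> /andP[/allP il _] /beforeP[j ji jc].
apply/negP => /mapP[k]; rewrite mem_filter => /andP[/andP[_ kmin] /il ik] ck.
move/negP : kmin; apply; apply/beforeP; exists j; last by rewrite jc.
by rewrite (leq_trans ji).
Qed.

Lemma uniq_closed_labels l : sorted (fun a b : 'I_n => (a < b)%N) l ->
  uniq (closed_labels l).
Proof.
elim: l => // i l IH /= il; have sl := path_sorted il.
rewrite /closed_labels /=; case: ifP => imin /=; last exact: IH.
rewrite IH// andbT; apply: before_closed il _.
by apply/beforeP; exists i.
Qed.

Lemma sub_closed_labels l : {subset closed_labels l <= map psi l}.
Proof. by apply/mem_subseq/map_subseq/filter_subseq. Qed.

Lemma factor_depends i l : path (fun a b : 'I_n => (a < b)%N) i l ->
  depends_on [predC closed_labels l] (factor i).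
Proof.
move=> il x y xy; have E c : before psi i.+1 c -> tnth x c = tnth y c.
  by move=> ci; apply: xy; rewrite inE; exact: before_closed il ci.
have Ei : tnth x (psi i) = tnth y (psi i) by apply: E; apply/beforeP; exists i.
rewrite /factor /crossing_factor Ei; congr (_ * _).
case: ifP => // _; case: ifP => // _.
by apply: eq_bigr => c /andP[+ _]; rewrite inE => /and3P[_ _ /E ->].
Qed.

(** The variables of [factor i] have not been integrated out by the operators in [l], so this factor
    moves under their integrals. Closing a block then adds one integration by
    [label_integral_cons]. *)
Lemma process_label_integral l : sorted (fun a b : 'I_n => (a < b)%N) l ->
  foldr process (fun=> 1) l = label_integral sigma (closed_labels l) (weight l).
Proof.
elim: l => [_|i l IH il].
  apply/funext => x /=; rewrite /label_integral cintegral_tuple0.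
  by rewrite /weight big_nil.
have sl := path_sorted il; rewrite /= IH//; apply/funext => x.
have ul := uniq_closed_labels sl; have sub := @sub_closed_labels l.
have pull y : factor i y * label_integral sigma (closed_labels l) (weight l) y =
    label_integral sigma (closed_labels l) (weight (i :: l)) y.
  rewrite -(label_integralM mK Koo y ul sub (label_fun_weight l) (factor_depends il)).
  by congr label_integral; apply/funext => z; rewrite /weight big_cons.
rewrite /process /closed_labels /= /block_min.
case: (eqVneq (psi i) i) => [pi|pi] /=.
  by rewrite -pull /new_block /factor pi eqxx mulr1.
case: ifP => pb /=.
  by rewrite -pull /add_block /factor (negbTE pi) pb [lambda%:C%C * _]mulrC.
have u' : uniq (psi i :: closed_labels l).
  by have := uniq_closed_labels il; rewrite /closed_labels /= /block_min pi pb.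
have sub' : {subset psi i :: closed_labels l <= map psi (i :: l)}.
  by have := @sub_closed_labels (i :: l); rewrite /closed_labels /= /block_min pi pb.
rewrite (label_integral_cons mK Koo x u' sub' (label_fun_weight (i :: l))).
rewrite /contract; congr cintegral; apply/funext => s; rewrite -pull.
congr (_ * _); have xs : tnth (set1var x (psi i) s) (psi i) = s.
  by rewrite tnth_assign /= eqxx.
rewrite /factor (negbTE pi) pb xs; congr (_ * _); rewrite /crossing_factor xs.
apply: eq_bigr => c /andP[_ ci]; congr q.
have cb : psi i != c by rewrite neq_ltn ci orbT.
by rewrite tnth_assign /= (negbTE cb).
Qed.

End block_map_weights.

(** * Partitions without singletons *)

Section partitions_and_block_maps.
Variable n : nat.
Implicit Types (V : {set {set 'I_n}}) (B : {set 'I_n}) (psi : {ffun 'I_n -> 'I_n}).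
Local Notation pblock := finset.pblock.
Local Notation parts := (partitions_ge2 n).

Definition max_map V : {ffun 'I_n -> 'I_n} :=
  [ffun i => [arg max_(j > i | j \in pblock V i) j]%N].

Definition map_partition psi : {set {set 'I_n}} :=
  preim_partition psi [set: 'I_n]%SET.

Section partition_facts.
Variable V : {set {set 'I_n}}.
Hypothesis Vge2 : V \in parts.

Lemma ge2_partition : finset.partition V [set: 'I_n]%SET.
Proof. by move: Vge2; rewrite inE => /andP[]. Qed.

Let triV : finset.trivIset V. Proof. by have /and3P[] := ge2_partition. Qed.

Lemma mem_pblockT i : i \in pblock V i.
Proof.
by have /and3P[/eqP cV _ _] := ge2_partition; rewrite finset.mem_pblock cV inE.
Qed.

Lemma pblock_memT i : pblock V i \in V.
Proof.
by have /and3P[/eqP cV _ _] := ge2_partition; rewrite finset.pblock_mem// cV inE.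
Qed.

Lemma pblockT B i : B \in V -> i \in B -> pblock V i = B.
Proof. exact: finset.def_pblock. Qed.

Lemma max_mapP i :
  max_map V i \in pblock V i /\ forall j, j \in pblock V i -> (j <= max_map V i)%N.
Proof. by rewrite ffunE; case: arg_maxnP => //; exact: mem_pblockT. Qed.

Lemma max_map_unique B i b : B \in V -> i \in B -> b \in B ->
  (forall j, j \in B -> (j <= b)%N) -> max_map V i = b.
Proof.
move=> BV iB bB bmax; have [] := max_mapP i; rewrite (pblockT BV iB) => mB mmax.
by apply/val_inj/eqP; rewrite eqn_leq bmax// mmax.
Qed.

Lemma max_map_block B i : B \in V -> i \in B ->
  max_map V i \in B /\ forall j, j \in B -> (j <= max_map V i)%N.
Proof. by move=> BV iB; have := max_mapP i; rewrite (pblockT BV iB). Qed.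

Lemma eq_max_map B i j : B \in V -> i \in B -> (max_map V j == max_map V i) = (j \in B).
Proof.
move=> BV iB; have [mB mmax] := max_map_block BV iB.
apply/eqP/idP => [ij|jB]; last exact: max_map_unique BV jB mB mmax.
have [] := max_mapP j; rewrite ij => mj _.
by rewrite -(pblockT BV mB) (pblockT (pblock_memT j) mj) mem_pblockT.
Qed.

Lemma block_map_max_map : block_map (max_map V).
Proof.
apply/block_mapP => b; have BV := pblock_memT b; have bB := mem_pblockT b.
have [maxB maxP] := max_mapP b; split; first exact: maxP.
  exact: (max_map_unique BV maxB maxB maxP).
move=> mb; move: Vge2; rewrite inE => /andP[_ /forallP/(_ (pblock V b))].
rewrite BV /= => /card_gt1P[x [y [xB yB xy]]].
(* A block has two elements, hence one other than [b]; it is smaller because [b] is the maximum. *)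
have [j jB jb] : exists2 j, j \in pblock V b & j != b.
  by have [xb|xb] := eqVneq x b; [exists y; rewrite // eq_sym -xb|exists x].
apply/beforeP; exists j.
  by rewrite ltn_neqAle jb -[X in (_ <= val X)%N]mb maxP.
by rewrite -[RHS]mb; apply/eqP; rewrite (eq_max_map _ BV bB).
Qed.

Lemma max_mapK : map_partition (max_map V) = V.
Proof.
rewrite -[RHS](finset.equivalence_partition_pblock ge2_partition).
rewrite /map_partition /preim_partition.
apply: eq_imset => i; apply/setP => j; rewrite !inE /=.
by rewrite eq_sym (eq_max_map _ (pblock_memT i) (mem_pblockT i)).
Qed.

End partition_facts.

Section block_map_facts.
Variable psi : {ffun 'I_n -> 'I_n}.
Hypothesis psiB : block_map psi.

Let eqR : {in [set: 'I_n]%SET & &, equivalence_rel (fun x y => psi x == psi y)}.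
Proof. by split=> // /eqP->. Qed.

Lemma mem_pblock_map i j : (j \in pblock (map_partition psi) i) = (psi i == psi j).
Proof. by rewrite /map_partition finset.pblock_equivalence_partition ?inE. Qed.

Lemma map_partition_ge2 : map_partition psi \in parts.
Proof.
have pP := finset.preim_partitionP psi [set: 'I_n]%SET.
rewrite inE pP /=; apply/forallP => B; apply/implyP => BV.
have /and3P[/eqP cV tV V0] := pP.
have [i iB] : exists i, i \in B by apply/set0Pn; apply: contraNneq V0 => <-.
have BE : B = pblock (map_partition psi) i by rewrite (finset.def_pblock tV BV iB).
have [_ pp _] := block_mapP _ psiB i.
have [_ _ /(_ pp)/beforeP[j ji jE]] := block_mapP _ psiB (psi i).
apply/card_gt1P; exists j, (psi i); rewrite BE !mem_pblock_map jE pp eqxx.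
by split=> //; rewrite neq_ltn ji.
Qed.

Lemma map_partitionK : max_map (map_partition psi) = psi.
Proof.
apply/ffunP => i; have [pi pp _] := block_mapP _ psiB i.
apply: (max_map_unique map_partition_ge2 (pblock_memT map_partition_ge2 i)).
- exact: mem_pblockT map_partition_ge2 i.
- by rewrite mem_pblock_map pp.
move=> j; rewrite mem_pblock_map => /eqP->.
by have [] := block_mapP _ psiB j.
Qed.

End block_map_facts.

Lemma sum_block_maps (T : nmodType) (F : {ffun 'I_n -> 'I_n} -> T) :
  \sum_(psi | block_map psi) F psi = \sum_(V in parts) F (max_map V).
Proof.
rewrite (reindex_onto max_map map_partition) /=; last exact: map_partitionK.
apply: eq_bigl => V; apply/andP/idP => [[Vb /eqP<-]|VP].
  exact: map_partition_ge2.
by split; [exact: block_map_max_map|rewrite max_mapK].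
Qed.

End partitions_and_block_maps.

(** * Products over the blocks of a partition *)

Section blocks.
Variables (n : nat) (V : {set {set 'I_n}}).
Hypothesis Vge2 : V \in partitions_ge2 n.
Local Notation psi := (max_map V).
Local Notation pblock := finset.pblock.

Lemma big_min_le (s : seq 'I_n) (B : {set 'I_n}) (m : 'I_n) : m \in s -> m \in B ->
  (\big[minn/n]_(i <- s | i \in B) i <= m)%N.
Proof.
elim: s => // a s IH; rewrite inE big_cons => /orP[/eqP<- ->|ms mB].
  exact: geq_minl.
case: ifP => _; last exact: IH.
by rewrite (leq_trans (geq_minr _ _))// IH.
Qed.

Lemma minB_P (B : {set 'I_n}) : B \in V ->
  exists m : 'I_n, [/\ m \in B, minB B = m & forall j, j \in B -> (m <= j)%N].
Proof.
move=> BV; have /and3P[_ _ V0] := ge2_partition Vge2.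
have /set0Pn[i iB] : B != finset.set0 by apply: contraNneq V0 => <-.
have [m mB mP] := @arg_minnP _ i (mem B) (fun j => j : nat) iB.
exists m; split=> //; apply/eqP; rewrite eqn_leq /minB big_min_le ?mem_index_enum//=.
elim/big_ind : _ => [|x y|j]; first exact/ltnW/ltn_ord.
  by rewrite leq_min => -> ->.
exact: mP.
Qed.

Lemma maxB_E (B : {set 'I_n}) i : B \in V -> i \in B -> maxB B = psi i.
Proof.
move=> BV iB; have [bB bmax] := max_map_block Vge2 BV iB.
apply/eqP; rewrite eqn_leq; apply/andP; split; first exact/bigmax_leqP.
exact: (@leq_bigmax_cond _ (mem B) (fun j : 'I_n => j : nat)).
Qed.

(** The bridge between the two descriptions: the first element sent to the maximum of [B] is the
    minimum of [B]. *)
Lemma before_max_map (B : {set 'I_n}) i m : B \in V -> i \in B ->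
  before psi m (psi i) = (minB B < m)%N.
Proof.
move=> BV iB; have [b [bB -> bmin]] := minB_P BV; apply/beforeP/idP => [[j jm /eqP]|bm].
  by rewrite (eq_max_map Vge2 _ BV iB) => /bmin bj; exact: leq_ltn_trans jm.
by exists b => //; apply/eqP; rewrite (eq_max_map Vge2 _ BV iB).
Qed.

Lemma minB_lt_maxB (B : {set 'I_n}) : B \in V -> (minB B < maxB B)%N.
Proof.
move=> BV; have [m [mB mE mmin]] := minB_P BV.
rewrite (maxB_E BV mB) -(before_max_map _ BV mB).
have /block_mapP B_ := block_map_max_map Vge2.
have [_ pp _] := B_ m; have [_ _ ] := B_ (psi m); rewrite pp; exact.
Qed.

Lemma prod_blocks (R : comNzRingType) (F : 'I_n -> R) :
  \prod_(i < n) F i = \prod_(B in V) \prod_(i in B) F i.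
Proof.
rewrite -(finset.set_partition_big _ (ge2_partition Vge2)) /=.
by apply: eq_bigl => i; rewrite inE.
Qed.

Section weights.
Variables (R : comNzRingType) (u : R) (a : 'I_n -> R).

(** In each block the maximum and the minimum are distinct and contribute 1, which leaves [#|B| - 2]
    factors [u]. *)
Lemma prod_middle : \prod_(i < n)
    (if psi i == i then 1 else if before psi i (psi i) then u else 1) =
  \prod_(B in V) u ^+ (#|B| - 2).
Proof.
rewrite prod_blocks; apply: eq_bigr => B BV.
have [m [mB mE mmin]] := minB_P BV.
have [bB bmax] := max_map_block Vge2 BV mB.
have mb : m != psi m.
  by apply: contraTneq (minB_lt_maxB BV) => E; rewrite (maxB_E BV mB) mE -E ltnn.
have pb : psi (psi m) = psi m.
  by apply/eqP; rewrite (eq_max_map Vge2 _ BV mB).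
rewrite (bigD1 (psi m))//= pb eqxx mul1r (bigD1 m)/=; last by rewrite mB.
rewrite eq_sym (negbTE mb) (before_max_map _ BV mB) mE ltnn mul1r.
rewrite (eq_bigr (fun=> u)); last first.
  move=> i /andP[/andP[iB ib] im].
  have -> : psi i = psi m by apply/eqP; rewrite (eq_max_map Vge2 _ BV mB).
  by rewrite eq_sym (negbTE ib) (before_max_map _ BV mB) mE ltn_neqAle mmin// andbT val_eqE eq_sym im.
rewrite prodr_const; congr (_ ^+ _).
rewrite (cardsD1 (psi m) B) bB (cardsD1 m) !inE mB mb /= !add1n subn2 /=.
apply: eq_card => i; rewrite !inE -[LHS]/((i \in B) && (i != psi m) && (i != m)).
by rewrite andbC [X in _ && X]andbC.
Qed.

Lemma prod_block_min : \prod_(i < n)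
    (if psi i == i then 1 else if before psi i (psi i) then 1 else a i) =
  \prod_(B in V) \prod_(i in B | i == minB B :> nat) a i.
Proof.
rewrite prod_blocks; apply: eq_bigr => B BV; rewrite [RHS]big_mkcondr.
apply: eq_bigr => i iB; rewrite (before_max_map _ BV iB).
case: eqP => [pi|_].
  have mi : (minB B < i)%N by have := minB_lt_maxB BV; rewrite (maxB_E BV iB) pi.
  by rewrite gtn_eqF.
have [m [mB mE mmin]] := minB_P BV.
by rewrite mE ltn_neqAle mmin// andbT eq_sym; case: eqP.
Qed.

Lemma prod_block_max (P : pred 'I_n) : (forall i, P i -> psi i = i) ->
  \prod_(i < n | P i) a i =
  \prod_(B in V) \prod_(i in B | (i == maxB B :> nat) && P i) a i.
Proof.
move=> Pmax; rewrite big_mkcond prod_blocks; apply: eq_bigr => B BV.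
rewrite [RHS]big_mkcondr; apply: eq_bigr => i iB; rewrite (maxB_E BV iB).
by case: ifP => [/Pmax->|]; rewrite ?eqxx ?andbF.
Qed.

End weights.
End blocks.

(** * The integral attached to a block map is that of its partition *)

Section partition_weights.
Context d (X : measurableType d) (R : realType).
Variable sigma : {sigma_finite_measure set X -> \bar R}.
Variable q : X -> X -> R[i].
Hypotheses (q1 : forall s t, normc (q s t) = 1)
  (mq : cmeasurable setT (fun p : X * X => q p.1 p.2)).
Variables (K : set X) (mK : measurable K) (Koo : (sigma K < +oo)%E).
Variable lambda : R.
Variables (n : nat) (f : 'I_n -> X -> R).
Hypothesis fK : forall i, supported_fun K (f i).
Variable V : {set {set 'I_n}}.
Hypothesis Vge2 : V \in partitions_ge2 n.
Local Notation psi := (max_map V).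
Local Notation mu := (tuple_measure sigma).

(** A crossing is charged to the minimum of [B2]: there the label of [B1] is open and smaller than
    that of [B2]. Since [t] is constant on blocks, only the values of [y] at maxima occur. *)
Lemma Qpartition_crossing (t y : n.-tuple X) :
  (forall i, tnth t i = tnth y (psi i)) ->
  Qpartition q V t =
  \prod_(B in V) \prod_(i in B | i == minB B :> nat) crossing_factor q psi i y.
Proof.
move=> ty; rewrite /Qpartition.
under eq_bigr do rewrite big_mkcondr.
rewrite exchange_big; apply: eq_bigr => B2 B2V /=.
have [m2 [m2B m2E m2min]] := minB_P Vge2 B2V.
rewrite [RHS](big_pred1 m2); last first.
  move=> i /=; rewrite m2E; apply/andP/eqP => [[_ /eqP/val_inj]//|->].
  by rewrite m2B eqxx.
pose P c := (c \in open_labels psi m2.+1) && (c < psi m2)%N.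
rewrite /crossing_factor (prod_block_max Vge2 _ (P := P)); last first.
  by move=> i /andP[]; rewrite inE => /and3P[_ /eqP].
apply: eq_bigr => B1 B1V.
have [m1 [m1B m1E m1min]] := minB_P Vge2 B1V.
have [b1B b1max] := max_map_block Vge2 B1V m1B.
set b1 := psi m1 in b1B b1max.
have b1E : maxB B1 = b1 by rewrite (maxB_E Vge2 B1V m1B).
have pb1 : psi b1 = b1 by apply/eqP; rewrite (eq_max_map Vge2 _ B1V m1B).
have b2E : maxB B2 = psi m2 by rewrite (maxB_E Vge2 B2V m2B).
have -> : [&& (minB B1 < minB B2)%N, (minB B2 < maxB B1)%N & (maxB B1 < maxB B2)%N] = P b1.
  rewrite /P inE pb1 eqxx /= (before_max_map Vge2 _ B1V m1B) ltnS m1E m2E b1E b2E.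
  have [bb|] := ltnP b1 (psi m2); rewrite ?andbT ?andbF//=.
  (* Openness at level [m2.+1] gives only a weak inequality; equal minima would mean equal blocks,
     which the strict inequality of maxima excludes. *)
  suff -> : (m1 <= m2)%N = (m1 < m2)%N by rewrite andbC.
  rewrite [LHS]leq_eqVlt orb_idl// => /eqP/val_inj mm.
  by move: bb; rewrite /b1 mm ltnn.
case: ifP => Pb1; last first.
  rewrite big_pred0// => c; rewrite b1E.
  by case: eqP => [/val_inj->|]; rewrite ?Pb1 ?andbF.
rewrite (big_pred1 b1); last first.
  move=> c /=; rewrite b1E; apply/and3P/eqP => [[_ /eqP/val_inj]//|->].
  by rewrite b1B eqxx Pb1.
by rewrite m2E b1E -!tnth_nth !ty pb1.
Qed.

Lemma weight_partition (t y : n.-tuple X) :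
  (forall i, tnth t i = tnth y (psi i)) ->
  weight q lambda f psi (enum 'I_n) y =
  (\prod_(i < n) f i (tnth t i))%:C%C * Qpartition q V t *
    (\prod_(B in V) lambda ^+ (#|B| - 2))%:C%C.
Proof.
move=> ty; rewrite /weight big_enum /factor big_split /= -mulrA; congr (_ * _).
  by rewrite rmorph_prod; apply: eq_bigr => i _; rewrite ty.
rewrite mulrC rmorph_prod /=; under [in RHS]eq_bigr do rewrite rmorphXn.
rewrite -(prod_middle Vge2) (Qpartition_crossing ty).
rewrite -(prod_block_min Vge2) -big_split; apply: eq_bigr => i _ /=.
by case: ifP => _; rewrite ?mulr1//; case: ifP => _; rewrite ?mulr1 ?mul1r.
Qed.

Lemma cmeasurable_Qpartition : cmeasurable setT (Qpartition q V).
Proof.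
have mnth k : measurable_fun setT (fun t : n.-tuple X => nth point t k).
  have [kn|kn] := ltnP k n.
    rewrite (_ : (fun _ => _) = fun t : n.-tuple X => tnth t (Ordinal kn)).
      exact: measurable_tnth.
    by apply/funext => t; rewrite (tnth_nth point).
  rewrite (_ : (fun _ => _) = cst point); first exact: measurable_cst.
  by apply/funext => t; rewrite nth_default// size_tuple.
apply: cmeasurable_prod => B1; apply: cmeasurable_prod => B2.
apply: (@cmeasurable_comp _ _ _ _ _ (fun p : X * X => q p.1 p.2)
  (fun t : n.-tuple X => (nth point t (minB B2), nth point t (maxB B1)))) => //.
exact: measurable_fun_pair.
Qed.

(** [closed_labels] lists the maxima in the order of the block minima, whereas [spread] follows
    [enum V]. The list [M] of maxima in the order of [enum V] is a rearrangement of the former, and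
    assigning along [M] gives each maximum the value that [spread] gives to its block. *)
Lemma label_integral_delta_partition x :
  label_integral sigma (closed_labels psi (enum 'I_n))
    (weight q lambda f psi (enum 'I_n)) x =
  cintegral (delta_partition sigma V) (fun t =>
    (\prod_(i < n) f i (tnth t i))%:C%C * Qpartition q V t *
    (\prod_(B in V) lambda ^+ (#|B| - 2))%:C%C).
Proof.
have sE : sorted (fun a b : 'I_n => (a < b)%N) (enum 'I_n).
  by have := iota_ltn_sorted 0 n; rewrite -val_enum_ord sorted_map.
have blockI (k : 'I_#|V|) : exists i, i \in enum_val k.
  by have [m [mB _ _]] := minB_P Vge2 (enum_valP k); exists m.
have [r rP] := boolp.choice blockI.
pose M := [seq psi (r k) | k <- enum 'I_#|V|].
have sM : size M = #|V| by rewrite size_map size_enum_ord.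
have rinj k l : psi (r k) = psi (r l) -> k = l.
  move=> /eqP; rewrite (eq_max_map Vge2 _ (enum_valP l) (rP l)) => kl.
  by apply: enum_val_inj; rewrite -(pblockT Vge2 (enum_valP k) (rP k)) (pblockT Vge2 (enum_valP l) kl).
have uM : uniq M by rewrite map_inj_uniq ?enum_uniq// => k l; exact: rinj.
have indexM i : index (psi i) M = index (finset.pblock V i) (enum V).
  have BV := pblock_memT Vge2 i; have iB := mem_pblockT Vge2 i.
  pose k := enum_rank_in BV (finset.pblock V i).
  have kE : enum_val k = finset.pblock V i by rewrite enum_rankK_in.
  have -> : psi i = nth i M k.
    rewrite (nth_map k) ?size_enum_ord// nth_ord_enum; apply/eqP.
    by rewrite (eq_max_map Vge2 _ (enum_valP k) (rP k)) kE.
  rewrite index_uniq ?sM// -kE (enum_val_nth finset.set0) index_uniq ?enum_uniq//.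
  by rewrite -cardE.
have LM : perm_eq (closed_labels psi (enum 'I_n)) M.
  apply: uniq_perm => //; first exact: uniq_closed_labels.
  move=> b; apply/mapP/mapP => [[j]|[k _ ->]].
    rewrite mem_filter => _ ->.
    have BV := pblock_memT Vge2 j; have jB := mem_pblockT Vge2 j.
    exists (enum_rank_in BV (finset.pblock V j)); first by rewrite mem_enum.
    apply/eqP; rewrite (eq_max_map Vge2 _ (enum_valP _) (rP _)).
    by rewrite enum_rankK_in.
  have BV := enum_valP k; have [m [mB mE mmin]] := minB_P Vge2 BV.
  exists m; last by apply/eqP; rewrite eq_sym (eq_max_map Vge2 _ BV (rP k)).
  rewrite mem_filter mem_enum andbT /block_min (before_max_map Vge2 _ BV mB) mE ltnn andbT.
  apply: contraTneq (minB_lt_maxB Vge2 BV) => E.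
  by rewrite (maxB_E Vge2 BV mB) mE E ltnn.
have ul := uniq_closed_labels psi sE.
have sub := @sub_closed_labels n psi (enum 'I_n).
have wL := label_fun_weight q1 mq lambda fK psi (enum 'I_n).
rewrite (perm_label_integral mK Koo x ul sub wL LM sM).
set g := fun t => _ * _ * _.
have wE (s : #|V|.-tuple X) : weight q lambda f psi (enum 'I_n) (assign x M s) = g (@spread d X n V s).
  apply: weight_partition => i; rewrite tnth_mktuple tnth_assign indexM.
  apply: set_nth_default; rewrite size_tuple cardE index_mem mem_enum.
  exact: pblock_memT.
have mg : cmeasurable setT g.
  apply: cmeasurableM; last exact: cmeasurable_cst.
  apply: cmeasurableM; last exact: cmeasurable_Qpartition.
  apply: cmeasurable_real; apply: measurable_prod => i _.
  by apply: measurableT_comp; [case: (fK i)|exact: measurable_tnth].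
(* Integrability is inherited from the weight, which is bounded and vanishes off a cube in the block
   variables. *)
have gi : cintegrable (mu #|V|) (g \o @spread d X n V).
  rewrite (_ : g \o _ = fun s : #|V|.-tuple X =>
      weight q lambda f psi (enum 'I_n) (assign x M s)).
    apply: (box_fun_cintegrable mK Koo); apply: (box_fun_assign x _ uM _ wL) => //.
    by move=> b; rewrite -(perm_mem LM); exact: sub.
  by apply/funext => s; rewrite wE.
have spE (C : set (n.-tuple X)) : measurable C ->
    delta_partition sigma V C = mu #|V| (@spread d X n V @^-1` C) by [].
rewrite (cintegral_image (@measurable_spread _ X n V) spE); last first.
  exact: (cintegrable_image (@measurable_spread _ X n V) spE).
by congr cintegral; apply/funext => s; rewrite wE.
Qed.

End partition_weights.

Section tensor_moments.
Context d (X : measurableType d) (R : realType).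
Variable sigma : {sigma_finite_measure set X -> \bar R}.
Variable q : X -> X -> R[i].
Hypotheses (qK : forall s t, q s t * q t s = 1)
  (q1 : forall s t, normc (q s t) = 1)
  (mq : cmeasurable setT (fun p : X * X => q p.1 p.2)).
Variables (K : set X) (mK : measurable K) (Koo : (sigma K < +oo)%E).
Variable lambda : R.

Lemma field_product_moment n (f : 'I_n -> X -> R) :
  (forall i, supported_fun K (f i)) ->
  field_product sigma q lambda f (@vacuum _ X R) [tuple] =
  \sum_(V in partitions_ge2 n) cintegral (delta_partition sigma V) (fun t =>
    (\prod_(i < n) f i (tnth t i))%:C%C * Qpartition q V t *
    (\prod_(B in V) lambda ^+ (#|B| - 2))%:C%C).
Proof.
move=> fK; have sE : sorted (fun a b : 'I_n => (a < b)%N) (enum 'I_n).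
  by have := iota_ltn_sorted 0 n; rewrite -val_enum_ord sorted_map.
pose x0 : n.-tuple X := [tuple point | _ < n].
rewrite (field_product_vacuum qK q1 mq mK Koo)// (raw_product_vacuum q1 mq mK Koo lambda x0)//.
rewrite sum_block_maps; apply: eq_bigr => V VP.
rewrite (process_label_integral q1 mq mK Koo)//.
exact: (label_integral_delta_partition q1 mq mK Koo).
Qed.

End tensor_moments.

(** * Density of tensors *)

Section compact_supports.
Context (R : realType) (T : ptopologicalType) (n : nat).

Definition pow_set (L : set T) : set {ptws 'I_n -> T} := [set g | forall i, L (g i)].

Lemma compact_pow (L : set T) : compact L -> compact (pow_set L).
Proof. by move=> cL; exact: (@tychonoff 'I_n (fun=> T) (fun=> L)). Qed.

(** The union of the coordinate projections of [K] serves as [L]. *)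
Lemma compact_support_box (K : set {ptws 'I_n -> T}) : compact K ->
  exists2 L : set T, compact L &
    forall t : n.-tuple (borel T), (exists i, ~ L (tnth t i)) -> ~ K (tnth t).
Proof.
move=> cK; exists (\big[setU/set0]_(i < n) ((fun g : {ptws 'I_n -> T} => g i) @` K)).
  apply: bigsetU_compact => i _; apply: continuous_compact => //.
  apply: continuous_subspaceT; exact: (@proj_continuous 'I_n (fun=> T) i).
move=> t [i ti] Kt; apply: ti; rewrite -bigcup_seq; exists i.
  by rewrite /= mem_index_enum.
by exists (tnth t).
Qed.

Lemma B0C_support (f : n.-tuple (borel T) -> R[i]) : B0C f ->
  exists2 L : set T, compact L & forall t, (exists i, ~ L (tnth t i)) -> f t = 0.
Proof.
move=> [_ [M [K cK [_ f0]]]]; have [L cL LK] := compact_support_box cK.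
by exists L => // t /LK/f0.
Qed.

End compact_supports.

Lemma normcB0 (R : realType) (z : R[i]) : normc (z - z) = 0.
Proof. by rewrite subrr normc0. Qed.

Section density_of_tensors.
Import HBNNSimple.
Context (R : realType) (T : ptopologicalType) (n : nat).
Hypothesis compact_meas :
  forall L : set T, compact L -> measurable (L : set (borel T)).
(** [D] stands for the difference of the two sides of the formula. Continuity enters only as closure
    of its zero set under bounded pointwise limits with a common compact support. *)
Variable D : (n.-tuple (borel T) -> R[i]) -> R[i].
Hypotheses (D_linear : forall f g c, B0C f -> B0C g ->
    D (fun t => c * f t + g t) = c * D f + D g)
  (D_tensor : forall f : 'I_n -> borel T -> R, (forall i, B0 (f i)) ->
    D (tensor f) = 0)
  (D_lim : forall (f_ : nat -> n.-tuple (borel T) -> R[i]) f M K,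
    (forall j, B0C (f_ j)) -> B0C f -> compact K ->
    (forall j, bounded_supported M K (f_ j)) ->
    (forall t, (fun j => normc (f_ j t - f t)) @ \oo --> (0 : R)) ->
    (forall j, D (f_ j) = 0) -> D f = 0).

Let B0C0 : B0C (fun _ : n.-tuple (borel T) => 0 : R[i]).
Proof.
split; first exact: cmeasurable_cst.
exists 0, set0; first exact: compact0.
by split=> // t; rewrite normc0.
Qed.

Let B0CZD (f g : n.-tuple (borel T) -> R[i]) c :
  B0C f -> B0C g -> B0C (fun t => c * f t + g t).
Proof.
move=> [mf [M [K cK [fM f0]]]] [mg [N [L cL [gN g0]]]]; split.
  by apply: cmeasurableD => //; apply: cmeasurableM => //; exact: cmeasurable_cst.
exists (normc c * M + N), (K `|` L); first exact: compactU.
split=> t; last by move=> /not_orP[/f0-> /g0->]; rewrite mulr0 addr0.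
rewrite (le_trans (le_normcD _ _))// lerD// normcM.
by rewrite ler_wpM2l ?normc_ge0.
Qed.

Let D0 : D (fun _ => 0) = 0.
Proof.
have := D_linear 1 B0C0 B0C0; rewrite mul1r addr0 mul1r.
by move/eqP; rewrite -subr_eq0 opprD addrA subrr sub0r oppr_eq0 => /eqP.
Qed.

Section fixed_support.
Variable L : set T.
Hypothesis cL : compact L.

Let LB : set (borel T) := L.

Let Ln : set (n.-tuple (borel T)) := box (fun=> LB).

Let mLn : measurable Ln.
Proof. by apply: measurable_box => i; exact: compact_meas. Qed.

(** Indicators are cut down to the cube over [L] to have compact support; complements are then taken
    inside that cube, whose indicator is [ind setT]. *)
Let ind (E : set (n.-tuple (borel T))) : n.-tuple (borel T) -> R[i] :=
  fun t => ((\1_(E `&` Ln) t : R))%:C%C.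

Let ind_bounded E : bounded_supported 1 (@pow_set T n L) (ind E).
Proof.
split=> t.
  by rewrite normc_real indicE; case: (_ \in _); rewrite ?normr1 ?normr0.
by move=> tL; rewrite /ind indicE memNset//= => -[].
Qed.

Let B0C_ind E : measurable E -> B0C (ind E).
Proof.
move=> mE; split.
  by apply: cmeasurable_real; apply: measurable_indic; exact: measurableI.
by exists 1, (@pow_set T n L); [exact: compact_pow|exact: ind_bounded].
Qed.

(** Dynkin induction from boxes, whose cut indicators are tensors: linearity handles complements,
    and [D_lim] handles countable disjoint unions. *)
Let D_ind E : measurable E -> D (ind E) = 0.
Proof.
move=> mE; move: (mE); rewrite measurable_tuple_boxes.
have D_box F : (forall i, measurable (F i)) -> D (ind (box F)) = 0.
  move=> mF.
  rewrite (_ : ind _ = tensor (fun i => \1_(F i `&` LB) : borel T -> R)).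
    apply: D_tensor => i; split.
    + by apply: measurable_indic; apply: measurableI => //; exact: compact_meas.
    + by exists 1 => t; rewrite indicE; case: (_ \in _); rewrite ?normr1 ?normr0.
    + by exists L => // t tL; rewrite indicE memNset// => -[].
  apply/funext => t; congr (_%:C)%C; rewrite indicE.
  have [tF|tF] := boolP (t \in box F `&` Ln).
    rewrite big1// => i _; rewrite indicE mem_set//.
    by move: tF; rewrite inE => -[tF tL]; split; [exact: tF|exact: tL].
  have [i iF] : exists i, ~ (F i `&` LB) (tnth t i).
    apply/existsNP => H; move: tF; rewrite notin_setE; apply.
    by split=> i; case: (H i).
  by rewrite (bigD1 i)//= indicE memNset// mul0r.
move: E {mE}; apply: (dynkin_induction (P := fun E => D (ind E) = 0)).
- exact: measurable_tuple_boxes.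
- exact: setI_closed_boxes.
- rewrite (_ : setT = box (fun=> setT)); first exact: D_box.
  by apply/seteqP; split.
- by move=> _ [E mE <-]; exact: D_box.
- move=> E mE DE.
  rewrite (_ : ind (~` E) = fun t => -1 * ind E t + ind setT t).
    rewrite D_linear//; [|exact: B0C_ind|exact: B0C_ind].
    rewrite DE mulr0 add0r (_ : setT = box (fun=> setT)); first exact: D_box.
    by apply/seteqP; split.
  apply/funext => t; rewrite /ind -(rmorphN1 (real_complex R)) -rmorphM -rmorphD.
  congr (_%:C)%C; rewrite !indicE !in_setI in_setC in_setT.
  by case: (t \in E); case: (t \in Ln); rewrite /= ?mulr0 ?mulr1 ?addr0 ?add0r ?addNr.
- move=> F mF tF DF.
  pose U N := \big[setU/set0]_(k < N) F k.
  have mU N : measurable (U N) by exact: bigsetU_measurable.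
  have DU N : D (ind (U N)) = 0.
    elim: N => [|N IH].
      rewrite /U big_ord0 (_ : ind _ = fun=> 0)//.
      by apply/funext => t; rewrite /ind set0I indic0.
    rewrite (_ : ind (U N.+1) = fun t => 1 * ind (U N) t + ind (F N) t).
      by rewrite D_linear ?IH ?DF ?mulr0 ?addr0//; exact: B0C_ind.
    apply/funext => t; rewrite /ind mul1r -rmorphD; congr (_%:C)%C.
    rewrite /U big_ord_recr /= -/(U N) !indicE !in_setI in_setU.
    have : ~~ ((t \in U N) && (t \in F N)).
      rewrite -in_setI notin_setE /U -bigcup_mkord => -[[k kN Fk] FN].
      move/trivIsetP : tF => /(_ k N I I); rewrite ltn_eqF// => /(_ isT) FF0.
      have : (F k `&` F N) t by split.
      by rewrite FF0.
    by case: (t \in U N); case: (t \in F N); case: (t \in Ln) => //; rewrite /= ?addr0 ?add0r.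
  apply: (D_lim (f_ := fun N => ind (U N)) (M := 1) (K := @pow_set T n L)).
  + by move=> N; exact: B0C_ind.
  + by apply: B0C_ind; exact: bigcup_measurable.
  + exact: compact_pow.
  + by move=> N; exact: ind_bounded.
  + move=> t; apply: cvg_near_cst.
    have [[k _ Fk]|nF] := pselect ((\bigcup_k F k) t).
      exists k.+1 => // N kN.
      have tU : U N t by rewrite /U -bigcup_mkord; exists k.
      by rewrite /ind !indicE !in_setI (mem_set tU) (@mem_set _ _ t (ex_intro2 _ _ k I Fk)) normcB0.
    exists 0 => // N _; have nU : ~ U N t.
      by rewrite /U -bigcup_mkord => -[k _ Fk]; apply: nF; exists k.
    rewrite /ind !indicE !in_setI (memNset nU) (memNset nF) normcB0.
  + by [].
  + exact: DU.
Qed.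

Let sum_ind_bounded (I : Type) (r : seq I) (c : I -> R[i])
    (E : I -> set (n.-tuple (borel T))) : (forall k, measurable (E k)) ->
  B0C (fun t => \sum_(k <- r) c k * ind (E k) t) /\
  D (fun t => \sum_(k <- r) c k * ind (E k) t) = 0.
Proof.
move=> mE; elim: r => [|k r [IH1 IH2]].
  by under eq_fun do rewrite big_nil.
under eq_fun do rewrite big_cons; split; first exact: B0CZD (B0C_ind _) IH1.
by rewrite D_linear// ?IH2 ?D_ind ?mulr0 ?addr0//; exact: B0C_ind.
Qed.

Lemma nonneg_density (u : n.-tuple (borel T) -> R) (M : R) :
  measurable_fun setT u -> (forall t, 0 <= u t <= M) ->
  (forall t, (exists i, ~ L (tnth t i)) -> u t = 0) ->
  B0C (fun t => (u t)%:C%C) /\ D (fun t => (u t)%:C%C) = 0.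
Proof.
move=> mu0 uM u0; have mu : measurable_fun setT (EFin \o u) by exact/measurable_EFinP.
have uL t : ~ pow_set L (tnth t) -> u t = 0 by move=> /existsNP tL; exact: u0.
have uB : B0C (fun t => (u t)%:C%C).
  split; first exact: cmeasurable_real.
  exists M, (@pow_set T n L); first exact: compact_pow.
  split=> t; last by move=> /uL->.
  by rewrite normc_real ger0_norm; case/andP: (uM t).
split=> //.
pose a := nnsfun_approx measurableT mu.
have apos : forall t, setT t -> (0 <= (EFin \o u) t)%E.
  by move=> t _; rewrite lee_fin; case/andP: (uM t).
have au j t : 0 <= a j t <= u t.
  rewrite fun_ge0 /= -lee_fin /a nnsfun_approxE.
  exact: (le_approx j apos).
have acvg t : (fun j => a j t) @ \oo --> u t.
  have /fine_cvg := cvg_nnsfun_approx measurableT mu apos (I : setT t).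
  by [].
pose r j : seq R := finmap.enum_fset (fset_set (range (a j))).
have aE j : (fun t => (a j t)%:C%C) =
    fun t => \sum_(y <- r j) y%:C%C * ind (a j @^-1` [set y]) t.
  apply/funext => t.
  (* Outside the cube [u] vanishes, and so do its approximations from below; cutting the level sets
     down to the cube changes nothing. *)
  have -> : a j t = \sum_(y <- r j) y * \1_(a j @^-1` [set y] `&` Ln) t.
    have [tL|tL] := pselect (Ln t).
      rewrite {1}fimfunE fsbig_finite//=; apply: eq_bigr => y _.
      by rewrite !indicE in_setI (mem_set tL) andbT.
    rewrite big1; last by move=> y _; rewrite indicE in_setI (memNset tL) andbF mulr0.
    by apply/eqP; rewrite eq_le; have := au j t; rewrite (uL _ tL) andbC.
  by rewrite rmorph_sum; apply: eq_bigr => y _; rewrite rmorphM.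
have ma j y : measurable (a j @^-1` [set y]) by exact: measurable_sfunP.
apply: (D_lim (f_ := fun j t => (a j t)%:C%C) (M := M) (K := @pow_set T n L)).
- by move=> j; rewrite aE; have [] := sum_ind_bounded (r j) (fun y => y%:C%C) (ma j).
- exact: uB.
- exact: compact_pow.
- move=> j; split=> t.
    rewrite normc_real ger0_norm; case/andP: (au j t) => // _ /le_trans; apply.
    by case/andP: (uM t).
  move=> /uL ut; have := au j t; rewrite ut => at0.
  by congr (_%:C)%C; apply/eqP; rewrite eq_le andbC.
- move=> t; under eq_fun do rewrite -rmorphB normc_real.
  have := acvg t; rewrite cvgrPdist_lt => acvgt; apply/cvgrPdist_lt => e e0.
  have := acvgt e e0; apply: filterS => j.
  by rewrite sub0r normrN normr_id distrC.
- by move=> j; rewrite aE; have [] := sum_ind_bounded (r j) (fun y => y%:C%C) (ma j).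
Qed.

Let real_density (u : n.-tuple (borel T) -> R) (M : R) :
  measurable_fun setT u -> (forall t, `|u t| <= M) ->
  (forall t, (exists i, ~ L (tnth t i)) -> u t = 0) ->
  B0C (fun t => (u t)%:C%C) /\ D (fun t => (u t)%:C%C) = 0.
Proof.
move=> mu uM u0.
have pos (v : n.-tuple (borel T) -> R) : measurable_fun setT v ->
    (forall t, `|v t| <= M) -> (forall t, (exists i, ~ L (tnth t i)) -> v t = 0) ->
    B0C (fun t => (Num.max (v t) 0)%:C%C) /\ D (fun t => (Num.max (v t) 0)%:C%C) = 0.
  move=> mv vM v0; apply: (@nonneg_density _ M).
  - by apply: measurable_maxr => //; exact: measurable_cst.
  - move=> t; rewrite le_max lexx orbT /= ge_max.
    by rewrite (le_trans (ler_norm _) (vM t)) (le_trans (normr_ge0 _) (vM t)).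
  - by move=> t tL; rewrite v0// maxxx.
have [pB pD] := pos u mu uM u0.
have [||t tL|nB nD] := pos (fun t => - u t).
- exact: measurableT_comp.
- by move=> t; rewrite normrN.
- by rewrite u0// oppr0.
have E : (fun t => (u t)%:C%C) = (fun t => -1 * (Num.max (- u t) 0)%:C%C + (Num.max (u t) 0)%:C%C).
  apply/funext => t; rewrite -(rmorphN1 (real_complex R)) -rmorphM -rmorphD.
  congr (_%:C)%C; rewrite mulN1r; case: (leP 0 (u t)) => ut.
    by rewrite [X in - X]max_r ?oppr_le0// oppr0 add0r.
  by rewrite max_l ?oppr_ge0 ?ltW// opprK addr0.
by rewrite E; split; [exact: B0CZD|rewrite D_linear// pD nD mulr0 addr0].
Qed.

Lemma fixed_support_density (f : n.-tuple (borel T) -> R[i]) (M : R) : cmeasurable setT f ->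
  (forall t, normc (f t) <= M) ->
  (forall t, (exists i, ~ L (tnth t i)) -> f t = 0) -> D f = 0.
Proof.
move=> [mr mi] fM f0.
have [||t tL|rB rD] := @real_density (fun t => complex.Re (f t)) M.
- exact: mr.
- by move=> t; exact: le_trans (Re_le_normc _) (fM t).
- by rewrite f0.
have [||t tL|iB iD] := @real_density (fun t => complex.Im (f t)) M.
- exact: mi.
- by move=> t; exact: le_trans (Im_le_normc _) (fM t).
- by rewrite f0.
rewrite (_ : f = fun t => 'i%C * (complex.Im (f t))%:C%C + (complex.Re (f t))%:C%C).
  by rewrite D_linear// rD iD mulr0 addr0.
by apply/funext => t; rewrite addrC -complexE.
Qed.

End fixed_support.

Lemma tensor_density f : B0C f -> D f = 0.
Proof.
move=> fB; have [L cL f0] := B0C_support fB.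
have [mf [M [K cK [fM _]]]] := fB.
exact: (fixed_support_density cL mf fM f0).
Qed.

End density_of_tensors.

(** * The moments formula *)

Section moment_functionals.
Context d (X : measurableType d) (R : realType).
Variable sigma : {sigma_finite_measure set X -> \bar R}.
Variable q : X -> X -> R[i].
Hypotheses (q1 : forall s t, normc (q s t) = 1)
  (mq : cmeasurable setT (fun p : X * X => q p.1 p.2)).
Variables (K : set X) (mK : measurable K) (Koo : (sigma K < +oo)%E).
Variables (n : nat) (V : {set {set 'I_n}}) (c : R[i]).
Hypothesis Vge2 : V \in partitions_ge2 n.
Local Notation mu := (tuple_measure sigma).

Definition partition_moment (g : n.-tuple X -> R[i]) : R[i] :=
  cintegral (delta_partition sigma V) (fun t => g t * Qpartition q V t * c).

Lemma normc_Qpartition t : normc (Qpartition q V t) = 1.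
Proof.
have normcM1 (z w : R[i]) : normc z = 1 -> normc w = 1 -> normc (z * w) = 1.
  by rewrite normcM => -> ->; rewrite mulr1.
rewrite /Qpartition; apply: (big_ind (fun z : R[i] => normc z = 1)) => // [|B1 _].
  exact: normc1.
by apply: (big_ind (fun z : R[i] => normc z = 1)) => //; exact: normc1.
Qed.

(** Blocks are nonempty, so every coordinate of the argument is copied to some position; one outside
    [K] makes [g] vanish. *)
Lemma box_fun_spread (g : n.-tuple X -> R[i]) :
  box_fun K g -> box_fun K (g \o @spread d X n V).
Proof.
move=> [mg [M gM] g0]; split.
- by apply: cmeasurable_comp mg; exact: measurable_spread.
- by exists M => s; exact: gM.
move=> s [k sk]; apply: g0.
have [m [mB _ _]] := minB_P Vge2 (enum_valP k).
exists m; rewrite tnth_mktuple (pblockT Vge2 (enum_valP k) mB).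
by rewrite (enum_val_nth finset.set0) index_uniq ?enum_uniq -?cardE// -tnth_nth.
Qed.

Let weighted (g : n.-tuple X -> R[i]) := fun t => g t * Qpartition q V t * c.

Let box_weighted g : box_fun K g -> box_fun K (weighted g).
Proof.
move=> gK; have := @box_funMl _ _ _ K _ (fun t => Qpartition q V t * c) g (normc c).
rewrite (_ : weighted g = fun t => Qpartition q V t * c * g t); last first.
  by apply/funext => t; rewrite /weighted -mulrA mulrC.
apply => //.
  by apply: cmeasurableM; [exact: cmeasurable_Qpartition|exact: cmeasurable_cst].
by move=> t; rewrite normcM normc_Qpartition mul1r.
Qed.

Let spE (C : set (n.-tuple X)) : measurable C ->
  delta_partition sigma V C = mu #|V| (@spread d X n V @^-1` C).
Proof. by []. Qed.

Let int_weighted g : box_fun K g ->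
  cintegrable (delta_partition sigma V) (weighted g).
Proof.
move=> gK; have wK := box_weighted gK.
apply: (cintegrable_image (@measurable_spread _ X n V) spE); first by case: wK.
by apply: (box_fun_cintegrable mK Koo); exact: box_fun_spread.
Qed.

Lemma partition_moment_linear (a : R[i]) f g : box_fun K f -> box_fun K g ->
  partition_moment (fun t => a * f t + g t) =
  a * partition_moment f + partition_moment g.
Proof.
move=> fK gK; rewrite /partition_moment -cintegralZ; last exact: int_weighted.
rewrite -cintegralD; [|exact/cintegrableZ/int_weighted|exact: int_weighted].
by congr cintegral; apply/funext => t; ring.
Qed.

(** As [q] has modulus 1, the integrands are dominated by a multiple of the indicator of a cube with
    one side per block, which has finite measure. *)
Lemma partition_moment_cvg (f_ : nat -> n.-tuple X -> R[i]) f (M : R) :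
  (forall j, box_fun K (f_ j)) -> box_fun K f ->
  (forall j t, normc (f_ j t) <= M) ->
  (forall t, (fun j => normc (f_ j t - f t)) @ \oo --> (0 : R)) ->
  (fun j => normc (partition_moment (f_ j) - partition_moment f)) @ \oo --> (0 : R).
Proof.
move=> fjK fK fM cvf; rewrite /partition_moment.
under eq_fun do rewrite !(cintegral_image (@measurable_spread _ X n V) spE (int_weighted _))//.
have M0 : 0 <= M := le_trans (normc_ge0 _) (fM 0%N [tuple point | _ < n]).
apply: (cdominated_convergence
  (h := fun s => M * normc c * \1_(box (fun=> K) : set (#|V|.-tuple X)) s)).
- by move=> j; have [] := box_fun_spread (box_weighted (fjK j)).
- by have [] := box_fun_spread (box_weighted fK).
- exact: (integrable_indic_box mK Koo).
- move=> j s; have [sK|sK] := pselect (box (fun=> K) s).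
    rewrite indicE (mem_set sK) mulr1 /weighted !normcM normc_Qpartition mulr1.
    by rewrite ler_wpM2r ?normc_ge0.
  have [_ _ w0] := box_fun_spread (box_weighted (fjK j)).
  rewrite indicE (memNset sK) mulr0 -[X in normc X]/((weighted (f_ j) \o @spread d X n V) s).
  by rewrite w0 ?normc0//; exact/existsNP.
- move=> s; have E j : normc (weighted (f_ j) (@spread d X n V s) - weighted f (@spread d X n V s)) =
      normc c * normc (f_ j (@spread d X n V s) - f (@spread d X n V s)).
    rewrite /weighted -!mulrA -mulrBl normcM normcM normc_Qpartition mul1r.
    by rewrite mulrC.
  under eq_fun do rewrite E.
  have : (fun j => normc c * normc (f_ j (@spread d X n V s) -
      f (@spread d X n V s))) @ \oo --> normc c * 0 by apply: cvgMl_tmp; exact: cvf.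
  by rewrite mulr0.
Qed.

End moment_functionals.

Lemma polish_hausdorff (R : realType) (T : ptopologicalType) :
  polish_space R T -> hausdorff_space T.
Proof.
move=> [_ [dist [d0 dC dT nbhsE _]]] p r pr.
have [d_ge0 _] := d0 p r.
apply: (d0 p r).2.1; apply/eqP; rewrite eq_le d_ge0 andbT leNgt; apply/negP => dpr.
have e0 : 0 < dist p r / 2 by rewrite divr_gt0.
have ball_nbhs z : nbhs z [set y | dist z y < dist p r / 2].
  by apply/(nbhsE z); exists (dist p r / 2).
have [z [/= pz rz]] := pr _ _ (ball_nbhs p) (ball_nbhs r).
have := dT p z r; rewrite leNgt => /negP; apply.
by rewrite (dC z r) [ltRHS](splitr (dist p r)) ltrD.
Qed.

Lemma compact_borel_measurable (R : realType) (T : ptopologicalType) :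
  polish_space R T -> forall L : set T, compact L -> measurable (L : set (borel T)).
Proof.
move=> PT L cL; have clL := compact_closed (polish_hausdorff PT) cL.
rewrite -(setCK (L : set (borel T))); apply: measurableC.
by apply: sub_sigma_algebra; exact: closed_openC.
Qed.

Section extended_Q.
Context d (X : measurableType d) (R : realType).
Variables (A : set (X * X)) (Q : X -> X -> R[i]).

Lemma normc_extendQ : (forall s t, ~ A (s, t) -> `|Q s t| = 1) ->
  forall s t, normc (extendQ A Q s t) = 1.
Proof.
move=> Q1 s t; rewrite /extendQ; case: asboolP => [_|/Q1]; first exact: normc1.
by case: (Q s t) => a b; rewrite normc_def /= => /complexI.
Qed.

Lemma cmeasurable_extendQ : measurable A ->
  cmeasurable (~` A) (fun p => Q p.1 p.2) ->
  cmeasurable setT (fun p : X * X => extendQ A Q p.1 p.2).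
Proof.
move=> mA [Qr Qi].
have glue (u : R[i] -> R) : measurable_fun (~` A) (fun p => u (Q p.1 p.2)) ->
    measurable_fun setT (fun p : X * X => u (extendQ A Q p.1 p.2)).
  move=> mu; rewrite -(setUv A); apply/measurable_funU => //; first exact: measurableC.
  split.
    apply: (eq_measurable_fun (cst (u 1))); last exact: measurable_cst.
    by move=> [s t] /set_mem Ast; rewrite /extendQ asboolT.
  apply: eq_measurable_fun mu => -[s t] /set_mem Ast.
  by rewrite /extendQ asboolF.
by split; exact: glue.
Qed.

End extended_Q.

Section vacuum_vector.
Context d (X : measurableType d) (R : realType).
Variable sigma : {sigma_finite_measure set X -> \bar R}.
Variable q : X -> X -> R[i].

Lemma fock_fin_vacuum : fock_fin sigma q (@vacuum _ X R).
Proof.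
split; last by exists 1%N => -[//|n] _; exact: aeW.
(* The empty set will do as support: the only nonzero component of the vacuum has no variables. *)
have [vK _] := @box_vector_vacuum _ X R set0.
move=> n; have vL : square_integrable (tuple_measure sigma n) (@vacuum _ X R n).
  apply: (@box_fun_square_integrable _ _ _ _ set0) => //.
  by rewrite measure0 ltry.
split=> //; exists (@vacuum _ X R n) => //.
by have [_] := represents_vacuum sigma q n.
Qed.

End vacuum_vector.

(** * Equality of the two functionals *)

Section moments.
Context (R : realType) (T : ptopologicalType).
Variable sigma : {sigma_finite_measure set (borel T) -> \bar R}.
Variable q : borel T -> borel T -> R[i].
Hypotheses (qK : forall s t, q s t * q t s = 1)
  (q1 : forall s t, normc (q s t) = 1)
  (mq : cmeasurable setT (fun p : borel T * borel T => q p.1 p.2)).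
Hypotheses (compact_meas : forall L : set T, compact L -> measurable (L : set (borel T)))
  (compact_fin : forall L : set T, compact L -> (sigma L < +oo)%E).
Variables (lambda : R) (n : nat)
  (W : (n.-tuple (borel T) -> R[i]) ->
       fock_vector (borel T) R -> fock_vector (borel T) R).
Hypothesis W_monomial : monomial_operators sigma q lambda W.
Local Notation vac := (@vacuum _ (borel T) R).
Local Notation parts := (partitions_ge2 n).

Let wt (V : {set {set 'I_n}}) : R[i] := (\prod_(B in V) lambda ^+ (#|B| - 2))%:C%C.

Let moment (V : {set {set 'I_n}}) g := partition_moment sigma q V (wt V) g.

Let D (f : n.-tuple (borel T) -> R[i]) : R[i] :=
  W f vac [tuple] - \sum_(V in parts) moment V f.

Let vac_fin : fock_fin sigma q vac. Proof. exact: fock_fin_vacuum. Qed.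

Lemma B0C_box_fun (f : n.-tuple (borel T) -> R[i]) (L : set T) : B0C f ->
  (forall t, (exists i, ~ L (tnth t i)) -> f t = 0) -> box_fun (L : set (borel T)) f.
Proof. by move=> [mf [M [K _ [fM _]]]] f0; split=> //; exists M. Qed.

Let D_linear (f g : n.-tuple (borel T) -> R[i]) c : B0C f -> B0C g -> D (fun t => c * f t + g t) = c * D f + D g.
Proof.
move=> fB gB; have [L1 cL1 f0] := B0C_support fB; have [L2 cL2 g0] := B0C_support gB.
have cL : compact (L1 `|` L2) by exact: compactU.
have fK : box_fun (L1 `|` L2 : set (borel T)) f.
  by apply: (B0C_box_fun fB) => t [k tk]; apply: f0; exists k => tL; apply: tk; left.
have gK : box_fun (L1 `|` L2 : set (borel T)) g.
  by apply: (B0C_box_fun gB) => t [k tk]; apply: g0; exists k => tL; apply: tk; right.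
have momentE : \sum_(V in parts) moment V (fun t => c * f t + g t) =
    c * \sum_(V in parts) moment V f + \sum_(V in parts) moment V g.
  rewrite mulr_sumr -big_split; apply: eq_bigr => V VP /=.
  exact: (partition_moment_linear q1 mq (compact_meas cL) (compact_fin cL)).
rewrite /D; have /(_ 0) /tuple_measure0 -> // := monomial_linear W_monomial c fB gB vac_fin.
by rewrite /fock_lin momentE; ring.
Qed.

Let D_tensor (f : 'I_n -> borel T -> R) : (forall i, B0 (f i)) -> D (tensor f) = 0.
Proof.
move=> fB; rewrite /D.
have /(_ 0) /tuple_measure0 -> // := monomial_tensor W_monomial fB vac_fin.
(* Each [f i] comes with its own compact support; the union of these is the common set [K]. *)
have [L LP] := boolp.choice (fun i => let: And3 _ _ (ex_intro2 L cL f0) := fB i in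
  ex_intro (fun L : set T => compact L /\ forall t, ~ L t -> f i t = 0) L (conj cL f0)).
pose K : set T := \big[setU/set0]_(i < n) L i.
have cK : compact K by apply: bigsetU_compact => i _; case: (LP i).
have fK i : supported_fun (K : set (borel T)) (f i).
  have [mf [M fM] _] := fB i; have [_ f0] := LP i; split=> //; first by exists M.
  move=> x xK; apply: f0 => xL; apply: xK; rewrite /K -bigcup_seq; exists i => //=.
  exact: mem_index_enum.
rewrite (field_product_moment qK q1 mq (compact_meas cK) (compact_fin cK) lambda fK).
by rewrite subrr.
Qed.

Let D_lim (f_ : nat -> n.-tuple (borel T) -> R[i]) (f : n.-tuple (borel T) -> R[i])
    (M : R) (K : set {ptws 'I_n -> T}) :
  (forall j, B0C (f_ j)) -> B0C f -> compact K ->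
  (forall j, bounded_supported M K (f_ j)) ->
  (forall t, (fun j => normc (f_ j t - f t)) @ \oo --> (0 : R)) ->
  (forall j, D (f_ j) = 0) -> D f = 0.
Proof.
move=> fjB fB cK fjK cvf Dj.
have [L cL LK] := compact_support_box cK.
have fjL j : box_fun (L : set (borel T)) (f_ j).
  by apply: (B0C_box_fun (fjB j)) => t /LK; have [_] := fjK j; apply.
(* That [f] is supported in the same [L] comes from the limit: it vanishes where all [f_ j] do. *)
have fL : box_fun (L : set (borel T)) f.
  apply: (B0C_box_fun fB) => t tL; apply: eq0_normc.
  have E : (fun j => normc (f_ j t - f t)) = cst (normc (f t)).
    by apply/funext => j; have [_ _ f0] := fjL j; rewrite f0// sub0r normcN.
  by have := cvf t; rewrite E => /cvg_lim <-//; rewrite lim_cst.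
have [_ /(_ 0) cvW] := monomial_continuous W_monomial fjB fB cK fjK cvf vac_fin.
pose w j := normc (W (f_ j) vac [tuple] - W f vac [tuple]).
have w0 : w @ \oo --> (0 : R).
  (* On 0-tuples the squared norm is the squared modulus at [[tuple]]; a square root then gives
     convergence of the vacuum components. *)
  have wE j : sqnorm (tuple_measure sigma 0)
      (fun t => W (f_ j) vac t - W f vac t) = (w j ^+ 2)%:E.
    rewrite /sqnorm (fun_tuple0 (fun t => (normc (W (f_ j) vac t - W f vac t) ^+ 2)%:E)).
    by rewrite /= integral_dirac// diracT mul1e.
  have w2 : (fun j => w j ^+ 2) @ \oo --> (0 : R).
    by move: cvW; under eq_fun do rewrite wE; move=> /fine_cvg.
  have -> : w = (fun j => Num.sqrt (w j ^+ 2)).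
    by apply/funext => j; rewrite sqrtr_sqr ger0_norm ?normc_ge0.
  by rewrite -(sqrtr0 R); exact: (continuous_cvg _ (@sqrt_continuous R 0) w2).
pose b j := w j + \sum_(V in parts) normc (moment V (f_ j) - moment V f).
have b0 : b @ \oo --> (0 : R).
  have -> : (0 : R) = 0 + \sum_(V in parts) 0 by rewrite big1 ?addr0.
  apply: cvgD => //; apply: cvg_big => [|V VP]; first exact: add_continuous.
  apply: (partition_moment_cvg q1 mq (compact_meas cL) (compact_fin cL) _ _ fjL fL) => //.
  by move=> j; have [] := fjK j.
(* Since [D (f_ j)] is 0, [D f] is a difference of [W]-values plus differences of moments, all
   tending to 0. *)
have Db j : normc (D f) <= b j.
  have -> : D f = (W f vac [tuple] - W (f_ j) vac [tuple]) +
      \sum_(V in parts) (moment V (f_ j) - moment V f).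
    have /eqP := Dj j; rewrite subr_eq0 => /eqP ->.
    by rewrite /D big_split /= sumrN addrA subrK.
  rewrite (le_trans (le_normcD _ _))// lerD//; first by rewrite -normcN opprB.
  elim/big_ind2 : _ => [|x1 x2 y1 y2 h1 h2|//]; first by rewrite normc0.
  by rewrite (le_trans (le_normcD _ _))// lerD.
apply: eq0_normc.
have Dlim : cst (normc (D f)) @ \oo --> (0 : R).
  apply: (squeeze_cvgr _ (cvg_cst 0) b0).
  by apply: nearW => j; rewrite normc_ge0 Db.
by have /cvg_lim <- := Dlim => //; rewrite lim_cst.
Qed.

Lemma moments_formula f : B0C f ->
  W f vac [tuple] = \sum_(V in parts) moment V f.
Proof.
move=> fB; apply/eqP; rewrite -subr_eq0; apply/eqP.
exact: (tensor_density compact_meas D_linear D_tensor D_lim fB).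
Qed.

End moments.

Theorem corollary4p8 (R : realType) (T : ptopologicalType)
  (T_polish : polish_space R T) (T_lc : locally_compact [set: T])
  (sigma : {sigma_finite_measure set (borel T) -> \bar R})
  (sigma_radon : radon_measure sigma) (sigma_na : non_atomic sigma)
  (A : set (borel T * borel T)) (A_meas : measurable A)
  (A_sym : forall s t, A (s, t) -> A (t, s)) (A_diag : forall t, A (t, t))
  (A_null : (sigma \x sigma)%E A = 0%E)
  (Q : borel T -> borel T -> R[i])
  (Q_meas : cmeasurable (~` A) (fun p => Q p.1 p.2))
  (Q_unit : forall s t, ~ A (s, t) -> `|Q s t| = 1)
  (Q_conj : forall s t, ~ A (s, t) -> Q s t = (Q t s)^*%C)
  (lambda : R) (n : nat)
  (W : (n.-tuple (borel T) -> R[i]) ->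
       fock_vector (borel T) R -> fock_vector (borel T) R)
  (W_monomial : monomial_operators sigma (extendQ A Q) lambda W)
  (f : n.-tuple (borel T) -> R[i]) (f_B0 : B0C f) :
  vacuum_state sigma (W f) =
  \sum_(V in partitions_ge2 n)
    cintegral (delta_partition sigma V)
      (fun t => f t * Qpartition (extendQ A Q) V t *
                (\prod_(B in V) lambda ^+ (#|B| - 2))%:C%C).
Proof.
rewrite vacuum_stateE; apply: (moments_formula _ _ _ _ _ W_monomial f_B0).
- exact: extendQV.
- exact: normc_extendQ.
- exact: cmeasurable_extendQ.
- exact: compact_borel_measurable T_polish.
- by move=> L cL; case: sigma_radon => + _; apply.
Qed.
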